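(* For every numerical constant $\kappa>0$ and all $L\ge\mu>0$, $\sigma>0$, there is a constant $C$, depending only on $\kappa$, universal numerical constants and the fixed parameters $L,\mu,\sigma$, such that the following holds. Let $T\ge 1$ be an integer, $0<\delta<1$, $d\ge 2$, and let the deterministic initial point satisfy $x_0\ne x^*$. Suppose that $f$ is $L$-smooth and $\mu$-strongly convex; that for almost every $\xi$ the function $f(\cdot;\xi)$ is $L$-smooth, $(x,\xi)\mapsto\nabla f(x;\xi)$ is jointly measurable, and $\mathbb{E}_\xi[\nabla f(x;\xi)]=\nabla f(x)$ for all $x$; and that $\mathbb{E}_\xi[\exp(\lambda\|\nabla f(x)-\nabla f(x;\xi)\|^2)]\le\exp(\lambda\sigma^2)$ for all $x\in\mathbb{R}^d$ and $\lambda\in(0,\sigma^{-2})$. Run the same-sample two-point Gaussian zeroth-order SGD algorithm (described in the context) for $T$ iterations from $x_0$. If $T_0\ge\kappa\,\Gamma_T(\delta)$, then with probability at least $1-\delta$, $$ f(x_T)-f(x^* )\le C\Big[\frac{T_0\Delta_0}{T+T_0}+\frac{d\,\Lambda\,\Gamma_T(\delta)}{T+T_0}\Big(1+\frac{\Gamma_T(\delta)}{T_0}\Big)\Big]. $$ In particular, suppressing fixed problem parameters ($L,\mu,\sigma,\Delta_0$) and logarithmic factors, $f(x_T)-f(x^* )=\widetilde{\mathcal{O}}(d/T)$ on this event.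
   Context: Problem: $f:\mathbb{R}^d\to\mathbb{R}$, $f(x)=\mathbb{E}_\xi[f(x;\xi)]$ for a random sample $\xi$; $\|\cdot\|$ is the Euclidean norm; $x^*$ is the unique minimizer of $f$. ''$f$ is $L$-smooth and $\mu$-strongly convex'' means $f$ is differentiable and $f(x)+\langle\nabla f(x),y-x\rangle+\frac{\mu}{2}\|y-x\|^2\le f(y)\le f(x)+\langle\nabla f(x),y-x\rangle+\frac{L}{2}\|y-x\|^2$ for all $x,y$. ''$f(\cdot;\xi)$ is $L$-smooth'' means it is differentiable with $L$-Lipschitz gradient. Algorithm (same-sample two-point Gaussian zeroth-order SGD). Input: deterministic $x_0\in\mathbb{R}^d$ and horizon $T$. Set $T_0=32dL/\mu$ and $\alpha=1/\sqrt{d(T+T_0)}$. For $t=0,\dots,T-1$: draw $u_t\sim\mathcal{N}(0,I_d)$ and, independently, a fresh sample $\xi_t$ distributed as $\xi$ (both independent of the past); set $\eta_t=\frac{4d}{\mu(t+T_0)\|u_t\|^2}$ (and $\eta_t=0$ if $u_t=0$); set $g_t=\frac{f(x_t+\alpha u_t;\xi_t)-f(x_t-\alpha u_t;\xi_t)}{2\alpha}\,u_t$; update $x_{t+1}=x_t-\eta_tg_t$. Output $x_T$. Notation: $\Lambda:=\log(T+T_0)$; $J_T:=1+\big\lceil\log_2\big(\tfrac{T(T+T_0)}{T_0}\big)\big\rceil$; $\Delta_0:=f(x_0)-f(x^* )$; $\Gamma_T(\delta):=1+\log\frac1\delta+\log J_T+\log(e+T_0)$. *)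

(* Defs.v *)
From HB Require Import structures.
From mathcomp Require Export all_boot all_order all_algebra.
From mathcomp Require Export all_classical all_reals all_analysis.
Set Implicit Arguments.
Unset Strict Implicit.
Unset Printing Implicit Defensive.
Export Order.TTheory GRing.Theory Num.Theory.
Export numFieldNormedType.Exports.
Local Open Scope classical_set_scope.
Local Open Scope ring_scope.

Section Euclidean.
Context {R : realType} {d : nat}.
Implicit Types (x y : 'rV[R]_d) (h : 'rV[R]_d -> R).

(* The library norm on 'rV[R]_d is the sup norm, so the Euclidean structure
   is given explicitly.  Both norms induce the same notion of
   differentiability, which is therefore the library one. *)
Definition dotp x y : R := \sum_(i < d) x 0 i * y 0 i.
Definition enorm x : R := Num.sqrt (dotp x x).

Definition grad h x : 'rV[R]_d := \row_(i < d) 'D_(delta_mx 0 i) h x.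

Definition smooth_strongly_convex (L mu : R) h : Prop :=
  (forall x, differentiable h x) /\
  (forall x y,
     h x + dotp (grad h x) (y - x) + mu / 2 * enorm (y - x) ^+ 2 <= h y /\
     h y <= h x + dotp (grad h x) (y - x) + L / 2 * enorm (y - x) ^+ 2).

Definition lipschitz_smooth (L : R) h : Prop :=
  (forall x, differentiable h x) /\
  (forall x y, enorm (grad h x - grad h y) <= L * enorm (x - y)).

Definition unique_minimizer h x : Prop := forall y, y != x -> h x < h y.

End Euclidean.

(* 'rV[R]_d with its Borel sigma-algebra. *)
Notation borel_rV R d := (g_sigma_algebraType (@open 'rV[R]_d)).

Section Probability.
Context {R : realType}.

Definition has_expectation {dX : measure_display} {X : measurableType dX}
    (D : probability X R) (h : X -> R) (m : R) : Prop :=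
  D.-integrable setT (EFin \o h) /\ ('E_D[h] = m%:E)%E.

(* nu is N(0, I_d), i.e. the d-fold product of N(0, 1): boxes generate the
   Borel sets, so this determines nu. *)
Definition std_gaussian {d : nat} (nu : set (borel_rV R d) -> \bar R) : Prop :=
  forall A : 'I_d -> set (measurableTypeR R), (forall i, measurable (A i)) ->
    nu [set x : 'rV[R]_d | forall i, A i (x 0 i)] =
    (\prod_(i < d) normal_prob (0 : R) 1 (A i))%E.

(* Mutual independence of the 2T random elements u_0, xi_0, ..., u_(T-1),
   xi_(T-1); the product rule for subfamilies is the case of A t or B t being
   the whole space. *)
Definition independent_draws {dW dU dX : measure_display}
    {W : measurableType dW} {U : measurableType dU} {X : measurableType dX}
    (P : probability W R) (T : nat)
    (u : nat -> {RV P >-> U}) (xi : nat -> {RV P >-> X}) : Prop :=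
  forall (A : 'I_T -> set U) (B : 'I_T -> set X),
    (forall t, measurable (A t)) -> (forall t, measurable (B t)) ->
    P [set w | forall t : 'I_T, A t (u t w) /\ B t (xi t w)] =
    (\prod_(t < T) (P (u t @^-1` A t) * P (xi t @^-1` B t)))%E.

End Probability.

Section Algorithm.
Context {R : realType} {d : nat} {X : Type}.
Variables (F : 'rV[R]_d -> X -> R) (L mu : R) (T : nat) (x0 : 'rV[R]_d).

Definition offset : R := 32 * d%:R * L / mu.

Definition smoothing : R := (Num.sqrt (d%:R * (T%:R + offset)))^-1.

Definition step_size (t : nat) (v : 'rV[R]_d) : R :=
  if v == 0 then 0 else 4 * d%:R / (mu * (t%:R + offset) * enorm v ^+ 2).

Definition two_point_estimate (x v : 'rV[R]_d) (s : X) : 'rV[R]_d :=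
  ((F (x + smoothing *: v) s - F (x - smoothing *: v) s) / (2 * smoothing))
    *: v.

(* The iterate x_t along one realization u, xi of the random draws. *)
Fixpoint zo_sgd (u : nat -> 'rV[R]_d) (xi : nat -> X) (t : nat) : 'rV[R]_d :=
  if t is t'.+1 then
    let x := zo_sgd u xi t' in
    x - step_size t' (u t') *: two_point_estimate x (u t') (xi t')
  else x0.

End Algorithm.

Section Rates.
Context {R : realType}.

(* T0 stands for [offset]. *)
Definition num_phases (T : nat) (T0 : R) : R :=
  1 + (Num.ceil (ln (T%:R * (T%:R + T0) / T0) / ln 2))%:~R.

Definition Gamma (T : nat) (T0 delta : R) : R :=
  1 + ln (1 / delta) + ln (num_phases T T0) + ln (expR 1 + T0).

Definition error_bound (d T : nat) (T0 delta Delta0 : R) : R :=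
  let G := Gamma T T0 delta in
  T0 * Delta0 / (T%:R + T0) +
  d%:R * ln (T%:R + T0) * G / (T%:R + T0) * (1 + G / T0).

(* d / T up to logarithmic factors: the k-th power of a logarithm of all the
   varying parameters, kept >= 1. *)
Definition polylog_rate (k d T : nat) (delta : R) : R :=
  d%:R / T%:R * ln (expR 1 + d%:R + T%:R + 1 / delta) ^+ k.

End Rates.

(* Main.v *)
From HB Require Import structures.
Require Import Defs.
From mathcomp Require Import perm measurable_realfun.
From mathcomp Require Import ring lra.
Set Implicit Arguments.
Unset Strict Implicit.
Unset Printing Implicit Defensive.
Local Open Scope classical_set_scope.
Local Open Scope ring_scope.

(** Write gap x = f x - f xstar and tau t = t + T0, and consider the potential
      S_t x = tau t * gap x + K d p h_t,   h_t = 1 + sum_(t <= s < T) 1 / tau s.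
    The proof shows that S_t (x_t) ^ p is a supermartingale ([potential_step],
    [potential_high_probability]) for every exponent p up to a constant
    multiple of d. One application of Markov's inequality, at the final time
    only, then gives S_T (x_T) <= delta ^ (- 1 / p) S_0 (x_0) with probability
    at least 1 - delta. The exponent is p = c Gamma: since Gamma is at least
    ln (1 / delta), the factor delta ^ (- 1 / p) is at most exp (1 / c), and the
    hypothesis kappa Gamma <= T0 = 32 d L / mu is what keeps p below the
    multiple of d. Dividing by tau T = T + T0 gives the rate, because
    h_0 = O(ln (T + T0)).

    The supermartingale property comes from one step of the algorithm. Let a
    and b be the components of the gradient of f and of the gradient noise n
    along the random direction u / |u|, let gamma = 4 d / (mu tau) and let alpha
    be the radius of the finite difference. Smoothness gives [sgd_step_le]:
      f x' - f x <= - 3/4 gamma a^2 - gamma a b + 2 L gamma^2 b^2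
                    + 3 gamma L^2 alpha^2 |u|^2.
    Convexity of the exponential reduces the exponential moment of the right
    side to four separate ones ([one_step_exp_moment]).
    - Descent: the direction is spread out, so a^2 is of order |grad f|^2 / d
      with a bounded kurtosis, and its Laplace transform decreases accordingly
      ([gaussian_direction_laplace]).
    - Cross term: given u it is a centred sub-Gaussian variable whose variance
      proxy is a multiple of a^2, hence it is absorbed by part of the descent
      ([noise_mgf]).
    - Noise: only a fraction 1 / d of |n|^2 is seen along a random direction
      ([gaussian_direction_second_moment], [noise_sqr_exp]).
    - Finite difference error: alpha is so small that it is of the same order
      as the noise ([gaussian_expR_norm]).
    Strong convexity bounds |grad f|^2 below by 2 mu gap, so the descent beats
    the growth of the weight tau; the two error terms are paid for by the
    decrease of h_t. The summand K d p h_t also bounds the potential from below,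
    which keeps all exponents in the range where the four estimates hold.

    The Gaussian law is only given through the probabilities of boxes. All the
    facts about random directions are derived from its coordinate marginals and
    its invariance under sign changes and permutations of the coordinates: sign
    changes remove the odd terms from the moments of sum_i w_i u_i r(|u|^2), as
    in Khintchine's inequality, and permutations make the remaining terms equal.

    Conditioning on the past is replaced by a pi-system of events that involve
    the first draws: the iterate is measurable for the sigma-algebra which it
    generates, and independence lets the sample and then the direction be
    integrated out ([integral_independent_pair]). *)

(** * Borel sets of row vectors *)

Section BorelRowVectors.
Context {R : realType} {d : nat}.
Implicit Types x y : 'rV[R]_d.

Definition rV_box (A : 'I_d -> set (measurableTypeR R)) : set (borel_rV R d) :=
  [set x : 'rV[R]_d | forall i, A i (x 0 i)].

Definition rV_boxes : set (set (borel_rV R d)) :=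
  [set B | exists2 A, (forall i, measurable (A i)) & B = rV_box A].

Let rat_box (k : 'rV[rat]_d * nat) : set (borel_rV R d) :=
  rV_box (fun i => ball (ratr (k.1 0 i) : R) (k.2.+1%:R^-1)).

(** The rational boxes contained in an open set cover it, and there are only
    countably many of them; hence open sets lie in the sigma-algebra generated
    by boxes. *)
Lemma open_bigcup_rat_box (O : set 'rV[R]_d) : open O ->
  O = \bigcup_(k in [set k | rat_box k `<=` O]) rat_box k.
Proof.
move=> oO; apply/seteqP; split => [x Ox|x [k /= kO kx]]; last exact: kO.
have [/= e e0 eO] : exists2 e : R, 0 < e & ball x e `<=` O.
  by apply/nbhs_ballP; move: oO; rewrite openE; exact.
have [n en] : exists n, n.+1%:R^-1 < e / 2.
  exists (Num.trunc (e / 2)^-1).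
  rewrite invf_plt ?posrE ?ltr0n ?divr_gt0//.
  by rewrite truncnS_gt// .
have n0 : 0 < n.+1%:R^-1 :> R by rewrite invr_gt0 ltr0n.
have /all_sig[q qx] i : {q : rat | ratr q \in `]x 0 i, (x 0 i + n.+1%:R^-1)[}.
  by apply/cid/rat_in_itvoo; rewrite ltrDl.
(* The box around q has radius 1 / (n + 1) < e / 2 and q is that close to x, so
it stays in the ball of radius e around x. *)
exists (\row_i q i, n) => /=.
  move=> y; rewrite /rat_box /rV_box/= => yq.
  apply: eO; split=> // i j; rewrite (ord1 i).
  have := yq j; have := qx j; rewrite mxE in_itv/= -!ball_normE /ball_/=.
  move=> /andP[q1 q2]; rewrite !ltr_norml => /andP[y1 y2]; apply/andP.
  by move: (_^-1) (y _ _) (x _ _) (ratr _) en y1 y2 q1 q2 => z a b c; split; lra.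
move=> i; rewrite mxE -ball_normE /ball_/=.
have := qx i; rewrite in_itv/= => /andP[q1 q2].
rewrite ltr_norml; apply/andP; by move: (_^-1) (x _ _) (ratr _) n0 q1 q2 => z b c; split; lra.
Qed.

Lemma open_sub_boxes : @open 'rV[R]_d `<=` <<s rV_boxes >>.
Proof.
move=> O oO; rewrite (open_bigcup_rat_box oO) bigcup_mkcond.
have -> : <<s rV_boxes >> = @measurable _ (g_sigma_algebraType rV_boxes) by [].
apply: countable_bigcupT_measurable => // k; case: ifPn => // _.
apply: sub_sigma_algebra; exists (fun i => ball (ratr (k.1 0 i) : R) (k.2.+1%:R^-1)) => //.
by move=> i; exact: measurable_ball.
Qed.

Lemma measurable_coord (i : 'I_d) :
  measurable_fun [set: borel_rV R d] (fun x : borel_rV R d => (x : 'rV[R]_d) 0 i).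
Proof.
apply: (measurability _ (RGenOpens.measurableE R)).
move=> _ [_ [a [b ->] <-]]; rewrite setTI; apply: sub_sigma_algebra.
have /continuousP := @coord_continuous R 1 d 0 i.
by apply; exact: interval_open.
Qed.

Lemma measurable_box (A : 'I_d -> set (measurableTypeR R)) :
  (forall i, measurable (A i)) -> measurable (rV_box A).
Proof.
move=> mA; rewrite (_ : rV_box A =
  \bigcap_(i in [set: 'I_d]) ((fun x : borel_rV R d => (x : 'rV[R]_d) 0 i) @^-1` A i)).
  apply: fin_bigcap_measurable => // i _; rewrite -[X in measurable X]setTI.
  exact: (@measurable_coord i measurableT _ (mA i)).
by apply/seteqP; split => [x Ax i _|x Ax i]; [exact: Ax|exact: Ax i I].
Qed.

Lemma borel_rV_boxes : @measurable _ (borel_rV R d) = <<s rV_boxes >>.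
Proof.
apply/seteqP; split.
  apply: smallest_sub; first exact: smallest_sigma_algebra.
  exact: open_sub_boxes.
apply: smallest_sub; first exact: sigma_algebra_measurable.
by move=> _ [A mA ->]; exact: measurable_box.
Qed.

Lemma continuous_measurable_rV (h : 'rV[R]_d -> R) : continuous h ->
  measurable_fun [set: borel_rV R d] h.
Proof.
move=> /continuousP hc.
apply: (measurability _ (RGenOpens.measurableE R)).
move=> _ [_ [a [b ->] <-]]; rewrite setTI.
by apply: sub_sigma_algebra; apply: hc; exact: interval_open.
Qed.

Lemma measurable_rV {dW} {W : measurableType dW} (f : W -> borel_rV R d) :
  (forall i, measurable_fun setT (fun w => (f w : 'rV[R]_d) 0 i)) ->
  measurable_fun setT f.
Proof.
move=> mf; apply: (measurability _ borel_rV_boxes).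
move=> _ [_ [A mA ->] <-]; rewrite setTI.
rewrite (_ : _ @^-1` _ =
  \bigcap_(i in [set: 'I_d]) ((fun w => (f w : 'rV[R]_d) 0 i) @^-1` A i)).
  apply: fin_bigcap_measurable => // i _; rewrite -[X in measurable X]setTI.
  exact: (mf i measurableT _ (mA i)).
by apply/seteqP; split => [x Ax i _|x Ax i]; [exact: Ax|exact: Ax i I].
Qed.

Lemma box_setI : setI_closed rV_boxes.
Proof.
move=> _ _ [A mA ->] [B mB ->]; exists (fun i => A i `&` B i).
  by move=> i; exact: measurableI.
by apply/seteqP; split => [x [Ax Bx] i|x ABx]; split => // i; have [] := ABx i.
Qed.

(** Boxes form a pi-system that generates the Borel sets. Identities between
    laws of random vectors are obtained by checking them on boxes. *)
Lemma box_measure_unique (m1 m2 : {measure set (borel_rV R d) -> \bar R}) :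
  (m1 setT < +oo)%E ->
  (forall A, (forall i, measurable (A i)) -> m1 (rV_box A) = m2 (rV_box A)) ->
  forall B, measurable B -> m1 B = m2 B.
Proof.
move=> m1oo m12; apply: (measure_unique rV_boxes (fun=> setT)) => //.
- exact: borel_rV_boxes.
- exact: box_setI.
- by move=> _; exists (fun=> setT) => //; apply/seteqP; split.
- by rewrite bigcup_const.
- by move=> _ [A mA ->]; exact: m12.
Qed.

End BorelRowVectors.

(** * The one-dimensional normal law *)

Section NormalDistribution.
Context {R : realType}.
Notation leb := (@lebesgue_measure R).
Notation N01 := (normal_prob (0 : R) 1).

Import HBNNSimple.

(** The density formula holds for simple functions by linearity, and for
    nonnegative functions by monotone convergence. *)
Lemma ge0_integral_normal_prob (m s : R) (f : measurableTypeR R -> \bar R) :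
  measurable_fun setT f -> (forall x, (0 <= f x)%E) ->
  (\int[normal_prob m s]_x f x = \int[leb]_x (f x * (normal_pdf m s x)%:E))%E.
Proof.
move=> mf f0; set g := normal_pdf m s.
have mg : measurable_fun [set: measurableTypeR R] (EFin \o g).
  by apply/measurable_EFinP; exact: measurable_normal_pdf.
have g0 x : (0 <= (g x)%:E)%E by rewrite lee_fin normal_pdf_ge0.
pose f_ := nnsfun_approx measurableT mf.
have f_cvg x : (f_ n x)%:E @[n --> \oo] --> f x.
  by apply: cvg_nnsfun_approx => // y _; exact: f0.
transitivity (lim (\int[normal_prob m s]_x (f_ n x)%:E @[n --> \oo])%E).
  rewrite -monotone_convergence//=.
  - by apply: eq_integral => x _; apply/esym/cvg_lim.
  - by move=> n; apply/measurable_EFinP; exact: measurable_funPT.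
  - by move=> n x _; rewrite lee_fin.
  - by move=> x _ a b ab; rewrite lee_fin; exact/lefP/nd_nnsfun_approx.
transitivity (lim (\int[leb]_x ((f_ n x)%:E * (g x)%:E) @[n --> \oo])%E); last first.
  rewrite -monotone_convergence//=.
  - apply: eq_integral => x _; apply/cvg_lim => //.
    apply: cvgeZr => //.
  - move=> n; apply: emeasurable_funM => //.
    by apply/measurable_EFinP; exact: measurable_funPT.
  - by move=> n x _; rewrite mule_ge0 // lee_fin.
  - move=> x _ a b ab; apply: lee_wpmul2r => //.
    by rewrite lee_fin; exact/lefP/nd_nnsfun_approx.
apply: congr_lim; apply/funext => n /=; move: (f_ n) => h {f_ f_cvg}.
rewrite integral_nnsfun// patch_setT sintegralE.
under [RHS]eq_integral => x _.
  rewrite fimfunE -fsumEFin// ge0_mule_fsuml; last first.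
    by move=> r; rewrite EFinM nnfun_muleindic_ge0.
  over.
rewrite ge0_integral_fsum//; last 2 first.
- move=> r; apply: emeasurable_funM => //; apply/measurable_EFinP.
  by apply: measurable_funM.
- by move=> r x _; rewrite mule_ge0// EFinM nnfun_muleindic_ge0.
apply: eq_fsbigr => r /[!inE] -[y _ hyr].
have r0 : (0 <= r)%R by rewrite -hyr.
under eq_integral do rewrite EFinM -muleA.
rewrite ge0_integralZl//; last 2 first.
- by apply: emeasurable_funM => //; apply/measurable_EFinP.
- by move=> x _; rewrite mule_ge0// lee_fin.
congr (_ * _)%E; transitivity (\int[leb]_(y in h @^-1` [set r]) (g y)%:E)%E => //; rewrite [LHS]integral_mkcond; apply: eq_integral => x _.
rewrite patchE indicE; case: ifPn => _; first by rewrite mul1e.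
by rewrite mul0e.
Qed.

Lemma measurable_expR_sqr (a : R) :
  measurable_fun setT (fun x : measurableTypeR R => expR (a * (x : R) ^+ 2)).
Proof.
apply: measurableT_comp => //.
by apply: measurable_funM => //; exact: exprn_measurable.
Qed.

(** The standard normal density times exp (3 x^2 / 8) is twice the density of
    the centred normal law with standard deviation 2. *)
Lemma normal_expR_sqr :
  (\int[N01]_x (expR (3 / 8 * x ^+ 2))%:E = 2%:E)%E.
Proof.
rewrite ge0_integral_normal_prob; [|by apply/measurable_EFinP; exact: measurable_expR_sqr|]; last first.
  by move=> x; rewrite lee_fin expR_ge0.
transitivity (\int[leb]_x (2%:E * (normal_pdf 0 2 x)%:E))%E.
  apply: eq_integral => x _; rewrite -!EFinM !normal_pdfE ?oner_eq0//.
  congr (_%:E); rewrite mulrCA (mulrA 2); congr (_ * _).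
    rewrite /normal_peak expr1n mul1r.
    rewrite -mulrnAr.
    rewrite sqrtrM ?sqr_ge0// sqrtr_sqr ger0_norm// invfM mulrA divff ?mul1r//.
  by rewrite /normal_fun -expRD; congr expR; rewrite subr0; field.
rewrite ge0_integralZl//=.
- by rewrite integral_normal_pdf mule1.
- by apply/measurable_EFinP; exact: measurable_normal_pdf.
- by move=> x _; rewrite lee_fin normal_pdf_ge0.
Qed.

(** The standard normal density is at most 1 / 2 and the interval has length
    2 e. *)
Lemma normal_small_ball (e : R) : 0 <= e ->
  (N01 (ball (0%R : R) e : set (measurableTypeR R)) <= e%:E)%E.
Proof.
move=> e0; rewrite /normal_prob; set D := ball _ _.
have mD : measurable (D : set (measurableTypeR R)) by exact: measurable_ball.
have peak : normal_peak (1 : R) <= 2^-1.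
  rewrite /normal_peak expr1n mul1r lef_pV2 ?posrE ?sqrtr_gt0//; last first.
    by rewrite mulrn_wgt0// pi_gt0.
  rewrite -[leLHS]ger0_norm// -sqrtr_sqr ler_wsqrtr//.
  by have := pi_ge2 R; rewrite -mulr_natr; lra.
have le1 : (\int[leb]_(x in D) (normal_pdf 0 1 x)%:E <=
            \int[leb]_(x in D) (2^-1)%:E)%E.
  apply: ge0_le_integral => //.
  - by move=> x _; rewrite lee_fin normal_pdf_ge0.
  - by apply/measurable_EFinP; apply: measurable_funTS; exact: measurable_normal_pdf.
  - move=> x _; rewrite lee_fin; apply: le_trans peak.
    exact: normal_pdf_ub (oner_neq0 _).
apply: (le_trans le1); rewrite integral_cst//=.
rewrite lebesgue_measure_ball// -EFinM lee_fin -mulr_natr; lra.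
Qed.

Lemma normal_prob_opp (A : set (measurableTypeR R)) : measurable A ->
  N01 (-%R @^-1` A) = N01 A.
Proof.
move=> mA; rewrite /normal_prob.
rewrite [RHS](@eq_measure_integral _ _ _ _
  (pushforward leb (-%R : R -> measurableTypeR R))); last first.
  by move=> B mB _ /=; rewrite lebesgue_measureN.
rewrite ge0_integral_pushforward//=.
- apply: eq_integral => x _; rewrite !normal_pdfE ?oner_eq0//.
  by rewrite /normal_fun !subr0 sqrrN.
- apply/measurable_EFinP; apply: measurable_funTS; exact: measurable_normal_pdf.
- by move=> x _; rewrite lee_fin normal_pdf_ge0.
Qed.

End NormalDistribution.

(** * Symmetries of the Gaussian vector *)

Section NonnegativeRealIntegrals.
Context {dT : measure_display} {T : measurableType dT} {R : realType}.
Variable (m : {measure set T -> \bar R}).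
Implicit Types f g : T -> R.

Lemma rintD f g : measurable_fun setT f -> measurable_fun setT g ->
  (forall x, 0 <= f x) -> (forall x, 0 <= g x) ->
  (\int[m]_x (f x + g x)%:E = \int[m]_x (f x)%:E + \int[m]_x (g x)%:E)%E.
Proof.
move=> mf mg f0 g0; under eq_integral do rewrite EFinD.
by rewrite ge0_integralD//; try (by move=> x _; rewrite lee_fin);
  exact/measurable_EFinP.
Qed.

Lemma rintZ f (k : R) : measurable_fun setT f -> (forall x, 0 <= f x) ->
  0 <= k -> (\int[m]_x (k * f x)%:E = k%:E * \int[m]_x (f x)%:E)%E.
Proof.
move=> mf f0 k0; under eq_integral do rewrite EFinM.
by rewrite ge0_integralZl_EFin//; try (by move=> x _; rewrite lee_fin);
  exact/measurable_EFinP.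
Qed.

Lemma rint_le f g : measurable_fun setT f -> measurable_fun setT g ->
  (forall x, 0 <= f x) -> (forall x, f x <= g x) ->
  (\int[m]_x (f x)%:E <= \int[m]_x (g x)%:E)%E.
Proof.
move=> mf mg f0 fg; apply: ge0_le_integral => //.
- by move=> x _; rewrite lee_fin.
- exact/measurable_EFinP.
- exact/measurable_EFinP.
- by move=> x _; rewrite lee_fin.
Qed.

Lemma rint_sum (I : finType) (F : I -> T -> R) :
  (forall i, measurable_fun setT (F i)) -> (forall i x, 0 <= F i x) ->
  (\int[m]_x (\sum_i F i x)%:E = \sum_i \int[m]_x (F i x)%:E)%E.
Proof.
move=> mF F0; under eq_integral do rewrite -sumEFin.
rewrite ge0_integral_sum//; first by move=> i; exact/measurable_EFinP.
by move=> i x _; rewrite lee_fin.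
Qed.

Lemma rint_ge0 f : (forall x, 0 <= f x) -> (0 <= \int[m]_x (f x)%:E)%E.
Proof. by move=> f0; apply: integral_ge0 => x _; rewrite lee_fin. Qed.

End NonnegativeRealIntegrals.

Lemma rint_cst {dT} {T : measurableType dT} {R : realType}
  (m : probability T R) (c : R) : (\int[m]_x c%:E = c%:E)%E.
Proof.
rewrite integral_cst//=  -[RHS]mule1; congr (_ * _)%E; exact: probability_setT.
Qed.

Lemma measurable_funif {dT} {T : measurableType dT} {R : realType}
  (g h : T -> R) (b : T -> bool) : measurable_fun setT b ->
  measurable_fun setT g -> measurable_fun setT h ->
  measurable_fun setT (fun t => if b t then g t else h t).
Proof. by move=> mb mg mh; exact: measurable_fun_ifT. Qed.

Section GaussianVector.
Context {R : realType} {d : nat} (nu : probability (borel_rV R d) R).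
Hypothesis gauss : std_gaussian nu.
Implicit Types x : 'rV[R]_d.
Notation N01 := (normal_prob (0 : R) 1).

Lemma gaussian_marginal (i : 'I_d) (phi : R -> R) :
  measurable_fun setT phi -> (forall r, 0 <= phi r) ->
  (\int[nu]_x (phi ((x : 'rV[R]_d) 0%R i))%:E = \int[N01]_r (phi r)%:E)%E.
Proof.
move=> mphi phi0.
transitivity (\int[pushforward nu (fun x : borel_rV R d => (x : 'rV[R]_d) 0%R i : measurableTypeR R)]_r (phi r)%:E)%E.
  rewrite ge0_integral_pushforward//=.
  - exact: measurable_coord.
  - exact/measurable_EFinP.
  - by move=> r _; rewrite lee_fin.
apply: eq_measure_integral => [|mc /= B mB _]; first exact: measurable_coord.
rewrite /pushforward.
have -> : (fun x : borel_rV R d => (x : 'rV[R]_d) 0%R i) @^-1` B =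
    rV_box (fun j => if j == i then B else setT).
  apply/seteqP; split => [x /= Bx j|x /(_ i)]; rewrite /=; last by rewrite eqxx.
  by case: eqP => // ->.
rewrite gauss; last by move=> j; case: ifP.
rewrite (bigD1 i)//= eqxx big1 ?mule1// => j /negbTE ->.
exact: probability_setT.
Qed.

Definition flip (k : 'I_d) x : 'rV[R]_d :=
  \row_i (if i == k then - x 0 i else x 0 i).

Definition swap (a b : 'I_d) x : 'rV[R]_d := \row_i x 0 (tperm a b i).

Lemma measurable_flip k :
  measurable_fun [set: borel_rV R d] (flip k : borel_rV R d -> borel_rV R d).
Proof.
apply: measurable_rV => i; under eq_fun do rewrite mxE.
case: (i == k); last exact: measurable_coord.
by apply: measurableT_comp => //; exact: measurable_coord.
Qed.

Lemma measurable_swap a b :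
  measurable_fun [set: borel_rV R d] (swap a b : borel_rV R d -> borel_rV R d).
Proof.
by apply: measurable_rV => i; under eq_fun do rewrite mxE; exact: measurable_coord.
Qed.

(** Only the measure of boxes needs to be preserved, since the law is determined
    by it. *)
Lemma gaussian_invariant (h : borel_rV R d -> borel_rV R d) (f : borel_rV R d -> R) :
  measurable_fun setT h ->
  (forall A, (forall i, measurable (A i)) -> nu (h @^-1` rV_box A) = nu (rV_box A)) ->
  measurable_fun setT f -> (forall x, 0 <= f x) ->
  (\int[nu]_x (f (h x))%:E = \int[nu]_x (f x)%:E)%E.
Proof.
move=> mh hA mf f0.
rewrite [RHS](@eq_measure_integral _ _ _ _ (pushforward nu h)).
  rewrite ge0_integral_pushforward//=; first exact/measurable_EFinP.
  by move=> x _; rewrite lee_fin.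
move=> B mB _; apply: (box_measure_unique _ _ mB).
  by apply: (@le_lt_trans _ _ 1%E); [exact: probability_le1|exact: ltry].
by move=> A mA; exact/esym/hA.
Qed.

Lemma gaussian_flip k (f : borel_rV R d -> R) :
  measurable_fun setT f -> (forall x, 0 <= f x) ->
  (\int[nu]_x (f (flip k x))%:E = \int[nu]_x (f x)%:E)%E.
Proof.
apply: gaussian_invariant; first exact: measurable_flip.
move=> A mA.
have -> : flip k @^-1` rV_box A =
    rV_box (fun i => if i == k then -%R @^-1` A i else A i).
  apply/seteqP; split=> [x Ax i|x Ax i]; have := Ax i; rewrite /flip /= mxE;
    by case: ifP.
rewrite !gauss//; last first.
  move=> i; case: ifP => // _; rewrite -[X in measurable X]setTI.
  exact: (@oppr_measurable R setT measurableT _ (mA i)).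
by apply: eq_bigr => i _; case: ifP => // _; rewrite normal_prob_opp.
Qed.

Lemma gaussian_swap a b (f : borel_rV R d -> R) :
  measurable_fun setT f -> (forall x, 0 <= f x) ->
  (\int[nu]_x (f (swap a b x))%:E = \int[nu]_x (f x)%:E)%E.
Proof.
apply: gaussian_invariant; first exact: measurable_swap.
move=> A mA.
have -> : swap a b @^-1` rV_box A = rV_box (fun i => A (tperm a b i)).
  apply/seteqP; split=> [x Ax i|x Ax i].
    by have := Ax (tperm a b i); rewrite mxE tpermK.
  by have := Ax (tperm a b i); rewrite /swap /= mxE tpermK.
rewrite !gauss// [RHS](reindex_inj (@perm_inj _ (tperm a b)))//.
Qed.

End GaussianVector.

(** * Euclidean geometry, gradients and one step of the algorithm *)

Section EuclideanGeometry.
Context {R : realType} {d : nat}.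
Implicit Types (x y z : 'rV[R]_d) (a : R).

Lemma dotpC x y : dotp x y = dotp y x.
Proof. by apply: eq_bigr => i _; rewrite mulrC. Qed.

Lemma dotpDl x y z : dotp (x + y) z = dotp x z + dotp y z.
Proof. by rewrite -big_split; apply: eq_bigr => i _; rewrite mxE mulrDl. Qed.

Lemma dotpZl a x y : dotp (a *: x) y = a * dotp x y.
Proof. by rewrite mulr_sumr; apply: eq_bigr => i _; rewrite mxE mulrA. Qed.

Lemma dotpNl x y : dotp (- x) y = - dotp x y.
Proof. by rewrite -scaleN1r dotpZl mulN1r. Qed.

Lemma dotpBl x y z : dotp (x - y) z = dotp x z - dotp y z.
Proof. by rewrite dotpDl dotpNl. Qed.

Lemma dotpDr x y z : dotp x (y + z) = dotp x y + dotp x z.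
Proof. by rewrite !(dotpC x) dotpDl. Qed.

Lemma dotpZr a x y : dotp x (a *: y) = a * dotp x y.
Proof. by rewrite !(dotpC x) dotpZl. Qed.

Lemma dotpNr x y : dotp x (- y) = - dotp x y.
Proof. by rewrite !(dotpC x) dotpNl. Qed.

Lemma dotp0r x : dotp x 0 = 0.
Proof. by rewrite -(scale0r (0 : 'rV[R]_d)) dotpZr mul0r. Qed.

Lemma dotpxx_ge0 x : 0 <= dotp x x.
Proof. by apply: sumr_ge0 => i _; rewrite -expr2 sqr_ge0. Qed.

Lemma dotpxx_eq0 x : dotp x x = 0 -> x = 0.
Proof.
move/eqP; rewrite psumr_eq0 => [/allP h|i _]; last by rewrite -expr2 sqr_ge0.
apply/rowP => i; rewrite mxE; apply/eqP.
by have := h i (mem_index_enum i); rewrite /= mulf_eq0 orbb.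
Qed.

Lemma enorm_sqr x : enorm x ^+ 2 = dotp x x.
Proof. by rewrite sqr_sqrtr// dotpxx_ge0. Qed.

Lemma enorm_ge0 x : 0 <= enorm x.
Proof. exact: sqrtr_ge0. Qed.

Lemma enormN x : enorm (- x) = enorm x.
Proof. by rewrite /enorm dotpNl dotpNr opprK. Qed.

Lemma enormZ a x : enorm (a *: x) = `|a| * enorm x.
Proof.
by rewrite /enorm dotpZl dotpZr mulrA -expr2 sqrtrM ?sqr_ge0// sqrtr_sqr.
Qed.

Lemma enorm_gt0 x : x != 0 -> 0 < enorm x.
Proof.
move=> x0; rewrite sqrtr_gt0 lt_def dotpxx_ge0 andbT.
by apply: contra x0 => /eqP/dotpxx_eq0 ->.
Qed.

Lemma cauchy_schwarz x y : dotp x y ^+ 2 <= dotp x x * dotp y y.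
Proof.
have [y0|y0] := eqVneq (dotp y y) 0.
  by rewrite (dotpxx_eq0 y0) !dotp0r expr0n mulr0.
have yy : 0 < dotp y y by rewrite lt_def y0 dotpxx_ge0.
have := dotpxx_ge0 (dotp y y *: x - dotp x y *: y).
have -> : dotp (dotp y y *: x - dotp x y *: y) (dotp y y *: x - dotp x y *: y) =
    dotp y y * (dotp x x * dotp y y - dotp x y ^+ 2).
  by rewrite dotpBl !dotpDr !dotpNr !dotpZl !dotpZr (dotpC y x); ring.
by rewrite pmulr_rge0// subr_ge0.
Qed.

Lemma dotp_le_enorm x y : `|dotp x y| <= enorm x * enorm y.
Proof.
rewrite -sqrtrM ?dotpxx_ge0// -sqrtr_sqr ler_wsqrtr//.
exact: cauchy_schwarz.
Qed.

End EuclideanGeometry.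

Section DifferentialGeometry.
Context {R : realType} {d : nat}.
Implicit Types (x y v : 'rV[R]_d) (h : 'rV[R]_d -> R).

Lemma derive_grad h x v : differentiable h x -> 'D_v h x = dotp (grad h x) v.
Proof.
move=> dh; rewrite deriveE//.
rewrite [in LHS](row_sum_delta v) linear_sum; apply: eq_bigr => i _.
by rewrite linearZ/= mxE deriveE// mulrC.
Qed.

Lemma is_derive_line h x v (r : R) : differentiable h (x + r *: v) ->
  is_derive r 1 (fun r => h (x + r *: v)) (dotp (grad h (x + r *: v)) v).
Proof.
move=> dh; have /(_ v) dv := @diff_derivable _ _ _ h (x + r *: v).
have e : (fun k : R => k^-1 *: (((fun r => h (x + r *: v)) \o shift r) (k *: (1 : R^o)) -
      h (x + r *: v))) =
    (fun k : R => k^-1 *: ((h \o shift (x + r *: v)) (k *: v) - h (x + r *: v))).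
  apply/funext => k /=; congr (_ *: (h _ - _)).
  by rewrite /shift/= scalerDl [k *: 1]mulr1 addrCA.
apply: DeriveDef.
  by rewrite /derivable e; exact: dv.
by rewrite /derive e -derive_grad.
Qed.

(** The two-point difference is a function of a single real variable whose
    derivative differs from twice the directional derivative at x by two
    gradient increments over distance c |v|, with c between 0 and a. *)
Lemma lipschitz_smooth_two_point (L : R) h x v (a : R) : 0 <= a ->
  lipschitz_smooth L h ->
  `|h (x + a *: v) - h (x - a *: v) - 2 * a * dotp (grad h x) v| <=
  2 * L * a ^+ 2 * dotp v v.
Proof.
move=> a0 [dh Lh].
pose g (r : R) := h (x + r *: v) - h (x + r *: (- v)).
pose dg (r : R) := dotp (grad h (x + r *: v)) v - dotp (grad h (x + r *: (- v))) (- v).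
have gd (r : R) : is_derive r 1 g (dg r).
  by apply: is_deriveB; exact: is_derive_line.
have [|c] := @MVT_segment R g dg 0 a a0 (fun r _ => gd r).
  by apply: derivable_within_continuous => r _; exact: ex_derive.
rewrite in_itv/= => /andP[c0 ca].
rewrite subr0 {1 2}/g !scale0r addr0 subrr subr0 scalerN => ->.
have -> : dg c * a - 2 * a * dotp (grad h x) v =
   a * (dotp (grad h (x + c *: v) - grad h x) v +
        dotp (grad h (x + c *: (- v)) - grad h x) v).
  by rewrite /dg !dotpBl dotpNr; ring.
have bound (w : 'rV[R]_d) : enorm w = enorm v ->
    `|dotp (grad h (x + c *: w) - grad h x) v| <= L * c * dotp v v.
  move=> wv; apply: (le_trans (dotp_le_enorm _ _)).
  rewrite -enorm_sqr expr2 mulrA; apply: ler_wpM2r; first exact: enorm_ge0.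
  apply: (le_trans (Lh _ _)).
  by rewrite addrC addKr enormZ ger0_norm// wv mulrA.
have b1 := bound v erefl; have b2 := bound (- v) (enormN v).
rewrite normrM (ger0_norm a0).
apply: (@le_trans _ _ (a * (2 * (L * c * dotp v v)))).
  apply: ler_wpM2l => //; apply: (le_trans (ler_normD _ _)); lra.
(* If v is nonzero, the Lipschitz bound itself forces L to be nonnegative. *)
have Lv : 0 <= L * dotp v v.
  have [v0|v0] := eqVneq (dotp v v) 0; first by rewrite v0 mulr0.
  have := le_trans (enorm_ge0 _) (Lh v 0); rewrite subr0 => Lv0.
  rewrite -enorm_sqr expr2 mulrA mulr_ge0 ?enorm_ge0//.
have -> : a * (2 * (L * c * dotp v v)) = (2 * a * (L * dotp v v)) * c by ring.
have -> : 2 * L * a ^+ 2 * dotp v v = (2 * a * (L * dotp v v)) * a by ring.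
by apply: ler_wpM2l => //; apply: mulr_ge0 => //; exact: mulr_ge0.
Qed.

Variables (L mu : R) (f : 'rV[R]_d -> R) (xstar : 'rV[R]_d).
Hypothesis fssc : smooth_strongly_convex L mu f.
Hypothesis fmin : unique_minimizer f xstar.

Lemma minimizer_le x : f xstar <= f x.
Proof. by have [->//|/fmin/ltW] := eqVneq x xstar. Qed.

(** A gradient step of length 1 / L decreases f by |grad f x|^2 / (2 L), and
    cannot lead below the minimum. *)
Lemma grad_sqr_le x : 0 < L -> dotp (grad f x) (grad f x) <= 2 * L * (f x - f xstar).
Proof.
move=> L0; have [_ /(_ x (x - L^-1 *: grad f x)) [_]] := fssc.
rewrite [x - _ - x]addrAC subrr add0r enormN enorm_sqr dotpNr !dotpZr dotpZl.
have := minimizer_le (x - L^-1 *: grad f x).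
move: (f (x - _)) (f x) (f xstar) (dotp _ _) => a b c s ca ab.
have e : L / 2 * (L^-1 * (L^-1 * s)) = L^-1 * s / 2.
  by field; rewrite gt_eqF.
rewrite e in ab.
have : L^-1 * s <= 2 * (b - c) by lra.
by rewrite ler_pdivrMl// => h; lra.
Qed.

(** The Polyak-Lojasiewicz inequality: evaluate the strong convexity bound at
    xstar and complete the square. *)
Lemma grad_sqr_ge x : 0 < mu -> 2 * mu * (f x - f xstar) <= dotp (grad f x) (grad f x).
Proof.
move=> mu0; have [_ /(_ x xstar) [+ _]] := fssc.
move: (xstar - x) => z; rewrite enorm_sqr => h.
have := dotpxx_ge0 (grad f x + mu *: z).
rewrite !(dotpDl, dotpDr) !(dotpZl, dotpZr) (dotpC z).
move: h; move: (f x) (f xstar) (dotp _ _) (dotp _ z) (dotp z z) => a b s t r h1 h2.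
have := ler_wpM2l (ltW mu0) h1; lra.
Qed.

(** The step has length gamma s along the unit vector v / |v|, where
    s = a + b + e: the slope a of f, the noise b in that slope, and the error e
    of the symmetric difference quotient. In the quadratic upper bound of f,
    the condition on gamma makes the second-order terms in a and e small
    compared with the first-order gain gamma a^2, and a e is split by Young's
    inequality. *)
Lemma sgd_step_le (H : 'rV[R]_d -> R) x v (al ga a b : R) :
  0 < al -> 0 <= ga -> 8 * L * ga <= 1 -> lipschitz_smooth L H -> 0 <= L ->
  a = dotp (grad f x) v / enorm v ->
  b = dotp (grad H x - grad f x) v / enorm v ->
  f (x - (ga / enorm v ^+ 2 * ((H (x + al *: v) - H (x - al *: v)) / (2 * al))) *: v)
  - f x <= - (3 / 4) * (ga * a ^+ 2) - ga * (a * b) + 2 * L * ga ^+ 2 * b ^+ 2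
           + 3 * ga * (L ^+ 2 * al ^+ 2 * dotp v v).
Proof.
move=> al0 ga0 gaL HL L0 aE bE.
set D := H _ - H _.
have [v0|v0] := eqVneq v 0.
  (* For v = 0 there is no move, and a = b = 0 because division by 0 yields 0. *)
  rewrite (_ : x - _ *: v = x); last by rewrite v0 scaler0 subr0.
  by rewrite subrr aE bE v0 !dotp0r !mul0r; lra.
have nv := enorm_gt0 v0; set N := enorm v in nv aE bE *.
pose s := D / (2 * al * N).
pose e := s - a - b.
have eE : e ^+ 2 <= L ^+ 2 * al ^+ 2 * dotp v v.
  have := lipschitz_smooth_two_point x v (ltW al0) HL; rewrite -/D.
  have -> : D - 2 * al * dotp (grad H x) v = 2 * al * N * e.
    rewrite /e /s aE bE dotpBl.
    field; rewrite !gt_eqF//.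
  rewrite -enorm_sqr -/N normrM ger0_norm ?mulr_ge0 ?(ltW al0) ?(ltW nv)//.
  have -> : 2 * L * al ^+ 2 * N ^+ 2 = 2 * al * N * (L * al * N) by ring.
  rewrite ler_pM2l ?mulr_gt0// => h.
  rewrite -real_normK ?num_real// -!exprMn !expr2.
  by apply: ler_pM.
have [_ /(_ x (x - (ga / N ^+ 2 * (D / (2 * al))) *: v)) [_]] := fssc.
rewrite [x - _ - x]addrAC subrr add0r enormN enorm_sqr dotpNr !dotpZr dotpZl.
rewrite -enorm_sqr -/N in eE *.
have -> : - (ga / N ^+ 2 * (D / (2 * al)) * dotp (grad f x) v) = - (ga * (s * a)).
  by rewrite /s aE; field; rewrite !gt_eqF.
have -> : ga / N ^+ 2 * (D / (2 * al)) * (ga / N ^+ 2 * (D / (2 * al)) * N ^+ 2)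
    = ga ^+ 2 * s ^+ 2.
  by rewrite /s; field; rewrite !gt_eqF.
have -> : s = a + b + e by rewrite /e; ring.
move: (f _) => fx'; move: (f x) (L ^+ 2 * _ * _) eE => fx E eE h.
set l := L * ga; have l0 : 0 <= l by exact: mulr_ge0.
have l8 : 8 * l <= 1 by rewrite /l; lra.
apply: (@le_trans _ _ (ga * (- ((a + b + e) * a) + l / 2 * (a + b + e) ^+ 2))).
  have -> : ga * (- ((a + b + e) * a) + l / 2 * (a + b + e) ^+ 2) =
      - (ga * ((a + b + e) * a)) + L / 2 * (ga ^+ 2 * (a + b + e) ^+ 2).
    by rewrite /l; ring.
  by rewrite lerBlDl addrA.
apply: (@le_trans _ _ (ga * (- (3 / 4) * a ^+ 2 - a * b + 2 * l * b ^+ 2 + 3 * E))).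
  apply: ler_wpM2l => //.
  have p1 : l * (a + b + e) ^+ 2 <= l * (2 * a ^+ 2 + 4 * b ^+ 2 + 4 * e ^+ 2).
    apply: ler_wpM2l => //.
    have := sqr_ge0 (a - b - e); have := sqr_ge0 (b - e); nra.
  have p2 : 8 * l * a ^+ 2 <= a ^+ 2 by rewrite ler_piMl ?sqr_ge0.
  have p3 : 8 * l * e ^+ 2 <= e ^+ 2 by rewrite ler_piMl ?sqr_ge0.
  have p4 := sqr_ge0 (a + 4 * e).
  nra.
by rewrite le_eqVlt; apply/orP; left; apply/eqP; rewrite /l; ring.
Qed.

End DifferentialGeometry.

(** * Moments of radially weighted coordinates *)

Lemma measurable_dotp {R : realType} {d : nat} (w : 'rV[R]_d) :
  measurable_fun [set: borel_rV R d] (fun x : borel_rV R d => dotp w x).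
Proof.
apply: measurable_sum => i; apply: measurable_funM => //.
exact: measurable_coord.
Qed.

Lemma measurable_dotpxx {R : realType} {d : nat} :
  measurable_fun [set: borel_rV R d] (fun x : borel_rV R d => dotp x x : R).
Proof.
by apply: measurable_sum => i; apply: measurable_funM; exact: measurable_coord.
Qed.

Section RadialMoments.
Context {R : realType} {d : nat} (nu : probability (borel_rV R d) R).
Hypothesis gauss : std_gaussian nu.
Variable r : R -> R.
Hypothesis mr : measurable_fun setT r.
Implicit Types x : 'rV[R]_d.

(** With r s = s^(-1/2) these are the coordinates of the unit vector x / |x|.
    Any weight that depends on |x| alone keeps the symmetries of the Gaussian
    law. *)
Definition radial (i : 'I_d) x : R := r (dotp x x) * x 0 i.

Lemma measurable_radial i :
  measurable_fun [set: borel_rV R d] (fun x : borel_rV R d => radial i x).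
Proof.
apply: measurable_funM; last exact: measurable_coord.
by apply: measurableT_comp => //; exact: measurable_dotpxx.
Qed.

Lemma radial_flip k i x :
  radial i (flip k x) = if i == k then - radial i x else radial i x.
Proof.
rewrite /radial mxE (_ : dotp _ _ = dotp x x).
  by case: ifP => _ //; rewrite mulrN.
by apply: eq_bigr => j _; rewrite mxE; case: ifP => _ //; rewrite mulrNN.
Qed.

Lemma radial_swap a b i x : radial i (swap a b x) = radial (tperm a b i) x.
Proof.
rewrite /radial mxE; congr (r _ * _).
rewrite [RHS](reindex_inj (@perm_inj _ (tperm a b))) /=.
by apply: eq_bigr => j _; rewrite !mxE.
Qed.

Lemma radial_moment_eq n i j : ~~ odd n ->
  (\int[nu]_x (radial i x ^+ n)%:E = \int[nu]_x (radial j x ^+ n)%:E)%E.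
Proof.
move=> n_even; rewrite -(gaussian_swap gauss i j).
- by apply: eq_integral => x _; rewrite radial_swap tpermL.
- by apply: measurable_funX; exact: measurable_radial.
- by move=> x; exact: exprn_even_ge0.
Qed.

Lemma sum_radial2 x : \sum_i radial i x ^+ 2 = r (dotp x x) ^+ 2 * dotp x x.
Proof. by rewrite /dotp mulr_sumr; apply: eq_bigr => i _; rewrite exprMn. Qed.

Variable w : 'rV[R]_d.

Let c i x : R := w 0 i * radial i x.
Let S (k : nat) x : R := \sum_(i < d | (i < k)%N) c i x.
Let Q (k : nat) x : R := \sum_(i < d | (i < k)%N) c i x ^+ 2.

Let mc i : measurable_fun [set: borel_rV R d] (fun x : borel_rV R d => c i x).
Proof. by apply: measurable_funM => //; exact: measurable_radial. Qed.

Let mS k : measurable_fun [set: borel_rV R d] (fun x : borel_rV R d => S k x).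
Proof.
rewrite /S; under eq_fun do rewrite big_mkcond.
by apply: measurable_sum => i; case: (_ < _)%N => //; exact: mc.
Qed.

Let mQ k : measurable_fun [set: borel_rV R d] (fun x : borel_rV R d => Q k x).
Proof.
rewrite /Q; under eq_fun do rewrite big_mkcond.
apply: measurable_sum => i; case: (_ < _)%N => //.
by apply: measurable_funX; exact: mc.
Qed.

Let Q0 k x : 0 <= Q k x.
Proof. by apply: sumr_ge0 => i _; exact: sqr_ge0. Qed.

Let c_flip k i x : c i (flip k x) = if i == k then - c i x else c i x.
Proof. by rewrite /c radial_flip; case: ifP => // _; rewrite mulrN. Qed.

Let S_flip (k : 'I_d) x : S k (flip k x) = S k x.
Proof.
apply: eq_bigr => i ik; rewrite c_flip; case: eqP => // eik.
by rewrite eik ltnn in ik.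
Qed.

Let S_step (k : 'I_d) x : S k.+1 x = S k x + c k x.
Proof.
rewrite /S (bigD1 k)//= addrC; congr (_ + _); apply: eq_bigl => i.
by rewrite ltnS leq_eqVlt -val_eqE/=; case: ltngtP.
Qed.

Let Q_step (k : 'I_d) x : Q k.+1 x = Q k x + c k x ^+ 2.
Proof.
rewrite /Q (bigD1 k)//= addrC; congr (_ + _); apply: eq_bigl => i.
by rewrite ltnS leq_eqVlt -val_eqE/=; case: ltngtP.
Qed.

(** Replaces an integrand by its even part in coordinate k. *)
Let flip_average k (f g : borel_rV R d -> R) :
  measurable_fun setT f -> measurable_fun setT g ->
  (forall x, 0 <= f x) -> (forall x, 0 <= g x) ->
  (forall x, f x + f (flip k x) = 2 * g x) ->
  (\int[nu]_x (f x)%:E = \int[nu]_x (g x)%:E)%E.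
Proof.
move=> mf mg f0 g0 fg.
have mff : measurable_fun [set: borel_rV R d] (fun x : borel_rV R d => f (flip k x)).
  exact: (measurableT_comp mf (measurable_flip k)).
have h : (\int[nu]_x (f x)%:E + \int[nu]_x (f x)%:E =
    2%:E * \int[nu]_x (g x)%:E)%E.
  rewrite -{2}(gaussian_flip gauss k mf f0) -rintD//.
  by rewrite -rintZ//; apply: eq_integral => x _; rewrite fg.
have : (2^-1%:E * (\int[nu]_x (f x)%:E + \int[nu]_x (f x)%:E) =
    2^-1%:E * (2%:E * \int[nu]_x (g x)%:E))%E by rewrite h.
rewrite muleA -EFinM mulVf// mul1e => <-.
rewrite ge0_muleDr ?rint_ge0// -ge0_muleDl ?lee_fin ?invr_ge0//.
by rewrite -EFinD (_ : 2^-1 + 2^-1 = 1 :> R) ?mul1e//; lra.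
Qed.

(** A sign change of the last coordinate removes the cross term. The even factor
    h is carried along because the fourth moment needs the case where h is the
    square of a further summand. *)
Let second_moment_step (k : nat) (h : borel_rV R d -> R) : (k <= d)%N ->
  measurable_fun setT h -> (forall x, 0 <= h x) ->
  (forall j x, h (flip j x) = h x) ->
  (\int[nu]_x (S k x ^+ 2 * h x)%:E = \int[nu]_x (Q k x * h x)%:E)%E.
Proof.
move=> + mh h0 hh; elim: k => [_|k IH kd].
  by apply: eq_integral => x _; rewrite /S /Q !big_pred0// expr2 !mul0r.
pose k' := Ordinal kd.
transitivity (\int[nu]_x (S k x ^+ 2 * h x + c k' x ^+ 2 * h x)%:E)%E.
  apply: (@flip_average k' (fun x => S k.+1 x ^+ 2 * h x)
    (fun x => S k x ^+ 2 * h x + c k' x ^+ 2 * h x)).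
  - by apply: measurable_funM => //; apply: measurable_funX; exact: mS.
  - apply: measurable_funD; apply: measurable_funM => //; apply: measurable_funX.
      exact: mS.
    exact: mc.
  - by move=> x; rewrite mulr_ge0 ?sqr_ge0.
  - by move=> x; apply: addr_ge0; apply: mulr_ge0 => //; exact: sqr_ge0.
  - move=> x; rewrite hh (S_step k') (S_step k') (S_flip k') c_flip eqxx; ring.
transitivity (\int[nu]_x (Q k x * h x + c k' x ^+ 2 * h x)%:E)%E; last first.
  by apply: eq_integral => x _; rewrite (Q_step k') mulrDl.
have mch : measurable_fun setT (fun x : borel_rV R d => c k' x ^+ 2 * h x).
  by apply: measurable_funM => //; apply: measurable_funX; exact: mc.
rewrite !rintD//.
- by rewrite IH// ltnW.
- by apply: measurable_funM => //; exact: mQ.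
- by move=> x; rewrite mulr_ge0.
- by move=> x; rewrite mulr_ge0 ?sqr_ge0.
- by apply: measurable_funM => //; apply: measurable_funX; exact: mS.
- by move=> x; rewrite mulr_ge0 ?sqr_ge0.
- by move=> x; rewrite mulr_ge0 ?sqr_ge0.
Qed.

(** Khintchine's inequality, one coordinate at a time. Once the odd terms are
    removed, (S + c)^4 becomes S^4 + 6 S^2 c^2 + c^4, which is compared term by
    term with 3 (Q + c^2)^2 = 3 Q^2 + 6 Q c^2 + 3 c^4. *)
Let fourth_moment_step (k : nat) : (k <= d)%N ->
  (\int[nu]_x (S k x ^+ 4)%:E <= 3%:E * \int[nu]_x (Q k x ^+ 2)%:E)%E.
Proof.
elim: k => [_|k IH kd].
  rewrite (_ : \int[nu]_x (S 0 x ^+ 4)%:E = 0)%E.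
    by apply: mule_ge0 => //; apply: rint_ge0 => x; exact: sqr_ge0.
  apply: integral0_eq => x _; rewrite /S big_pred0// expr0n//.
pose k' := Ordinal kd.
have mc2 : measurable_fun setT (fun x : borel_rV R d => c k' x ^+ 2).
  by apply: measurable_funX; exact: mc.
have mSc : measurable_fun setT (fun x : borel_rV R d => S k x ^+ 2 * c k' x ^+ 2).
  by apply: measurable_funM => //; apply: measurable_funX; exact: mS.
have mQc : measurable_fun setT (fun x : borel_rV R d => Q k x * c k' x ^+ 2).
  by apply: measurable_funM => //; exact: mQ.
have mc4 : measurable_fun setT (fun x : borel_rV R d => c k' x ^+ 4).
  by apply: measurable_funX; exact: mc.
have mS4 : measurable_fun setT (fun x : borel_rV R d => S k x ^+ 4).
  by apply: measurable_funX; exact: mS.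
have mQ2 : measurable_fun setT (fun x : borel_rV R d => Q k x ^+ 2).
  by apply: measurable_funX; exact: mQ.
have p4 (y : R) : 0 <= y ^+ 4 by exact: exprn_even_ge0.
have Sc0 x : 0 <= S k x ^+ 2 * c k' x ^+ 2 by rewrite mulr_ge0 ?sqr_ge0.
have Qc0 x : 0 <= Q k x * c k' x ^+ 2 by rewrite mulr_ge0 ?sqr_ge0.
have m6 : measurable_fun setT (fun x : borel_rV R d =>
    6 * (S k x ^+ 2 * c k' x ^+ 2)) by exact: measurable_funM.
have m6Q : measurable_fun setT (fun x : borel_rV R d =>
    6 * (Q k x * c k' x ^+ 2)) by exact: measurable_funM.
have m3Q : measurable_fun setT (fun x : borel_rV R d =>
    3 * (Q k x ^+ 2)) by exact: measurable_funM.
have m3c : measurable_fun setT (fun x : borel_rV R d =>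
    3 * (c k' x ^+ 4)) by exact: measurable_funM.
have -> : (\int[nu]_x (S k.+1 x ^+ 4)%:E =
    \int[nu]_x (S k x ^+ 4 + 6 * (S k x ^+ 2 * c k' x ^+ 2) + c k' x ^+ 4)%:E)%E.
  apply: (@flip_average k' (fun x => S k.+1 x ^+ 4) (fun x => S k x ^+ 4 +
    6 * (S k x ^+ 2 * c k' x ^+ 2) + c k' x ^+ 4)).
  - by apply: measurable_funX; exact: mS.
  - by apply: measurable_funD => //; exact: measurable_funD.
  - by move=> x; exact: p4.
  - by move=> x; rewrite !addr_ge0 ?p4// mulr_ge0.
  - move=> x; rewrite (S_step k') (S_step k') (S_flip k') c_flip eqxx; ring.
have -> : (3%:E * \int[nu]_x (Q k.+1 x ^+ 2)%:E = \int[nu]_x (3 * Q k x ^+ 2 +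
    6 * (Q k x * c k' x ^+ 2) + 3 * (c k' x ^+ 4))%:E)%E.
  rewrite -rintZ//; last 2 first.
  - by apply: measurable_funX; exact: mQ.
  - by move=> x; exact: sqr_ge0.
  by apply: eq_integral => x _; rewrite (Q_step k'); congr (_%:E); ring.
have Q30 x : 0 <= 3 * Q k x ^+ 2 by rewrite mulr_ge0 ?sqr_ge0.
have c30 x : 0 <= 3 * c k' x ^+ 4 by rewrite mulr_ge0.
have S60 x : 0 <= 6 * (S k x ^+ 2 * c k' x ^+ 2) by rewrite mulr_ge0.
have Q60 x : 0 <= 6 * (Q k x * c k' x ^+ 2) by rewrite mulr_ge0.
rewrite !rintD//; first last.
- by move=> x; apply: addr_ge0.
- exact: measurable_funD.
- by move=> x; apply: addr_ge0.
- exact: measurable_funD.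
apply: leeD; first apply: leeD.
- rewrite rintZ//; last by move=> x; exact: sqr_ge0.
  by apply: IH; rewrite ltnW.
- rewrite !rintZ// (second_moment_step (h := fun x => c k' x ^+ 2))//.
  + by rewrite ltnW.
  + by move=> x; exact: sqr_ge0.
  + by move=> j x; rewrite c_flip; case: ifP => // _; rewrite sqrrN.
- rewrite rintZ// -[leLHS]mul1e; apply: lee_wpmul2r; last by rewrite lee_fin ler1n.
  exact: rint_ge0.
Qed.

Let S_full x : S d x = \sum_i w 0 i * radial i x.
Proof. by apply: eq_bigl => i; rewrite ltn_ord. Qed.

Let Q_full x : Q d x = \sum_i (w 0 i * radial i x) ^+ 2.
Proof. by apply: eq_bigl => i; rewrite ltn_ord. Qed.

Lemma radial_second_moment (i0 : 'I_d) :
  (\int[nu]_x ((\sum_i w 0 i * radial i x) ^+ 2)%:E =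
   (dotp w w)%:E * \int[nu]_x (radial i0 x ^+ 2)%:E)%E.
Proof.
transitivity (\int[nu]_x (S d x ^+ 2 * 1)%:E)%E.
  by apply: eq_integral => x _; rewrite mulr1 S_full.
rewrite (second_moment_step (h := cst 1))//.
transitivity (\int[nu]_x (\sum_i w 0 i ^+ 2 * radial i x ^+ 2)%:E)%E.
  apply: eq_integral => x _; rewrite mulr1 Q_full; congr (_%:E).
  by apply: eq_bigr => i _; rewrite exprMn.
have mr2 i : measurable_fun setT (fun x : borel_rV R d => radial i x ^+ 2).
  by apply: measurable_funX; exact: measurable_radial.
rewrite rint_sum.
- rewrite /dotp -sumEFin ge0_sume_distrl; last first.
    by move=> i _; rewrite lee_fin -expr2 sqr_ge0.
  apply: eq_bigr => i _; rewrite rintZ ?sqr_ge0//; last first.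
    by move=> x; exact: sqr_ge0.
  by rewrite (radial_moment_eq i i0)// -expr2.
- by move=> i; exact: measurable_funM.
- by move=> i x; rewrite mulr_ge0 ?sqr_ge0.
Qed.

Lemma radial_fourth_moment (i0 : 'I_d) :
  (\int[nu]_x ((\sum_i w 0 i * radial i x) ^+ 4)%:E <=
   (3 * dotp w w ^+ 2)%:E * \int[nu]_x (radial i0 x ^+ 4)%:E)%E.
Proof.
have -> : (\int[nu]_x ((\sum_i w 0 i * radial i x) ^+ 4)%:E =
    \int[nu]_x (S d x ^+ 4)%:E)%E.
  by apply: eq_integral => x _; rewrite S_full.
apply: (le_trans (fourth_moment_step (leqnn d))).
have p4 (y : R) : 0 <= y ^+ 4 by exact: exprn_even_ge0.
have mr4 i : measurable_fun setT (fun x : borel_rV R d => radial i x ^+ 4).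
  by apply: measurable_funX; exact: measurable_radial.
have mw4 i : measurable_fun setT (fun x : borel_rV R d => w 0 i ^+ 2 * radial i x ^+ 4).
  by exact: measurable_funM.
have w4 i x : 0 <= w 0 i ^+ 2 * radial i x ^+ 4.
  by rewrite mulr_ge0 ?sqr_ge0.
have msum : measurable_fun setT (fun x : borel_rV R d =>
    \sum_i w 0 i ^+ 2 * radial i x ^+ 4) by exact: measurable_sum.
(* Cauchy-Schwarz with the weights w_i^2. *)
have CS x : Q d x ^+ 2 <= dotp w w * \sum_i w 0 i ^+ 2 * radial i x ^+ 4.
  rewrite Q_full expr2 /dotp !mulr_suml.
  under eq_bigr do rewrite mulr_sumr.
  under [leRHS]eq_bigr do rewrite mulr_sumr.
  rewrite -(ler_pM2l (x := 2))// !mulr_natl [leRHS]mulr2n.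
  rewrite [X in _ <= _ + X]exchange_big/= -big_split/= -sumrMnl.
  apply: ler_sum => i _; rewrite -big_split/= -sumrMnl; apply: ler_sum => j _.
  have := sqr_ge0 (w 0 i * w 0 j * (radial i x ^+ 2 - radial j x ^+ 2)).
  rewrite -subr_ge0 => /le_trans; apply.
  by rewrite le_eqVlt; apply/orP; left; apply/eqP; ring.
apply: (@le_trans _ _ (3%:E * \int[nu]_x
   (dotp w w * \sum_i w 0 i ^+ 2 * radial i x ^+ 4)%:E)%E).
  apply: lee_wpmul2l => //; apply: rint_le => //.
  - by apply: measurable_funX; exact: mQ.
  - exact: measurable_funM.
  - by move=> x; exact: sqr_ge0.
rewrite rintZ ?dotpxx_ge0//; last by move=> x; apply: sumr_ge0 => i _.
rewrite rint_sum//.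
under eq_bigr => i _ do rewrite rintZ ?sqr_ge0// (radial_moment_eq i i0)//.
rewrite -ge0_sume_distrl; last by move=> i _; rewrite lee_fin sqr_ge0.
rewrite sumEFin (_ : \sum_(i < d) _ = dotp w w); last first.
  by apply: eq_bigr => i _; rewrite expr2.
by rewrite !muleA -!EFinM expr2 mulrA.
Qed.

End RadialMoments.

(** * Random directions *)

Section ExponentialInequalities.
Context {R : realType}.
Implicit Types x y z t : R.

Lemma expR_tangent x y : expR y * (1 + (x - y)) <= expR x.
Proof.
have -> : expR x = expR y * expR (x - y) by rewrite -expRD addrC subrK.
by rewrite ler_pM2l ?expR_gt0// expR_ge1Dx.
Qed.

(** Convexity of the exponential between 0 and z. *)
Lemma expR_interpolation t z : 0 <= t <= 1 ->
  expR (t * z) <= 1 + t * (expR z - 1).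
Proof.
move=> /andP[t0 t1].
have h1 := expR_tangent z (t * z); have h2 := expR_tangent 0 (t * z).
rewrite expR0 in h2; move: (expR (t * z)) (expR z) h1 h2 => a b h1 h2.
have t1' : 0 <= 1 - t by rewrite subr_ge0.
have := ler_wpM2l t0 h1; have := ler_wpM2l t1' h2; nra.
Qed.

Lemma expRN_le_quadratic z : 0 <= z -> expR (- z) <= 1 - z + z ^+ 2.
Proof.
move=> z0; rewrite expRN.
have h : 1 + z <= expR z by exact: expR_ge1Dx.
have z1 : 0 < 1 + z by lra.
apply: (@le_trans _ _ (1 + z)^-1).
  by rewrite lef_pV2 ?posrE ?expR_gt0//.
rewrite -[leLHS]mul1r ler_pdivrMr// -subr_ge0.
have -> : (1 - z + z ^+ 2) * (1 + z) - 1 = z ^+ 3 by ring.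
exact: exprn_ge0.
Qed.

End ExponentialInequalities.

(** Gives a name in R to a bounded integral, so that several integral
    inequalities can be combined by linear arithmetic. *)
Lemma rint_real {dT} {T : measurableType dT} {R : realType}
    (m : {measure set T -> \bar R}) (f : T -> R) (c : R) :
  (forall x, 0 <= f x) -> (\int[m]_x (f x)%:E <= c%:E)%E ->
  exists2 a, 0 <= a <= c & (\int[m]_x (f x)%:E = a%:E)%E.
Proof.
move=> f0 fc; have f_ge0 := @rint_ge0 _ _ _ m f f0.
have ff : (\int[m]_x (f x)%:E)%E \is a fin_num.
  by rewrite ge0_fin_numE//; apply: (le_lt_trans fc); exact: ltry.
exists (fine (\int[m]_x (f x)%:E)%E); last by rewrite fineK.
by rewrite -lee_fin -[(_ <= c)%R]lee_fin fineK// f_ge0.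
Qed.

Section GaussianDirection.
Context {R : realType} {d : nat} (nu : probability (borel_rV R d) R).
Hypothesis gauss : std_gaussian nu.
Hypothesis d_gt0 : (0 < d)%N.
Implicit Types x w : 'rV[R]_d.
Notation N01 := (normal_prob (0 : R) 1).

Let i0 : 'I_d := Ordinal d_gt0.
Let dR_gt0 : 0 < d%:R :> R. Proof. by rewrite ltr0n. Qed.

(** With z = r^2 / 8, r^4 = 64 z^2 <= 32 (1 + z)^3 <= 32 exp (3 z), and the
    integral of exp (3 r^2 / 8) is 2. *)
Lemma normal_fourth_moment : (\int[N01]_r (r ^+ 4)%:E <= 64%:E)%E.
Proof.
apply: (@le_trans _ _ (32%:E * \int[N01]_r (expR (3 / 8 * r ^+ 2))%:E)%E).
  rewrite -rintZ; [|exact: measurable_expR_sqr|by move=> r; exact: expR_ge0|by []].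
  apply: rint_le.
  - exact: exprn_measurable.
  - by apply: measurable_funM => //; exact: measurable_expR_sqr.
  - by move=> r; exact: exprn_even_ge0.
  move=> r; pose z := r ^+ 2 / 8.
  have z0 : 0 <= z by rewrite divr_ge0 ?sqr_ge0.
  have -> : 3 / 8 * r ^+ 2 = z + (z + z) by rewrite /z; field.
  rewrite !expRD; have := expR_ge1Dx z.
  have -> : r ^+ 4 = 64 * z ^+ 2 by rewrite /z; field.
  move: (expR z) => e ez.
  have z1 : 0 <= 1 + z by lra.
  have e2 : (1 + z) * (1 + z) <= e * e by exact: ler_pM.
  have e3 : (1 + z) * ((1 + z) * (1 + z)) <= e * (e * e).
    by apply: ler_pM => //; exact: mulr_ge0.
  have z3 : 0 <= z * (z * z) by exact: (mulr_ge0 z0 (mulr_ge0 z0 z0)).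
  nra.
by rewrite normal_expR_sqr -EFinM lee_fin; lra.
Qed.

Lemma gaussian_expR_sqr i :
  (\int[nu]_x (expR (4^-1 * (x : 'rV[R]_d) 0%R i ^+ 2))%:E <= 2%:E)%E.
Proof.
rewrite (gaussian_marginal gauss i (phi := fun r => expR (4^-1 * r ^+ 2)))//.
- rewrite -normal_expR_sqr; apply: rint_le.
  + exact: measurable_expR_sqr.
  + exact: measurable_expR_sqr.
  + by move=> r; exact: expR_ge0.
  + by move=> r; rewrite ler_expR ler_wpM2r ?sqr_ge0//; lra.
- exact: measurable_expR_sqr.
Qed.

(** By Jensen's inequality exp (|x|^2 / (4 d)) is at most the average of
    exp (x_i^2 / 4), whose expectation is at most 2; smaller exponents follow by
    interpolation. *)
Lemma gaussian_expR_norm y : 0 <= y -> 4 * d%:R * y <= 1 ->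
  (\int[nu]_x (expR (y * dotp (x : 'rV[R]_d) x))%:E <= (1 + 4 * d%:R * y)%:E)%E.
Proof.
move=> y0 y1; pose t := 4 * d%:R * y.
have t0 : 0 <= t by rewrite !mulr_ge0.
pose E x : R := \sum_i d%:R^-1 * expR (4^-1 * x 0 i ^+ 2).
have mE1 i : measurable_fun [set: borel_rV R d]
    (fun x : borel_rV R d => expR (4^-1 * (x : 'rV[R]_d) 0 i ^+ 2)).
  apply: measurableT_comp => //; apply: measurable_funM => //.
  by apply: measurable_funX; exact: measurable_coord.
have mE : measurable_fun [set: borel_rV R d] (fun x : borel_rV R d => E x).
  by apply: measurable_sum => i; exact: measurable_funM.
have E0 x : 0 <= E x.
  by apply: sumr_ge0 => i _; rewrite mulr_ge0 ?expR_ge0// invr_ge0 ltW.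
have sumd : \sum_(i < d) (d%:R^-1 : R) = 1.
  by rewrite sumr_const card_ord -[LHS]mulr_natr mulVf// gt_eqF.
have jensen x : expR ((4 * d%:R)^-1 * dotp x x) <= E x.
  pose A := (4 * d%:R)^-1 * dotp x x.
  (* Jensen through the tangent of exp at the mean A, whose linear part sums to 0. *)
  have -> : expR ((4 * d%:R)^-1 * dotp x x) =
      \sum_(i < d) d%:R^-1 * (expR A * (1 + (4^-1 * x 0 i ^+ 2 - A))).
    rewrite -mulr_sumr -mulr_sumr -/A big_split/= sumrB !sumr_const card_ord.
    rewrite -mulr_sumr (_ : \sum_(i < d) _ = dotp x x).
      rewrite -[A *+ d]mulr_natr -[1 *+ d]/(d%:R); move: (expR A) => e.
      rewrite /A; move: (dotp x x) => s.
      by move: (d%:R : R) (lt0r_neq0 dR_gt0) => D D0; field.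
    by apply: eq_bigr => i _; rewrite expr2.
  apply: ler_sum => i _; rewrite ler_pM2l ?invr_gt0//; exact: expR_tangent.
have intE : (\int[nu]_x (E x)%:E <= 2%:E)%E.
  rewrite rint_sum//.
  - apply: (@le_trans _ _ (\sum_(i < d) (d%:R^-1 * 2)%:E)%E); last first.
      by rewrite sumEFin -mulr_suml sumd mul1r.
    apply: lee_sum => i _; rewrite rintZ; [|exact: mE1|by move=> x; exact: expR_ge0|
      by rewrite invr_ge0 ltW].
    rewrite EFinM; apply: lee_wpmul2l; first by rewrite lee_fin invr_ge0 ltW.
    exact: gaussian_expR_sqr.
  - by move=> i; exact: measurable_funM.
apply: (@le_trans _ _ (\int[nu]_x ((1 - t) + t * E x)%:E)%E).
  apply: rint_le.
  - apply: measurableT_comp => //; apply: measurable_funM => //.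
    exact: measurable_dotpxx.
  - by apply: measurable_funD => //; exact: measurable_funM.
  - by move=> x; exact: expR_ge0.
  move=> x; have -> : y * dotp x x = t * ((4 * d%:R)^-1 * dotp x x).
    rewrite /t; move: (dotp x x) => s.
    by move: (d%:R : R) (lt0r_neq0 dR_gt0) => D D0; field.
  apply: le_trans (expR_interpolation _ _) _; first by rewrite t0.
  have := ler_wpM2l t0 (jensen x); lra.
rewrite rintD//; last 3 first.
- exact: measurable_funM.
- by move=> x; rewrite subr_ge0.
- by move=> x; rewrite mulr_ge0.
rewrite rint_cst rintZ//.
apply: (@le_trans _ _ ((1 - t)%:E + t%:E * 2%:E)%E).
  by apply: leeD => //; apply: lee_wpmul2l.
by rewrite -EFinM -EFinD lee_fin -/t; lra.
Qed.

Let inv_norm (s : R) : R := s `^ (- 2^-1).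
(* Discarding the vectors with |x|^2 < d / 512 makes the fourth moments of the
normalized coordinates O(1 / d^2); it costs at most a quarter of the second
moment. *)
Let thr : R := d%:R / 512.
Let cut_inv_norm (s : R) : R := if s < thr then 0 else inv_norm s.

Let thr_gt0 : 0 < thr. Proof. exact: divr_gt0 dR_gt0 (ltr0Sn _ 511). Qed.

Let m_inv_norm : measurable_fun setT inv_norm.
Proof. exact: measurable_powR. Qed.

Let m_cut_inv_norm : measurable_fun setT cut_inv_norm.
Proof.
apply: measurable_funif => //.
by apply: measurable_fun_ltr => //; exact: measurable_id.
Qed.

Let inv_normE x : inv_norm (dotp x x) = (enorm x)^-1.
Proof. by rewrite /inv_norm powRN powR12_sqrt// dotpxx_ge0. Qed.

Let inv_norm_sqr s : 0 <= s -> inv_norm s ^+ 2 = s^-1.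
Proof.
by move=> s0; rewrite /inv_norm powRN powR12_sqrt// exprVn sqr_sqrtr.
Qed.

Let sum_radialE r w x :
  \sum_i w 0 i * radial r i x = r (dotp x x) * dotp w x.
Proof. by rewrite mulr_sumr; apply: eq_bigr => i _; rewrite /radial; ring. Qed.

Let sum_moment r : measurable_fun setT r ->
  (d%:R%:E * \int[nu]_x (radial r i0 x ^+ 2)%:E =
   \int[nu]_x (r (dotp (x : 'rV[R]_d) x) ^+ 2 * dotp (x : 'rV[R]_d) x)%:E)%E.
Proof.
move=> mr; under [RHS]eq_integral do rewrite -sum_radial2.
rewrite rint_sum.
- under eq_bigr => i _ do rewrite (radial_moment_eq gauss mr i i0)//.
  by rewrite sumr_const card_ord mule_natl.
- by move=> i; apply: measurable_funX; exact: measurable_radial.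
- by move=> i x; exact: sqr_ge0.
Qed.

(** The squared coordinates of a unit vector sum to 1 and have equal
    expectations. (The sum is 0 for the zero vector.) *)
Lemma gaussian_direction_second_moment w :
  (\int[nu]_x ((dotp w x / enorm x) ^+ 2)%:E <= (dotp w w / d%:R)%:E)%E.
Proof.
have -> : (\int[nu]_x ((dotp w x / enorm x) ^+ 2)%:E =
    \int[nu]_x ((\sum_i w 0 i * radial inv_norm i x) ^+ 2)%:E)%E.
  by apply: eq_integral => x _; rewrite sum_radialE inv_normE mulrC.
rewrite (radial_second_moment gauss m_inv_norm w i0) EFinM.
apply: lee_wpmul2l; first by rewrite lee_fin dotpxx_ge0.
have : (d%:R%:E * \int[nu]_x (radial inv_norm i0 x ^+ 2)%:E <= 1)%E.
  rewrite sum_moment// -[leRHS](rint_cst nu); apply: rint_le => //.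
  - apply: measurable_funM; last exact: measurable_dotpxx.
    apply: measurable_funX; apply: measurableT_comp => //.
    exact: measurable_dotpxx.
  - by move=> x; rewrite mulr_ge0 ?sqr_ge0 ?dotpxx_ge0.
  move=> x; rewrite inv_norm_sqr ?dotpxx_ge0//.
  by have [->|x0] := eqVneq (dotp x x) 0; rewrite ?mulr0 ?mulVf.
by rewrite -lee_pdivlMl// mule1.
Qed.

(** If |x|^2 < d / 512, at most d / 8 coordinates exceed 1 / 8 in absolute
    value, so at least 7 d / 8 do not; but each coordinate is that small with
    probability at most 1 / 8. Markov's inequality gives 1 / 7. *)
Let small_norm_prob : (\int[nu]_x ((dotp (x : 'rV[R]_d) x < thr)%R%:R)%:E <= (4^-1)%:E)%E.
Proof.
pose small (i : 'I_d) (x : 'rV[R]_d) : R := (`|x 0 i| < 8^-1)%R%:R.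
have m_lt (h : borel_rV R d -> R) (a : R) : measurable_fun setT h ->
    measurable_fun setT (fun x : borel_rV R d => ((h x < a)%R%:R : R)).
  move=> mh; rewrite (_ : (fun x : borel_rV R d => _) = (fun x => if h x < a then 1 else 0)).
    by apply: measurable_funif => //; exact: measurable_fun_ltr.
  by apply/funext => x; case: ifP.
have m_small i : measurable_fun [set: borel_rV R d] (fun x : borel_rV R d => small i x).
  apply: m_lt; apply: measurableT_comp => //; exact: measurable_coord.
have b0 (b : bool) : 0 <= b%:R :> R by rewrite ler0n.
have small0 i x : 0 <= small i x by exact: b0.
have small_le i : (\int[nu]_x (small i x)%:E <= (8^-1)%:E)%E.
  rewrite (gaussian_marginal gauss i (phi := fun r => (`|r| < 8^-1)%R%:R))//.
    have ballE (r : R) : (`|r| < 8^-1)%R%:R = \1_(ball (0 : R) 8^-1) r :> R.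
      rewrite indicE; congr ((nat_of_bool _)%:R).
      by apply/idP/idP; rewrite inE -ball_normE /ball_/= sub0r normrN.
    under eq_integral do rewrite ballE.
    rewrite integral_indic//; last exact: measurable_ball.
    by rewrite setIT; apply: normal_small_ball; rewrite invr_ge0.
  rewrite (_ : (fun r : R => _) = (fun r : R => if `|r| < 8^-1 then 1 else 0)).
    apply: measurable_funif => //; apply: measurable_fun_ltr => //.
  by apply/funext => x; case: ifP.
apply: (@le_trans _ _ (\int[nu]_x ((8 / (7 * d%:R)) * \sum_i small i x)%:E)%E).
  apply: rint_le.
  - by apply: m_lt; exact: measurable_dotpxx.
  - by apply: measurable_funM => //; exact: measurable_sum.
  - by move=> x; exact: b0.
  move=> x; have [xthr|_] := ltP (dotp x x) thr; last first.
    by rewrite mulr_ge0 ?divr_ge0 ?mulr_ge0 ?(ltW dR_gt0)//; exact: sumr_ge0.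
  have h : \sum_(i < d) (1 - small i x) <= 64 * dotp x x.
    rewrite mulr_sumr; apply: ler_sum => i _; rewrite /small.
    case: ltP => [_|xi]; first by rewrite subrr -expr2 mulr_ge0 ?sqr_ge0.
    rewrite subr0 -expr2 -real_normK ?num_real//.
    have h8 : 0 <= 8^-1 :> R by rewrite invr_ge0.
    by have := ler_pM h8 h8 xi xi; rewrite expr2; lra.
  rewrite sumrB sumr_const card_ord in h.
  rewrite mulrAC ler_pdivlMr ?mulr_gt0// mul1r.
  move: h xthr; rewrite /thr; move: (\sum_i _) => s h xthr.
  have : 64 * dotp x x <= d%:R / 8 by lra.
  lra.
rewrite rintZ; last 3 first.
- exact: measurable_sum.
- by move=> x; exact: sumr_ge0.
- by rewrite divr_ge0 ?mulr_ge0 ?(ltW dR_gt0).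
rewrite rint_sum//.
apply: (@le_trans _ _ ((8 / (7 * d%:R))%:E * \sum_(i < d) (8^-1 : R)%:E)%E).
  apply: lee_wpmul2l; first by rewrite lee_fin divr_ge0 ?mulr_ge0 ?(ltW dR_gt0).
  by apply: lee_sum => i _.
rewrite sumEFin -EFinM lee_fin sumr_const card_ord -[8^-1 *+ d]mulr_natr.
have -> : 8 / (7 * d%:R) * (8^-1 * d%:R) = 7^-1 :> R.
  by move: (d%:R : R) (lt0r_neq0 dR_gt0) => D D0; field.
lra.
Qed.

(** Summed over the coordinates, this is the probability of the event that
    |x|^2 is at least d / 512. *)
Let cut_second_moment :
  ((3 / 4 / d%:R)%:E <= \int[nu]_x (radial cut_inv_norm i0 x ^+ 2)%:E)%E.
Proof.
rewrite [in leLHS]mulrC EFinM lee_pdivrMl// sum_moment//.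
have mgood : measurable_fun [set: borel_rV R d]
    (fun x : borel_rV R d => ((dotp (x : 'rV[R]_d) x < thr)%R%:R : R)).
  rewrite (_ : (fun x : borel_rV R d => _) = (fun x => if dotp x x < thr then 1 else 0)).
    apply: measurable_funif => //; apply: measurable_fun_ltr => //.
    exact: measurable_dotpxx.
  by apply/funext => x; case: ifP.
have mcut : measurable_fun [set: borel_rV R d] (fun x : borel_rV R d =>
    cut_inv_norm (dotp (x : 'rV[R]_d) x) ^+ 2 * dotp (x : 'rV[R]_d) x).
  apply: measurable_funM; last exact: measurable_dotpxx.
  apply: measurable_funX; apply: measurableT_comp => //.
  exact: measurable_dotpxx.
have cut0 x : 0 <= cut_inv_norm (dotp x x) ^+ 2 * dotp x x.
  by rewrite mulr_ge0 ?sqr_ge0 ?dotpxx_ge0.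
have h : (\int[nu]_x (cut_inv_norm (dotp (x : 'rV[R]_d) x) ^+ 2 *
      dotp (x : 'rV[R]_d) x)%:E +
    \int[nu]_x ((dotp (x : 'rV[R]_d) x < thr)%R%:R)%:E = 1)%E.
  rewrite -rintD// -[RHS](rint_cst nu); apply: eq_integral => x _.
  congr (_%:E); rewrite /cut_inv_norm; case: ltP => [_|thrx].
    by rewrite expr0n mul0r add0r.
  rewrite addr0 inv_norm_sqr ?dotpxx_ge0// mulVf// gt_eqF//.
  exact: lt_le_trans thrx.
have [b /andP[b0 b4] bE] := rint_real (fun=> ler0n _ _) small_norm_prob.
rewrite bE in h.
have -> : (\int[nu]_x (cut_inv_norm (dotp (x : 'rV[R]_d) x) ^+ 2 *
    dotp (x : 'rV[R]_d) x)%:E = (1 - b)%:E)%E.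
  by rewrite EFinB -h addeK.
by rewrite lee_fin; lra.
Qed.

Let cut_fourth_moment :
  (\int[nu]_x (radial cut_inv_norm i0 x ^+ 4)%:E <=
   (64 * 512 ^+ 2 / d%:R ^+ 2)%:E)%E.
Proof.
apply: (@le_trans _ _ (\int[nu]_x ((512 / d%:R) ^+ 2 *
   (x : 'rV[R]_d) 0%R i0 ^+ 4)%:E)%E).
  apply: rint_le.
  - by apply: measurable_funX; exact: measurable_radial.
  - apply: measurable_funM => //; apply: measurable_funX.
    exact: measurable_coord.
  - by move=> x; exact: exprn_even_ge0.
  move=> x; rewrite /radial exprMn ler_wpM2r ?exprn_even_ge0//.
  rewrite /cut_inv_norm; case: ltP => [_|thrx].
    by rewrite expr0n/= sqr_ge0.
  have -> : 512 / d%:R = thr^-1 by rewrite /thr invfM invrK mulrC.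
  have le_inv : (dotp x x)^-1 <= thr^-1.
    by rewrite lef_pV2 ?posrE// (lt_le_trans thr_gt0).
  have inv0 : 0 <= (dotp x x)^-1 by rewrite invr_ge0 dotpxx_ge0.
  by rewrite (exprM _ 2 2) inv_norm_sqr ?dotpxx_ge0// !expr2; apply: ler_pM.
rewrite rintZ; last 3 first.
- by apply: measurable_funX; exact: measurable_coord.
- by move=> x; exact: exprn_even_ge0.
- exact: sqr_ge0.
rewrite (gaussian_marginal gauss i0 (phi := fun r => r ^+ 4))//; last first.
  by move=> r; exact: exprn_even_ge0.
have -> : 64 * 512 ^+ 2 / d%:R ^+ 2 = (512 / d%:R) ^+ 2 * 64 :> R.
  by rewrite exprMn exprVn; ring.
rewrite [leRHS]EFinM; apply: lee_wpmul2l; first by rewrite lee_fin sqr_ge0.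
exact: normal_fourth_moment.
Qed.

(** For a truncated random direction v, the expectation of <w, v>^4 is at most
    this constant times (|w|^2 / d)^2. The factors come from sign symmetry,
    from the normal fourth moment and from the truncation radius. *)
Definition kurtosis_bound : R := 3 * (64 * 512 ^+ 2).

(** Truncation only increases the integrand. For the truncated variable
    q, the expansion exp (- z) <= 1 - z + z^2 at z = s q has first-order term at
    least 3 / 4 of s |w|^2 / d, and the condition on s keeps the second-order
    term below 1 / 4 of it. *)
Lemma gaussian_direction_laplace w s : 0 <= s ->
  4 * kurtosis_bound * (s * dotp w w) <= d%:R ->
  (\int[nu]_x (expR (- (s * (dotp w x / enorm x) ^+ 2)))%:E <=
   (1 - s * dotp w w / (2 * d%:R))%:E)%E.
Proof.
move=> s0 sd; set W := dotp w w in sd *.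
have W0 : 0 <= W by exact: dotpxx_ge0.
pose q x : R := (\sum_i w 0 i * radial cut_inv_norm i x) ^+ 2.
have msum : measurable_fun [set: borel_rV R d]
    (fun x : borel_rV R d => \sum_i w 0 i * radial cut_inv_norm i x).
  apply: measurable_sum => i; apply: measurable_funM => //.
  exact: measurable_radial.
have mq : measurable_fun [set: borel_rV R d] (fun x : borel_rV R d => q x).
  exact: measurable_funX.
have msq : measurable_fun [set: borel_rV R d] (fun x : borel_rV R d => s * q x).
  exact: measurable_funM.
have mex : measurable_fun [set: borel_rV R d] (fun x : borel_rV R d => expR (- (s * q x))).
  by apply: measurableT_comp => //; exact: measurableT_comp.
have q0 x : 0 <= q x by exact: sqr_ge0.
have sq0 x : 0 <= s * q x by exact: mulr_ge0.
have q_le x : q x <= (dotp w x / enorm x) ^+ 2.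
  rewrite /q sum_radialE /cut_inv_norm; case: ifP => _.
    by rewrite mul0r expr0n sqr_ge0.
  by rewrite inv_normE mulrC.
have mdir : measurable_fun [set: borel_rV R d]
    (fun x : borel_rV R d => (dotp w x / enorm x) ^+ 2).
  apply: measurable_funX; apply: measurable_funM; first exact: measurable_dotp.
  under eq_fun do rewrite -inv_normE.
  by apply: measurableT_comp => //; exact: measurable_dotpxx.
apply: (@le_trans _ _ (\int[nu]_x (expR (- (s * q x)))%:E)%E).
  apply: rint_le => //.
  - by apply: measurableT_comp => //; apply: measurableT_comp => //; exact: measurable_funM.
  - by move=> x; rewrite ler_expR lerN2 ler_wpM2l.
have expq1 : (\int[nu]_x (expR (- (s * q x)))%:E <= 1%:E)%E.
  rewrite -[leRHS](rint_cst nu); apply: rint_le => //.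
  - by move=> x; rewrite -expR0 ler_expR oppr_le0.
have [A /andP[A0 A1] AE] := rint_real (fun=> expR_ge0 _) expq1.
have m4 : (\int[nu]_x (q x ^+ 2)%:E <= (kurtosis_bound * (W / d%:R) ^+ 2)%:E)%E.
  under eq_integral do rewrite /q -exprM.
  apply: (le_trans (radial_fourth_moment gauss m_cut_inv_norm w i0)).
  apply: (@le_trans _ _ ((3 * W ^+ 2)%:E * (64 * 512 ^+ 2 / d%:R ^+ 2)%:E)%E).
    by apply: lee_wpmul2l => //; rewrite lee_fin mulr_ge0 ?sqr_ge0.
  rewrite -EFinM lee_fin /kurtosis_bound exprMn exprVn.
  by rewrite le_eqVlt; apply/orP; left; apply/eqP; ring.
have [M /andP[M0 M1] ME] := rint_real (fun=> sqr_ge0 _) m4.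
have m2_ge : ((3 / 4 * (W / d%:R))%:E <= \int[nu]_x (q x)%:E)%E.
  rewrite (radial_second_moment gauss m_cut_inv_norm w i0).
  have -> : 3 / 4 * (W / d%:R) = W * (3 / 4 / d%:R) by ring.
  by rewrite EFinM; apply: lee_wpmul2l.
have sum_le : (\int[nu]_x (expR (- (s * q x)) + s * q x)%:E <=
    \int[nu]_x (1 + s ^+ 2 * q x ^+ 2)%:E)%E.
  apply: rint_le.
  - exact: measurable_funD.
  - apply: measurable_funD => //; apply: measurable_funM => //.
    exact: measurable_funX.
  - by move=> x; rewrite addr_ge0 ?expR_ge0.
  - by move=> x; have := expRN_le_quadratic (sq0 x); rewrite exprMn; lra.
move: sum_le; rewrite rintD//.
rewrite rintD//; last 2 first.
- by apply: measurable_funM => //; exact: measurable_funX.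
- by move=> x; rewrite mulr_ge0 ?sqr_ge0.
rewrite rint_cst rintZ// rintZ ?sqr_ge0//; last 2 first.
- exact: measurable_funX.
- by move=> x; exact: sqr_ge0.
rewrite AE ME -EFinM -EFinD => sum_le.
have : ((A + s * (3 / 4 * (W / d%:R)))%:E <= (1 + s ^+ 2 * M)%:E)%E.
  apply: le_trans sum_le; rewrite EFinD; apply: leeD => //.
  by rewrite EFinM; apply: lee_wpmul2l.
rewrite !lee_fin => Ale.
have sM : s ^+ 2 * M <= s * W / d%:R / 4.
  apply: (@le_trans _ _ (s ^+ 2 * (kurtosis_bound * (W / d%:R) ^+ 2))).
    by rewrite ler_wpM2l ?sqr_ge0.
  have -> : s ^+ 2 * (kurtosis_bound * (W / d%:R) ^+ 2) =
      (s * W / d%:R / 4) * ((4 * kurtosis_bound * (s * W)) / d%:R).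
    by move: (d%:R : R) (lt0r_neq0 dR_gt0) => D D0; field.
  rewrite ler_piMr ?ler_pdivrMr ?mul1r//.
  by rewrite !mulr_ge0 ?invr_ge0 ?(ltW dR_gt0).
have -> : s * W / (2 * d%:R) = s * W / d%:R / 2.
  by move: (d%:R : R) (lt0r_neq0 dR_gt0) => D D0; field.
have e : s * (3 / 4 * (W / d%:R)) = 3 / 4 * (s * W / d%:R) by ring.
rewrite e in Ale; lra.
Qed.

End GaussianDirection.

(** * Gradient noise *)

(** The linear term is kept exactly, so that it disappears when z has mean 0. *)
Lemma expR_le_addr {R : realType} (z : R) : expR z <= z + expR (2 * z ^+ 2).
Proof.
have h : 1 + 2 * z ^+ 2 <= expR (2 * z ^+ 2) by exact: expR_ge1Dx.
have [z0|z0] := leP z 0.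
  have := @expRN_le_quadratic R (- z); rewrite opprK sqrrN oppr_ge0 => /(_ z0).
  have := sqr_ge0 z; lra.
have [zh|zh] := leP (2^-1) z.
  apply: (@le_trans _ _ (expR (2 * z ^+ 2))); last by lra.
  by rewrite ler_expR expr2; nra.
have z1 : 0 < 1 - z by lra.
suff : expR z <= 1 + z + 2 * z ^+ 2 by lra.
rewrite -[z in leLHS]opprK expRN.
apply: (@le_trans _ _ (1 - z)^-1).
  by rewrite lef_pV2 ?posrE ?expR_gt0//; exact: expR_ge1Dx.
rewrite -[leLHS]mul1r ler_pdivrMr//.
have -> : (1 + z + 2 * z ^+ 2) * (1 - z) = 1 + z ^+ 2 * (1 - 2 * z) by ring.
by rewrite lerDl mulr_ge0 ?sqr_ge0//; lra.
Qed.

Lemma measurable_inv_enorm {R : realType} {d : nat} :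
  measurable_fun [set: borel_rV R d] (fun x : borel_rV R d => (enorm x)^-1 : R).
Proof.
rewrite (_ : (fun x => _) = (fun x : borel_rV R d => (dotp x x : R) `^ (- 2^-1))).
  apply: (measurableT_comp (measurable_powR _)); exact: measurable_dotpxx.
by apply/funext => x; rewrite powRN powR12_sqrt// dotpxx_ge0.
Qed.

Lemma dotp_dir_sqr_le {R : realType} {d : nat} (w v : 'rV[R]_d) :
  (dotp w v / enorm v) ^+ 2 <= dotp w w.
Proof.
have [->|v0] := eqVneq v 0.
  by rewrite dotp0r mul0r expr0n dotpxx_ge0.
rewrite exprMn exprVn ler_pdivrMr ?exprn_gt0 ?enorm_gt0// enorm_sqr.
exact: cauchy_schwarz.
Qed.

Section SubgaussianNoise.
Context {R : realType} {d : nat} {dX : measure_display} {X : measurableType dX}.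
Variables (D : probability X R) (n : X -> 'rV[R]_d) (sigma : R).
Hypothesis sigma_gt0 : 0 < sigma.
Hypothesis n_int : forall i, D.-integrable setT (fun s => (n s 0%R i)%:E).
Hypothesis n_mean : forall i, (\int[D]_s (n s 0%R i)%:E = 0)%E.
Hypothesis n_exp : forall la, 0 < la < sigma ^- 2 ->
  (\int[D]_s (expR (la * dotp (n s) (n s)))%:E <= (expR (la * sigma ^+ 2))%:E)%E.

Lemma measurable_noise i : measurable_fun setT (fun s => n s 0 i).
Proof. by have /measurable_int/measurable_EFinP := n_int i. Qed.

Lemma measurable_noise_dotp (w : 'rV[R]_d) : measurable_fun setT (fun s => dotp (n s) w).
Proof.
by apply: measurable_sum => i; apply: measurable_funM => //; exact: measurable_noise.
Qed.

Lemma measurable_noise_sqr : measurable_fun setT (fun s => dotp (n s) (n s)).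
Proof. by apply: measurable_sum => i; apply: measurable_funM; exact: measurable_noise. Qed.

Lemma noise_dotp_integrable (w : 'rV[R]_d) (y : R) :
  D.-integrable setT (fun s => (y * dotp (n s) w)%:E).
Proof.
rewrite (_ : (fun s => _) = (fun s => \sum_i (y * w 0 i)%:E * (n s 0%R i)%:E)%E).
  by apply: integrable_sum => // i _; exact: integrableZl.
apply/funext => s; rewrite mulr_sumr -sumEFin; apply: eq_bigr => i _.
by rewrite -EFinM; congr (_%:E); ring.
Qed.

Lemma noise_dotp_mean (w : 'rV[R]_d) (y : R) :
  (\int[D]_s (y * dotp (n s) w)%:E = 0)%E.
Proof.
transitivity (\int[D]_s \sum_i ((y * w 0%R i)%:E * (n s 0%R i)%:E))%E.
  apply: eq_integral => s _; rewrite mulr_sumr -sumEFin; apply: eq_bigr => i _.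
  by rewrite -EFinM; congr (_%:E); ring.
rewrite integral_sum//; last by move=> i; exact: integrableZl.
by rewrite big1// => i _; rewrite integralZl// n_mean mule0.
Qed.

Let sigma2 : 0 < sigma ^+ 2. Proof. exact: exprn_gt0. Qed.

Let m_exp (a : R) : measurable_fun setT (fun s => expR (a * dotp (n s) (n s))).
Proof.
by apply: measurableT_comp => //; apply: measurable_funM => //; exact: measurable_noise_sqr.
Qed.

(** For small y, integrating [expR_le_addr] leaves only exp (2 y^2 |n|^2), to
    which the sub-Gaussian hypothesis applies. For large y Young's
    inequality suffices: it gives the exponent y^2 sigma^2 / 2 + 1 / 2, whose
    last term is then at most y^2 sigma^2. *)
Lemma noise_mgf (w : 'rV[R]_d) (y : R) : dotp w w <= 1 ->
  (\int[D]_s (expR (y * dotp (n s) w))%:E <= (expR (2 * y ^+ 2 * sigma ^+ 2))%:E)%E.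
Proof.
move=> w1.
have mb : measurable_fun setT (fun s => expR (y * dotp (n s) w)).
  by apply: measurableT_comp => //; apply: measurable_funM => //; exact: measurable_noise_dotp.
have b_le s : dotp (n s) w ^+ 2 <= dotp (n s) (n s).
  by apply: (le_trans (cauchy_schwarz _ _)); rewrite ler_piMr// dotpxx_ge0.
have crude : (\int[D]_s (expR (y * dotp (n s) w))%:E <=
    (expR (y ^+ 2 * sigma ^+ 2 / 2 + 1 / 2))%:E)%E.
  pose th := (2 * sigma ^+ 2)^-1.
  have th0 : 0 < th by rewrite invr_gt0 mulr_gt0.
  have ths : th * sigma ^+ 2 = 1 / 2 by rewrite /th; field; rewrite gt_eqF.
  apply: (@le_trans _ _ (\int[D]_s
      (expR (y ^+ 2 * sigma ^+ 2 / 2) * expR (th * dotp (n s) (n s)))%:E)%E).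
    apply: rint_le => //.
    - exact: measurable_funM.
    - move=> s; rewrite -expRD ler_expR.
      (* Young: y b <= y^2 sigma^2 / 2 + b^2 / (2 sigma^2), with th = 1 / (2 sigma^2). *)
      have := sqr_ge0 (y * sigma ^+ 2 - dotp (n s) w) => h.
      have h2 : 0 <= th * (y * sigma ^+ 2 - dotp (n s) w) ^+ 2.
        by rewrite mulr_ge0// ltW.
      have e : th * (y * sigma ^+ 2 - dotp (n s) w) ^+ 2 =
         (th * sigma ^+ 2) * y ^+ 2 * sigma ^+ 2
         - 2 * (th * sigma ^+ 2) * y * dotp (n s) w + th * dotp (n s) w ^+ 2 by ring.
      rewrite e ths in h2.
      have := ler_wpM2l (ltW th0) (b_le s); lra.
  rewrite rintZ// ?expR_ge0// expRD EFinM; apply: lee_wpmul2l.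
    by rewrite lee_fin expR_ge0.
  rewrite -ths; apply: n_exp; rewrite th0/= /th invfM.
  rewrite gtr_pMl ?invr_gt0//; lra.
have [y_large|y_small] := leP 1 (2 * y ^+ 2 * sigma ^+ 2).
  by apply: (le_trans crude); rewrite lee_fin ler_expR; lra.
have [->|y0] := eqVneq y 0.
  rewrite expr0n/= mulr0 mul0r expR0.
  by under eq_integral do rewrite mul0r expR0; rewrite rint_cst.
have y2 : 0 < y ^+ 2 by rewrite lt_def sqr_ge0 sqrf_eq0 y0.
have lim : (\int[D]_s (expR ((2 * y ^+ 2) * dotp (n s) (n s)))%:E <=
    (expR (2 * y ^+ 2 * sigma ^+ 2))%:E)%E.
  apply: n_exp; rewrite mulr_gt0//=.
  by rewrite -[ltRHS]mul1r ltr_pdivlMr.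
have fin (f : X -> R) : measurable_fun setT f -> (forall s, 0 <= f s) -> forall c,
    (\int[D]_s (f s)%:E <= c%:E)%E -> D.-integrable setT (fun s => (f s)%:E).
  move=> mf f0 c fc; apply/integrableP; split; first exact/measurable_EFinP.
  under eq_integral do rewrite /= ger0_norm//.
  by apply: (le_lt_trans fc); exact: ltry.
have i1 : D.-integrable setT (fun s => (expR (y * dotp (n s) w))%:E).
  by apply: (fin _ mb _ _ crude) => s; exact: expR_ge0.
have i2 : D.-integrable setT (fun s => (expR ((2 * y ^+ 2) * dotp (n s) (n s)))%:E).
  by apply: (fin _ (m_exp _) _ _ lim) => s; exact: expR_ge0.
apply: (@le_trans _ _ (\int[D]_s ((y * dotp (n s) w)%:E +
    (expR ((2 * y ^+ 2) * dotp (n s) (n s)))%:E))%E).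
  apply: le_integral => //.
    by apply: integrableD => //; exact: noise_dotp_integrable.
  move=> s _; rewrite -EFinD lee_fin.
  apply: (le_trans (expR_le_addr _)); rewrite lerD2l ler_expR exprMn mulrA.
  by apply: ler_wpM2l => //; apply: mulr_ge0 => //; exact: ltW.
rewrite integralD//; last exact: noise_dotp_integrable.
by rewrite noise_dotp_mean add0e.
Qed.

(** The polynomial factor is absorbed by N <= 4 sigma^2 exp (N / (4 sigma^2)).
    The exponent rises to at most 3 / (4 sigma^2), still admissible, and
    exp (3 / 4) <= 4. *)
Lemma noise_sqr_exp (th : R) : 0 <= th -> 2 * th * sigma ^+ 2 <= 1 ->
  (\int[D]_s (dotp (n s) (n s) * expR (th * dotp (n s) (n s)))%:E <=
   (16 * sigma ^+ 2)%:E)%E.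
Proof.
move=> th0 ths; pose la := 3 / 4 / sigma ^+ 2.
have las : la * sigma ^+ 2 = 3 / 4 by rewrite /la divfK// gt_eqF.
apply: (@le_trans _ _ (\int[D]_s (4 * sigma ^+ 2 *
    expR (la * dotp (n s) (n s)))%:E)%E).
  apply: rint_le => //.
  - by apply: measurable_funM => //; exact: measurable_noise_sqr.
  - exact: measurable_funM.
  - by move=> s; rewrite mulr_ge0 ?dotpxx_ge0 ?expR_ge0.
  move=> s; move: (dotp _ _) (dotpxx_ge0 (n s)) => N N0.
  have hN : N <= 4 * sigma ^+ 2 * expR (N / (4 * sigma ^+ 2)).
    rewrite -ler_pdivrMl ?mulr_gt0// mulrC.
    by apply: le_trans (expR_ge1Dx _); rewrite lerDr.
  apply: (@le_trans _ _ (4 * sigma ^+ 2 * expR (N / (4 * sigma ^+ 2)) * expR (th * N))).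
    by rewrite ler_wpM2r ?expR_ge0.
  rewrite -mulrA ler_pM2l ?mulr_gt0// -expRD ler_expR.
  have -> : N / (4 * sigma ^+ 2) + th * N = ((4 * sigma ^+ 2)^-1 + th) * N by ring.
  rewrite ler_wpM2r// -(ler_pM2r sigma2) mulrDl las.
  have -> : (4 * sigma ^+ 2)^-1 * sigma ^+ 2 = 1 / 4.
    by field; rewrite gt_eqF.
  by lra.
rewrite rintZ//; last by rewrite mulr_ge0// ltW.
have -> : 16 * sigma ^+ 2 = 4 * sigma ^+ 2 * 4 by ring.
rewrite [leRHS]EFinM; apply: lee_wpmul2l; first by rewrite lee_fin mulr_ge0// ltW.
apply: (@le_trans _ _ (expR (la * sigma ^+ 2))%:E).
  apply: n_exp; rewrite /la divr_gt0//=.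
  by rewrite gtr_pMl ?invr_gt0//; lra.
rewrite lee_fin las -[expR _]invrK -expRN -[leRHS]invrK lef_pV2 ?posrE ?invr_gt0 ?expR_gt0//.
have := @expR_ge1Dx R (- (3 / 4)); lra.
Qed.

End SubgaussianNoise.

(** * Exponential moment of one step *)

Lemma expR_average4 {R : realType} (a b c e : R) :
  expR (a + b + c + e) <=
  4^-1 * (expR (4 * a) + expR (4 * b) + expR (4 * c) + expR (4 * e)).
Proof.
set m := a + b + c + e.
have h1 := expR_tangent (4 * a) m; have h2 := expR_tangent (4 * b) m.
have h3 := expR_tangent (4 * c) m; have h4 := expR_tangent (4 * e) m.
have : expR m * (1 + (4 * a - m)) + expR m * (1 + (4 * b - m)) +
    expR m * (1 + (4 * c - m)) + expR m * (1 + (4 * e - m)) = 4 * expR m.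
  by rewrite /m; ring.
lra.
Qed.

Section OneStep.
Context {R : realType} {d : nat} {dX : measure_display} {X : measurableType dX}.
Variables (nu : probability (borel_rV R d) R) (D : probability X R).
Hypothesis gauss : std_gaussian nu.
Hypothesis d_gt0 : (0 < d)%N.
Variables (L mu sigma : R) (f : 'rV[R]_d -> R) (xstar : 'rV[R]_d).
Hypothesis fssc : smooth_strongly_convex L mu f.
Hypothesis sigma_gt0 : 0 < sigma.
Hypothesis L_gt0 : 0 < L.
Variable (H : 'rV[R]_d -> X -> R) (x : 'rV[R]_d).
Hypothesis H_smooth : forall s, lipschitz_smooth L (H ^~ s).
Let g := grad f x.
Let n (s : X) := grad (H ^~ s) x - g.
Hypothesis n_int : forall i, D.-integrable setT (fun s => (n s 0%R i)%:E).
Hypothesis n_mean : forall i, (\int[D]_s (n s 0%R i)%:E = 0)%E.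
Hypothesis n_exp : forall la, 0 < la < sigma ^- 2 ->
  (\int[D]_s (expR (la * dotp (n s) (n s)))%:E <= (expR (la * sigma ^+ 2))%:E)%E.
Variables (al ga : R).
Hypothesis al_gt0 : 0 < al.
Hypothesis ga_ge0 : 0 <= ga.

(** One update with ga in place of 4 d / (mu tau), so that the step size is
    ga / |u|^2. *)
Definition sgd_move (u : 'rV[R]_d) (s : X) : 'rV[R]_d :=
  x - (ga / enorm u ^+ 2 * ((H (x + al *: u) s - H (x - al *: u) s) / (2 * al))) *: u.

Hypothesis m_move : measurable_fun [set: borel_rV R d * X]
  (fun z : borel_rV R d * X => f (sgd_move z.1 z.2)).

Let Z := (borel_rV R d * X)%type.
Let a (u : 'rV[R]_d) : R := dotp g u / enorm u.
Let b (u : 'rV[R]_d) (s : X) : R := dotp (n s) u / enorm u.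
Let N (s : X) : R := dotp (n s) (n s).

Let m_fst (h : borel_rV R d -> R) : measurable_fun setT h ->
  measurable_fun setT (fun z : Z => h z.1).
Proof. by move=> mh; exact: (measurableT_comp mh measurable_fst). Qed.

Let m_snd (h : X -> R) : measurable_fun setT h ->
  measurable_fun setT (fun z : Z => h z.2).
Proof. by move=> mh; exact: (measurableT_comp mh measurable_snd). Qed.

Let m_a : measurable_fun [set: borel_rV R d] (fun u : borel_rV R d => a u).
Proof.
by apply: measurable_funM; [exact: measurable_dotp|exact: measurable_inv_enorm].
Qed.

Let m_b : measurable_fun [set: Z] (fun z : Z => b z.1 z.2).
Proof.
apply: measurable_funM; last exact: (m_fst measurable_inv_enorm).
apply: measurable_sum => i; apply: measurable_funM.
  by apply: (@m_snd (fun s => n s 0 i)); exact: (measurable_noise n_int).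
by apply: (@m_fst (fun u : borel_rV R d => (u : 'rV[R]_d) 0 i)); exact: measurable_coord.
Qed.

Let m_N : measurable_fun [set: X] N.
Proof. exact: (measurable_noise_sqr n_int). Qed.

Let m_expR dT (T : measurableType dT) (h : T -> R) (c : R) : measurable_fun setT h ->
  measurable_fun setT (fun t => expR (c * h t)).
Proof. by move=> mh; apply: measurableT_comp => //; exact: measurable_funM. Qed.

Let int_fst (h : borel_rV R d -> R) : measurable_fun setT h -> (forall u, 0 <= h u) ->
  (\int[(nu \x D)%E]_z (h z.1)%:E = \int[nu]_u (h u)%:E)%E.
Proof.
move=> mh h0; rewrite fubini_tonelli1; last 2 first.
- by apply/measurable_EFinP; exact: (m_fst mh).
- by move=> z; rewrite lee_fin.
by apply: eq_integral => u _; rewrite /fubini_F/= rint_cst.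
Qed.

Let int_cst (c : R) : 0 <= c -> (\int[(nu \x D)%E]_z c%:E = c%:E)%E.
Proof.
move=> c0; rewrite (int_fst (h := cst c))//; exact: rint_cst.
Qed.

Variable la : R.
Hypothesis la_ge0 : 0 <= la.
(* The four ranges of validity: of the deterministic step, of the Laplace
transform, of the cross term and of the finite difference error. *)
Hypothesis c1 : 8 * L * ga <= 1.
Hypothesis c2 : 8 * kurtosis_bound * (la * ga * dotp g g) <= d%:R.
Hypothesis c3 : 32 * la * ga * sigma ^+ 2 <= 1.
Hypothesis c4 : 48 * d%:R * (la * ga * L ^+ 2 * al ^+ 2) <= 1.

Let lg0 : 0 <= la * ga. Proof. exact: mulr_ge0. Qed.
Let d0 : 0 < d%:R :> R. Proof. by rewrite ltr0n. Qed.

Let descent_term : (\int[(nu \x D)%E]_z (expR (- (2 * la * ga) * a z.1 ^+ 2))%:E <=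
  (1 - la * ga * dotp g g / d%:R)%:E)%E.
Proof.
have ma2 : measurable_fun [set: borel_rV R d] (fun u : borel_rV R d => a u ^+ 2).
  exact: measurable_funX.
rewrite (int_fst (h := fun u => expR (- (2 * la * ga) * a u ^+ 2)))//; last first.
  exact: m_expR.
have h0 : 0 <= 2 * la * ga by rewrite -mulrA mulr_ge0.
have := @gaussian_direction_laplace R d nu gauss d_gt0 g (2 * la * ga) h0.
have -> : 4 * kurtosis_bound * (2 * la * ga * dotp g g) =
  8 * kurtosis_bound * (la * ga * dotp g g) :> R by ring.
move=> /(_ c2); have -> : 1 - 2 * la * ga * dotp g g / (2 * d%:R) =
    1 - la * ga * dotp g g / d%:R.
  by move: (d%:R : R) (lt0r_neq0 d0) => e e0; field.
by apply: le_trans; under [leRHS]eq_integral do rewrite -mulNr.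
Qed.

(** Given u, the noise enters linearly with coefficient y = - 4 la ga a, which
    costs 2 y^2 sigma^2 = 32 (la ga)^2 a^2 sigma^2; c3 makes this smaller than
    the reserved la ga a^2. *)
Let cross_term : (\int[(nu \x D)%E]_z (expR (- (la * ga) *
   (a z.1 ^+ 2 + 4 * (a z.1 * b z.1 z.2))))%:E <= 1%:E)%E.
Proof.
have m2 : measurable_fun [set: Z] (fun z : Z => expR (- (la * ga) *
   (a z.1 ^+ 2 + 4 * (a z.1 * b z.1 z.2)))).
  apply: m_expR; apply: measurable_funD; first by apply: measurable_funX; exact: (m_fst m_a).
  by apply: measurable_funM => //; apply: measurable_funM => //; exact: (m_fst m_a).
rewrite fubini_tonelli1; last 2 first.
- exact/measurable_EFinP.
- by move=> z; rewrite lee_fin expR_ge0.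
rewrite -[leRHS](rint_cst nu).
apply: ge0_le_integral => //.
- by move=> u _; apply: rint_ge0 => s; exact: expR_ge0.
- apply: measurable_fun_fubini_tonelli_F; first exact/measurable_EFinP.
  by move=> z; rewrite lee_fin expR_ge0.
move=> u _; rewrite /fubini_F/=.
pose y := - (4 * la * ga) * a u.
pose w := (enorm u)^-1 *: u.
have w1 : dotp w w <= 1.
  rewrite /w dotpZl dotpZr; have [->|u0] := eqVneq u 0.
    by rewrite dotp0r !mulr0.
  rewrite -enorm_sqr le_eqVlt; apply/orP; left; apply/eqP.
  by field; rewrite gt_eqF// enorm_gt0.
under eq_integral => s _.
  have -> : - (la * ga) * (a u ^+ 2 + 4 * (a u * b u s)) =
      - (la * ga) * a u ^+ 2 + y * dotp (n s) w.
    by rewrite /b /w /y dotpZr; ring.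
  rewrite expRD; over.
rewrite rintZ ?expR_ge0//; last first.
  by apply: m_expR; exact: (measurable_noise_dotp n_int).
apply: (@le_trans _ _ ((expR (- (la * ga) * a u ^+ 2))%:E *
    (expR (2 * y ^+ 2 * sigma ^+ 2))%:E)%E).
  apply: lee_wpmul2l; first by rewrite lee_fin expR_ge0.
  exact: (noise_mgf sigma_gt0 n_int n_mean n_exp).
rewrite -EFinM lee_fin -expRD -[leRHS]expR0 ler_expR.
have -> : - (la * ga) * a u ^+ 2 + 2 * y ^+ 2 * sigma ^+ 2 =
   - ((la * ga * a u ^+ 2) * (1 - 32 * la * ga * sigma ^+ 2)).
  by rewrite /y; ring.
by rewrite oppr_le0 mulr_ge0 ?subr_ge0// mulr_ge0 ?sqr_ge0.
Qed.

(** exp (th b^2) <= 1 + th b^2 exp (th |n|^2) because b^2 <= |n|^2. The integral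
    over directions then replaces b^2 by |n|^2 / d, at fixed sample. *)
Let noise_term : (\int[(nu \x D)%E]_z (expR (8 * la * L * ga ^+ 2 * b z.1 z.2 ^+ 2))%:E <=
  (1 + 128 * la * L * ga ^+ 2 * sigma ^+ 2 / d%:R)%:E)%E.
Proof.
pose th := 8 * la * L * ga ^+ 2.
have thE : th = (8 * L * ga) * (la * ga) by rewrite /th; ring.
have th0 : 0 <= th by rewrite thE mulr_ge0 ?mulr_ge0 ?(ltW L_gt0).
have th_le : th <= la * ga by rewrite thE ler_piMl.
have ths : 2 * th * sigma ^+ 2 <= 1.
  have h0 : 0 <= la * ga * sigma ^+ 2 by rewrite mulr_ge0 ?sqr_ge0.
  have h1 : th * sigma ^+ 2 <= la * ga * sigma ^+ 2 by rewrite ler_wpM2r ?sqr_ge0.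
  have := c3; lra.
have b_le u s : b u s ^+ 2 <= N s by exact: dotp_dir_sqr_le.
have mb2 : measurable_fun [set: Z] (fun z : Z => b z.1 z.2 ^+ 2).
  exact: measurable_funX.
have mNexp : measurable_fun [set: X] (fun s => expR (th * N s)) by exact: m_expR.
have mprod : measurable_fun [set: Z] (fun z : Z => expR (th * N z.2) * b z.1 z.2 ^+ 2).
  by apply: measurable_funM => //; exact: (@m_snd (fun s => expR (th * N s))).
have prod0 (z : Z) : 0 <= expR (th * N z.2) * b z.1 z.2 ^+ 2.
  by rewrite mulr_ge0 ?expR_ge0 ?sqr_ge0.
apply: (@le_trans _ _ (\int[(nu \x D)%E]_z
    (1 + th * (expR (th * N z.2) * b z.1 z.2 ^+ 2))%:E)%E).
  apply: rint_le.
  - exact: m_expR.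
  - by apply: measurable_funD => //; exact: measurable_funM.
  - by move=> z; exact: expR_ge0.
  move=> z; rewrite -/th; set B := b _ _ ^+ 2.
  have B0 : 0 <= B by exact: sqr_ge0.
  have BN : th * B <= th * N z.2 by apply: ler_wpM2l => //; exact: b_le.
  have h1 := expR_tangent 0 (th * B).
  rewrite expR0 in h1.
  have h2 : expR (th * B) <= expR (th * N z.2) by rewrite ler_expR.
  have h3 : 0 <= th * B by exact: mulr_ge0.
  have := ler_wpM2l h3 h2; lra.
rewrite rintD//; last 2 first.
- exact: measurable_funM.
- by move=> z; exact: (mulr_ge0 th0 (prod0 z)).
rewrite int_cst// rintZ// EFinD; apply: leeD => //.
have -> : 128 * la * L * ga ^+ 2 * sigma ^+ 2 / d%:R = th * (d%:R^-1 * (16 * sigma ^+ 2)).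
  by rewrite /th; move: (d%:R : R) (lt0r_neq0 d0) => e e0; field.
rewrite [leRHS]EFinM; apply: lee_wpmul2l => //.
rewrite fubini_tonelli2; last 2 first.
- exact/measurable_EFinP.
- by move=> z; rewrite lee_fin; exact: prod0.
apply: (@le_trans _ _ (\int[D]_s (d%:R^-1 * (N s * expR (th * N s)))%:E)%E); last first.
  rewrite rintZ; last 3 first.
  - exact: measurable_funM.
  - by move=> s; rewrite mulr_ge0 ?dotpxx_ge0 ?expR_ge0.
  - by rewrite invr_ge0 ltW.
  rewrite EFinM; apply: lee_wpmul2l; first by rewrite lee_fin invr_ge0 ltW.
  exact: (noise_sqr_exp sigma_gt0 n_int n_exp).
apply: ge0_le_integral => //.
- by move=> s _; apply: rint_ge0 => u; exact: (prod0 (u, s)).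
- apply: measurable_fun_fubini_tonelli_G; first exact/measurable_EFinP.
  by move=> z; rewrite lee_fin; exact: prod0.
- by apply/measurable_EFinP; apply: measurable_funM => //; exact: measurable_funM.
move=> s _; rewrite /fubini_G/= rintZ ?expR_ge0//; last 2 first.
- apply: measurable_funX; apply: measurable_funM; last exact: measurable_inv_enorm.
  exact: measurable_dotp.
- by move=> u; exact: sqr_ge0.
have -> : d%:R^-1 * (N s * expR (th * N s)) = expR (th * N s) * (N s / d%:R) by ring.
rewrite EFinM; apply: lee_wpmul2l; first by rewrite lee_fin expR_ge0.
exact: gaussian_direction_second_moment.
Qed.

Let difference_term : (\int[(nu \x D)%E]_z (expR (12 * la * ga *
   (L ^+ 2 * al ^+ 2 * dotp (z.1 : 'rV[R]_d) z.1)))%:E <=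
   (1 + 48 * d%:R * (la * ga * L ^+ 2 * al ^+ 2))%:E)%E.
Proof.
pose y := 12 * (la * ga * L ^+ 2 * al ^+ 2).
have y0 : 0 <= y.
  apply: mulr_ge0 => //; apply: mulr_ge0; last exact: sqr_ge0.
  by apply: mulr_ge0 => //; exact: sqr_ge0.
rewrite (int_fst (h := fun u => expR (12 * la * ga *
   (L ^+ 2 * al ^+ 2 * dotp (u : 'rV[R]_d) u)))); last 2 first.
- by apply: m_expR; apply: measurable_funM => //; exact: measurable_dotpxx.
- by move=> u; exact: expR_ge0.
have e : 48 * d%:R * (la * ga * L ^+ 2 * al ^+ 2) = 4 * d%:R * y by rewrite /y; ring.
have := @gaussian_expR_norm R d nu gauss d_gt0 y y0; rewrite -e => /(_ c4).
apply: le_trans; under [leRHS]eq_integral => u _.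
  have -> : y * dotp u u = 12 * la * ga * (L ^+ 2 * al ^+ 2 * dotp u u).
    by rewrite /y; ring.
  over.
by [].
Qed.

(** Of the gain 3/4 ga a^2, the part 1/2 serves as descent and the part 1/4 is
    reserved for the cross term; the exponential of the sum of the four pieces
    is at most the average of the exponentials of four times each piece. *)
Lemma one_step_exp_moment :
  (\int[(nu \x D)%E]_z (expR (la * (f (sgd_move z.1 z.2) - f x)))%:E <=
   (1 - la * ga * dotp g g / (4 * d%:R) + 32 * la * L * ga ^+ 2 * sigma ^+ 2 / d%:R
      + 12 * d%:R * (la * ga * L ^+ 2 * al ^+ 2))%:E)%E.
Proof.
pose e1 (z : Z) := expR (- (2 * la * ga) * a z.1 ^+ 2).
pose e2 (z : Z) := expR (- (la * ga) * (a z.1 ^+ 2 + 4 * (a z.1 * b z.1 z.2))).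
pose e3 (z : Z) := expR (8 * la * L * ga ^+ 2 * b z.1 z.2 ^+ 2).
pose e4 (z : Z) := expR (12 * la * ga *
   (L ^+ 2 * al ^+ 2 * dotp (z.1 : 'rV[R]_d) z.1)).
have ma2 : measurable_fun [set: Z] (fun z : Z => a z.1 ^+ 2).
  by apply: measurable_funX; exact: (m_fst m_a).
have me1 : measurable_fun setT e1 by exact: m_expR.
have me2 : measurable_fun setT e2.
  apply: m_expR; apply: measurable_funD => //.
  by apply: measurable_funM => //; apply: measurable_funM => //; exact: (m_fst m_a).
have me3 : measurable_fun setT e3 by apply: m_expR; exact: measurable_funX.
have me4 : measurable_fun setT e4.
  apply: m_expR; apply: measurable_funM => //.
  by apply: (@m_fst (fun u : borel_rV R d => dotp (u : 'rV[R]_d) u)); exact: measurable_dotpxx.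
have me12 : measurable_fun setT (fun z => e1 z + e2 z) by exact: measurable_funD.
have me123 : measurable_fun setT (fun z => e1 z + e2 z + e3 z) by exact: measurable_funD.
have me : measurable_fun setT (fun z => e1 z + e2 z + e3 z + e4 z) by exact: measurable_funD.
have p1 z : 0 <= e1 z by exact: expR_ge0.
have p2 z : 0 <= e2 z by exact: expR_ge0.
have p3 z : 0 <= e3 z by exact: expR_ge0.
have p4 z : 0 <= e4 z by exact: expR_ge0.
have p12 z : 0 <= e1 z + e2 z by exact: addr_ge0.
have p123 z : 0 <= e1 z + e2 z + e3 z by exact: addr_ge0.
have p z : 0 <= e1 z + e2 z + e3 z + e4 z by exact: addr_ge0.
apply: (@le_trans _ _ (\int[(nu \x D)%E]_z
   (4^-1 * (e1 z + e2 z + e3 z + e4 z))%:E)%E).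
  apply: rint_le.
  - by apply: m_expR; exact: measurable_funB.
  - exact: measurable_funM.
  - by move=> z; exact: expR_ge0.
  move=> -[u s] /=.
  have st := sgd_step_le fssc al_gt0 ga_ge0 c1 (H_smooth s) (ltW L_gt0)
    (erefl (dotp (grad f x) u / enorm u))
    (erefl (dotp (grad (H ^~ s) x - grad f x) u / enorm u)).
  apply: le_trans (le_trans _ (expR_average4 (- (la * ga / 2) * a u ^+ 2)
    (- (la * ga / 4) * (a u ^+ 2 + 4 * (a u * b u s)))
    (2 * la * L * ga ^+ 2 * b u s ^+ 2)
    (3 * la * ga * (L ^+ 2 * al ^+ 2 * dotp u u)))) _.
    rewrite ler_expR; have := ler_wpM2l la_ge0 st; rewrite -/g -/(n s) -/(a u) -/(b u s).
    rewrite -/(sgd_move u s) => /le_trans; apply.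
    by rewrite le_eqVlt; apply/orP; left; apply/eqP; field.
  rewrite /e1 /e2 /e3 /e4 /=.
  rewrite le_eqVlt; apply/orP; left; apply/eqP.
  by congr (_ * (expR _ + expR _ + expR _ + expR _)); field.
rewrite rintZ// !rintD//.
apply: (@le_trans _ _ (4^-1%:E * ((1 - la * ga * dotp g g / d%:R)%:E + 1%:E +
   (1 + 128 * la * L * ga ^+ 2 * sigma ^+ 2 / d%:R)%:E +
   (1 + 48 * d%:R * (la * ga * L ^+ 2 * al ^+ 2))%:E))%E).
  apply: lee_wpmul2l => //.
  by apply: leeD; [apply: leeD; [apply: leeD|]|].
rewrite -!EFinD -EFinM lee_fin.
rewrite le_eqVlt; apply/orP; left; apply/eqP.
by move: (d%:R : R) (lt0r_neq0 d0) => e e0; field.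
Qed.

End OneStep.

(** * The potential *)

Section Potential.
Context {R : realType} {d : nat} {dX : measure_display} {X : measurableType dX}.
Variables (nu : probability (borel_rV R d) R) (D : probability X R).
Hypothesis gauss : std_gaussian nu.
Hypothesis d_gt1 : (1 < d)%N.
Variables (L mu sigma : R) (f : 'rV[R]_d -> R) (xstar : 'rV[R]_d).
Hypothesis fssc : smooth_strongly_convex L mu f.
Hypothesis fmin : unique_minimizer f xstar.
Hypothesis sigma_gt0 : 0 < sigma.
Hypothesis mu_gt0 : 0 < mu.
Hypothesis mu_le_L : mu <= L.
Variable (H : 'rV[R]_d -> X -> R).
Hypothesis H_smooth : forall s, lipschitz_smooth L (H ^~ s).
Hypothesis n_int : forall x i,
  D.-integrable setT (fun s => ((grad (H ^~ s) x - grad f x) 0%R i)%:E).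
Hypothesis n_mean : forall x i,
  (\int[D]_s ((grad (H ^~ s) x - grad f x) 0%R i)%:E = 0)%E.
Hypothesis n_exp : forall x la, 0 < la < sigma ^- 2 ->
  (\int[D]_s (expR (la * dotp (grad (H ^~ s) x - grad f x)
                             (grad (H ^~ s) x - grad f x)))%:E
   <= (expR (la * sigma ^+ 2))%:E)%E.
Variables (T : nat) (K p : R).

Let T0 : R := offset (d := d) L mu.
Let al : R := smoothing (d := d) L mu T.
Let tau (t : nat) : R := t%:R + T0.
Let ga (t : nat) : R := 4 * d%:R / (mu * tau t).
Let gap x := f x - f xstar.

Hypothesis p_gt0 : 0 < p.
Hypothesis p_le_d : 4 * kurtosis_bound * p <= d%:R.
Hypothesis K_gt0 : 0 < K.
Hypothesis K_sigma : 256 * sigma ^+ 2 <= K * mu.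
Hypothesis K_L : 384 * L ^+ 2 <= K * mu.
Hypothesis K_p : 2 * (512 * L * sigma ^+ 2 / mu ^+ 2 + 48 * L ^+ 2 / mu) <= K * p.

(** The share of the noise that is still to come: the step at time s
    consumes 1 / (s + T0). *)
Definition noise_budget (t : nat) : R :=
  1 + \sum_(t <= s < T) (s%:R + offset (d := d) L mu)^-1.

Definition potential (t : nat) (x : 'rV[R]_d) : R :=
  (t%:R + offset (d := d) L mu) * (f x - f xstar) + K * d%:R * p * noise_budget t.

Let L_gt0 : 0 < L. Proof. exact: lt_le_trans mu_le_L. Qed.
Let d2 : 2 <= d%:R :> R. Proof. by rewrite (ler_nat R 2). Qed.
Let d0 : 0 < d%:R :> R. Proof. by rewrite ltr0n ltnW. Qed.

Let T0E : mu * T0 = 32 * d%:R * L.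
Proof. by rewrite /T0 /offset mulrC divfK// gt_eqF. Qed.

Let T0_ge : 64 <= T0.
Proof.
rewrite /T0 /offset ler_pdivlMr//.
have : mu * 2 <= L * d%:R by apply: ler_pM => //; exact: ltW.
lra.
Qed.

Let tau_ge t : T0 <= tau t. Proof. by rewrite lerDr. Qed.
Let tau_ge1 t : 1 <= tau t. Proof. by have := tau_ge t; have := T0_ge; lra. Qed.
Let tau_gt0 t : 0 < tau t. Proof. by have := tau_ge1 t; lra. Qed.

Lemma noise_budget_ge1 t : 1 <= noise_budget t.
Proof.
rewrite lerDl; apply: sumr_ge0 => s _; rewrite invr_ge0.
exact: ltW (tau_gt0 s).
Qed.

Lemma noise_budgetS t : (t < T)%N -> noise_budget t = (tau t)^-1 + noise_budget t.+1.
Proof. by move=> tT; rewrite /noise_budget big_ltn// addrCA. Qed.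

Lemma gap_ge0 x : 0 <= gap x.
Proof. by rewrite subr_ge0; exact: minimizer_le. Qed.

Let KDP_gt0 : 0 < K * d%:R * p. Proof. by rewrite !mulr_gt0. Qed.

Lemma potential_ge t x : K * d%:R * p <= potential t x.
Proof.
rewrite /potential -[leLHS]add0r; apply: lerD.
  apply: mulr_ge0; [exact: ltW (tau_gt0 t)|exact: gap_ge0].
by rewrite ler_pMr//; exact: noise_budget_ge1.
Qed.

Lemma potential_gt0 t x : 0 < potential t x.
Proof. exact: lt_le_trans (potential_ge t x). Qed.

Lemma gap_le_potential t x : tau t * gap x <= potential t x.
Proof.
rewrite /potential lerDl mulr_ge0// ?(ltW KDP_gt0)//.
by have := noise_budget_ge1 t; lra.
Qed.

Let gaE t : mu * tau t * ga t = 4 * d%:R.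
Proof. by rewrite /ga mulrC divfK// gt_eqF// mulr_gt0. Qed.

Let ga_ge0 t : 0 <= ga t.
Proof.
rewrite /ga divr_ge0//; first by rewrite mulr_ge0// ltW.
Qed.

Let ga_L t : 8 * L * ga t <= 1.
Proof.
rewrite /ga mulrA ler_pdivrMr ?mulr_gt0// mul1r.
apply: (@le_trans _ _ (mu * T0)); last by rewrite ler_pM2l.
by rewrite T0E; lra.
Qed.

Let al_sqr : al ^+ 2 = (d%:R * (T%:R + T0))^-1.
Proof.
rewrite /al /smoothing exprVn sqr_sqrtr// mulr_ge0 ?(ltW d0)//.
exact: ltW (tau_gt0 T).
Qed.

Let al_gt0 : 0 < al.
Proof. by rewrite /al /smoothing invr_gt0 sqrtr_gt0 mulr_gt0// tau_gt0. Qed.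

Let z_move t x (z : borel_rV R d * X) := sgd_move H x al (ga t) z.1 z.2.

(** Since ln (1 + z) <= z, the increment of p ln S is at most linear in
    f x' - f x with slope la = p (tau + 1) / S, so the exponential moment of one
    step applies. From S >= tau gap and S >= K d p follow la gap <= 2 p and
    la K d <= 2 tau; these keep la in the four admissible ranges. *)
Lemma potential_step t x : (t < T)%N ->
  measurable_fun [set: borel_rV R d * X] (fun z => f (z_move t x z)) ->
  (\int[(nu \x D)%E]_z (expR (p * ln (potential t.+1 (z_move t x z))))%:E <=
   (expR (p * ln (potential t x)))%:E)%E.
Proof.
move=> tT mz; set S := potential t x.
have S0 : 0 < S by exact: potential_gt0.
have S_KDP : K * d%:R * p <= S by exact: potential_ge.
have S_gap : tau t * gap x <= S by exact: gap_le_potential.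
have gx := gap_ge0 x; have t0 := tau_gt0 t; have t1 := tau_ge1 t.
pose la := p * (tau t + 1) / S.
have la_gt0 : 0 < la by rewrite /la divr_gt0 ?mulr_gt0//; lra.
(* The drift of p ln S that does not depend on the move: the weight tau grows by
1 and the noise budget shrinks by 1 / tau. *)
pose cst := la / (tau t + 1) * (gap x - K * d%:R * p / tau t).
have laS : la * S = p * (tau t + 1) by rewrite /la divfK// gt_eqF.
have la_gap : la * gap x <= 2 * p.
  rewrite -(ler_pM2l t0).
  have : la * (tau t * gap x) <= la * S by rewrite ler_wpM2l// ltW.
  rewrite laS; have : p * (tau t + 1) <= p * (2 * tau t) by rewrite ler_pM2l//; lra.
  lra.
have la_K : la * (K * d%:R) <= 2 * tau t.
  rewrite -(ler_pM2r p_gt0).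
  have : la * (K * d%:R * p) <= la * S by rewrite ler_wpM2l// ltW.
  rewrite laS; have : p * (tau t + 1) <= p * (2 * tau t) by rewrite ler_pM2l//; lra.
  lra.
have la_ga : la * ga t * (K * mu) <= 8.
  rewrite -(ler_pM2r (tau_gt0 t)).
  have -> : la * ga t * (K * mu) * tau t = la * (K * d%:R) * 4.
    transitivity (la * K * (mu * tau t * ga t)); first by ring.
    by rewrite gaE; ring.
  lra.
have lg0 : 0 <= la * ga t by rewrite mulr_ge0// ltW.
have G2le := grad_sqr_le fssc fmin x L_gt0.
have G2ge := grad_sqr_ge xstar fssc x mu_gt0.
set G2 := dotp (grad f x) (grad f x) in G2le G2ge.
have c2 : 8 * kurtosis_bound * (la * ga t * G2) <= d%:R.
  have h1 : la * ga t * G2 <= la * ga t * (2 * L * gap x) by rewrite ler_wpM2l.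
  have h2 : (8 * L * ga t) * (la * gap x) <= la * gap x.
    by rewrite ler_piMl// mulr_ge0// ltW.
  have h3 : la * ga t * G2 <= p / 2 by lra.
  have k0 : 0 <= 8 * kurtosis_bound :> R by rewrite /kurtosis_bound; lra.
  have := ler_wpM2l k0 h3; have := p_le_d; lra.
have c3 : 32 * la * ga t * sigma ^+ 2 <= 1.
  have := ler_wpM2l lg0 K_sigma; lra.
have TT0 : 1 <= T%:R + T0 by exact: tau_ge1.
have dal : d%:R * al ^+ 2 = (T%:R + T0)^-1.
  by rewrite al_sqr invfM mulrA mulfV ?mul1r// gt_eqF.
have c4 : 48 * d%:R * (la * ga t * L ^+ 2 * al ^+ 2) <= 1.
  have -> : 48 * d%:R * (la * ga t * L ^+ 2 * al ^+ 2) =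
    48 * (la * ga t * L ^+ 2) * (d%:R * al ^+ 2) by ring.
  rewrite dal ler_pdivrMr ?mul1r; last by lra.
  have := ler_wpM2l lg0 K_L; lra.
have step := one_step_exp_moment gauss (ltnW d_gt1) fssc sigma_gt0 L_gt0 H_smooth
  (n_int x) (n_mean x) (@n_exp x) al_gt0 (ga_ge0 t) mz (ltW la_gt0)
  (ga_L t) c2 c3 c4.
have SS y : potential t.+1 y = S + (tau t + 1) * (f y - f x) + gap x - K * d%:R * p / tau t.
  rewrite /S /potential (noise_budgetS tT) -natr1 /gap /tau -/T0; ring.
have pointwise y : expR (p * ln (potential t.+1 y)) <=
    expR (p * ln S + cst) * expR (la * (f y - f x)).
  rewrite -expRD ler_expR.
  have -> : p * ln S + cst + la * (f y - f x) = p * (ln S + (potential t.+1 y / S - 1)).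
    rewrite SS /cst /la; field.
    by rewrite !gt_eqF//; lra.
  rewrite ler_pM2l// -[leRHS]expRK.
  rewrite ler_ln ?posrE ?potential_gt0 ?expR_gt0//.
  rewrite expRD lnK ?posrE// -ler_pdivrMl// mulrC.
  by apply: le_trans (expR_ge1Dx _); lra.
have mf1 : measurable_fun [set: borel_rV R d * X]
    (fun z => expR (la * (f (z_move t x z) - f x))).
  by apply: measurableT_comp => //; apply: measurable_funM => //; exact: measurable_funB.
apply: (@le_trans _ _ (\int[(nu \x D)%E]_z (expR (p * ln S + cst) *
   expR (la * (f (z_move t x z) - f x)))%:E)%E).
  apply: rint_le.
  - apply: measurableT_comp => //; apply: measurable_funM => //.
    apply: measurableT_comp => //; apply: measurable_funD => //.
    by apply: measurable_funM => //; exact: measurable_funB.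
  - exact: measurable_funM.
  - by move=> z; exact: expR_ge0.
  - by move=> z; exact: pointwise.
rewrite rintZ ?expR_ge0//.
apply: (@le_trans _ _ ((expR (p * ln S + cst))%:E * (1 -
   la * ga t * G2 / (4 * d%:R) + 32 * la * L * ga t ^+ 2 * sigma ^+ 2 / d%:R +
   12 * d%:R * (la * ga t * L ^+ 2 * al ^+ 2))%:E)%E).
  by apply: lee_wpmul2l; first by rewrite lee_fin expR_ge0.
set E := (X in (1 - X + _ + _)); set B1 := (X in (1 - E + X + _)).
set B2 := (X in (1 - E + B1 + X)).
rewrite -EFinM lee_fin expRD -mulrA ler_piMr ?expR_ge0//.
apply: (@le_trans _ _ (expR cst * expR (- E + B1 + B2))).
  by rewrite ler_wpM2l ?expR_ge0//; apply: le_trans (expR_ge1Dx _); lra.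
rewrite -expRD -[leRHS]expR0 ler_expR.
have la_ge0 := ltW la_gt0; have L_ge0 := ltW L_gt0; have p_ge0 := ltW p_gt0.
have d_ge0 := ltW d0; have K_ge0 := ltW K_gt0.
have tV0 : 0 <= (tau t)^-1 by rewrite invr_ge0 ltW.
have muV0 : 0 <= mu^-1 by rewrite invr_ge0 ltW.
(* Up to the factor la, the descent E is at least 2 gap / tau by strong
convexity, against a drift of at most gap / tau - (d / tau^2) K p / 2. The
errors B1 and B2 are of order d / tau^2, and K_p makes K p / 2 dominate them. *)
have hE : 2 * la * gap x / tau t <= E.
  have -> : 2 * la * gap x / tau t = la * ga t * (2 * mu * gap x) / (4 * d%:R).
    by rewrite /ga; field; rewrite !gt_eqF.
  rewrite /E ler_pM2r ?invr_gt0 ?mulr_gt0//; apply: ler_wpM2l => //.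
have hB1 : B1 = la * d%:R / tau t ^+ 2 * (512 * L * sigma ^+ 2 / mu ^+ 2).
  by rewrite /B1 /ga; field; rewrite !gt_eqF.
have hB2 : B2 <= la * d%:R / tau t ^+ 2 * (48 * L ^+ 2 / mu).
  have -> : B2 = la * d%:R / tau t * (48 * L ^+ 2 / mu) * (T%:R + T0)^-1.
    have -> : B2 = 12 * (la * ga t * L ^+ 2) * (d%:R * al ^+ 2) by rewrite /B2; ring.
    by rewrite dal /ga; field; rewrite !gt_eqF//; lra.
  have -> : la * d%:R / tau t ^+ 2 * (48 * L ^+ 2 / mu) =
     la * d%:R / tau t * (48 * L ^+ 2 / mu) * (tau t)^-1.
    by field; rewrite !gt_eqF.
  apply: ler_wpM2l.
    apply: mulr_ge0; first by apply: mulr_ge0 => //; exact: mulr_ge0.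
    by apply: mulr_ge0 => //; apply: mulr_ge0 => //; exact: sqr_ge0.
  rewrite lef_pV2 ?posrE//; last by lra.
  by rewrite /tau lerD2r ler_nat ltnW.
have hcst : cst <= la * gap x / tau t - la * d%:R / tau t ^+ 2 * (K * p / 2).
  have -> : cst = la * gap x / (tau t + 1) - la * d%:R / tau t * (K * p) / (tau t + 1).
    by rewrite /cst; field; rewrite !gt_eqF//; lra.
  apply: lerB.
    apply: ler_wpM2l; first exact: mulr_ge0.
    by rewrite lef_pV2 ?posrE//; lra.
  have -> : la * d%:R / tau t ^+ 2 * (K * p / 2) =
      la * d%:R / tau t * (K * p) / (2 * tau t).
    by field; rewrite !gt_eqF.
  apply: ler_wpM2l.
    by apply: mulr_ge0; [apply: mulr_ge0 => //; exact: mulr_ge0|exact: mulr_ge0].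
  by rewrite lef_pV2 ?posrE ?mulr_gt0//; lra.
have c0 : 0 <= la * d%:R / tau t ^+ 2.
  by rewrite divr_ge0 ?sqr_ge0// mulr_ge0// ltW.
have := ler_wpM2l c0 K_p.
have g1 : 0 <= la * gap x / tau t by apply: mulr_ge0 => //; exact: mulr_ge0.
rewrite hB1; move: hE hB2 hcst; move: (la * d%:R / tau t ^+ 2) => M.
have -> : 2 * la * gap x / tau t = 2 * (la * gap x / tau t) by ring.
move: (la * gap x / tau t) g1 => Y g1; lra.
Qed.

End Potential.

(** * Joint measurability *)

Section Caratheodory.
Context {R : realType} {d : nat} {dX : measure_display} {X : measurableType dX}.
Variable H : 'rV[R]_d -> X -> R.
Hypothesis mH : forall x, measurable_fun setT (H x).
Hypothesis cH : forall s, continuous (H ^~ s).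

Let cell (n : nat) (x : 'rV[R]_d) : 'rV[int]_d :=
  \row_i Num.floor (x 0 i * n.+1%:R).

Let corner (n : nat) (k : 'rV[int]_d) : 'rV[R]_d :=
  \row_i ((k 0 i)%:~R / n.+1%:R).

Let measurable_cell n k : measurable [set x : borel_rV R d | cell n x = k].
Proof.
rewrite (_ : mkset _ = rV_box (fun i =>
    `[(k 0 i)%:~R / n.+1%:R, ((k 0 i)%:~R + 1) / n.+1%:R[%classic)).
  by apply: measurable_box => i; exact: measurable_itv.
have floorE i (x : 'rV[R]_d) : (cell n x 0 i == k 0 i) =
    (x 0 i \in `[(k 0 i)%:~R / n.+1%:R, ((k 0 i)%:~R + 1) / n.+1%:R[).
  by rewrite mxE in_itv/= ler_pdivrMr ?ltr0n// ltr_pdivlMr ?ltr0n// floor_eq intrD.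
apply/seteqP; split => [x /= xk i|x xk].
  by rewrite /= -floorE xk.
by apply/rowP => i; apply/eqP; rewrite floorE; exact: xk.
Qed.

Let corner_cvg (x : 'rV[R]_d) : corner n (cell n x) @[n --> \oo] --> x.
Proof.
apply/cvg_ballP => e e0; near=> n.
split=> // i j; rewrite (ord1 i) -ball_normE /ball_/= !mxE.
have n0 : 0 < n.+1%:R :> R by rewrite ltr0n.
have /andP[fl1 fl2] := floor_itv (x 0 j * n.+1%:R).
have en : n.+1%:R^-1 < e.
  near: n; exact: (near_infty_natSinv_lt (PosNum e0)).
have h1 : (Num.floor (x 0 j * n.+1%:R))%:~R / n.+1%:R <= x 0 j.
  by rewrite ler_pdivrMr.
have h2 : x 0 j < (Num.floor (x 0 j * n.+1%:R))%:~R / n.+1%:R + n.+1%:R^-1.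
  by rewrite -[X in _ + X]mul1r -mulrDl ltr_pdivlMr//; move: fl2; rewrite intrD.
by rewrite ger0_norm ?subr_ge0//; apply: lt_trans en; rewrite ltrBlDr addrC.
Unshelve. all: by end_near. Qed.

(** A function that is measurable in the sample and continuous in the point is
    the limit of the functions that round the point down to a grid of mesh
    1 / (n + 1); these are measurable because the grid has countably many
    cells. *)
Lemma caratheodory_measurable :
  measurable_fun setT (fun z : borel_rV R d * X => H z.1 z.2).
Proof.
pose h n (z : borel_rV R d * X) := H (corner n (cell n z.1)) z.2.
apply: (@measurable_fun_cvg _ _ R setT h) => [n _ B mB|[x s] _]; last first.
  have := @cH s x; apply: cvg_comp; exact: corner_cvg.
rewrite setTI (_ : h n @^-1` B = \bigcup_(k in [set: 'rV[int]_d])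
    ([set x : borel_rV R d | cell n x = k] `*` (H (corner n k) @^-1` B))).
  apply: countable_bigcupT_measurable; first exact: countableP.
  move=> k; apply: measurableX; first exact: measurable_cell.
  by rewrite -[X in measurable X]setTI; exact: mH.
apply/seteqP; split => [[x s] /= Bxs|[x s] [k _ [/= <- //]]].
by exists (cell n x).
Qed.

End Caratheodory.

(** * Independence from the past *)

Section IntegralOfIndependentPair.
Context {R : realType} {dW dY dZ : measure_display} {W : measurableType dW}
  {Y : measurableType dY} {Z : measurableType dZ}.
Variables (P : probability W R) (m : probability Z R).
Variables (G : set (set W)) (V : W -> Y) (U : W -> Z).
Hypothesis G_setI : setI_closed G.
Hypothesis G_setT : G setT.
Hypothesis G_meas : G `<=` measurable.
Hypothesis mU : measurable_fun setT U.
Hypothesis mV : measurable_fun [set: g_sigma_algebraType G] (V : g_sigma_algebraType G -> Y).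
Hypothesis G_indep : forall E B, G E -> measurable B ->
  (P (E `&` U @^-1` B) = P E * m B)%E.

Let mUB B : measurable B -> measurable (U @^-1` B).
Proof. by move=> mB; rewrite -[X in measurable X]setTI; exact: mU. Qed.

(** Both sides are finite measures in E that agree on the pi-system G. *)
Lemma sigma_algebra_independent E B : <<s G >> E -> measurable B ->
  (P (E `&` U @^-1` B) = P E * m B)%E.
Proof.
move=> GE mB.
have fB : m B \is a fin_num by exact: fin_num_measure.
have r0 : 0 <= fine (m B) by rewrite fine_ge0.
have rE : (((NngNum r0)%:num)%R%:E = m B)%E by rewrite /= fineK.
suff : mrestr P (mUB mB) E = mscale (NngNum r0) P E.
  by rewrite /mrestr /mscale rE [RHS]muleC.
apply: (g_sigma_algebra_measure_unique G G_meas (fun=> setT)) => //.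
- by rewrite bigcup_const.
- by move=> A GA; rewrite /= /mrestr /mscale rE G_indep// muleC.
- move=> _; rewrite /= /mrestr setTI; apply: (@le_lt_trans _ _ 1%E); last exact: ltry.
  exact: probability_le1 (mUB mB).
Qed.

Let mVW : measurable_fun [set: W] V.
Proof.
move=> _ A mA; have := mV measurableT mA; rewrite setTI => GA.
move: GA; apply: smallest_sub; last exact: G_meas.
exact: sigma_algebra_measurable.
Qed.

(** If V is measurable for the sigma-algebra of a pi-system of which U is
    independent, the law of (V, U) is a product, and Tonelli's theorem lets U be
    integrated out at fixed V. *)
Lemma integral_independent_pair (h : Y * Z -> \bar R) :
  measurable_fun setT h -> (forall z, 0 <= h z)%E ->
  (\int[P]_w h (V w, U w) = \int[P]_w \int[m]_z h (V w, z))%E.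
Proof.
move=> mh h0.
pose V' : {RV P >-> Y} := HB.pack V (isMeasurableFun.Build _ _ _ _ V mVW).
have mVU : measurable_fun [set: W] (fun w => (V w, U w)).
  exact: measurable_fun_pair.
pose VU : {RV P >-> (Y * Z)%type} :=
  HB.pack (fun w => (V w, U w)) (isMeasurableFun.Build _ _ _ _ _ mVU).
transitivity (\int[distribution P VU]_z h z)%E.
  by rewrite ge0_integral_distribution.
transitivity (\int[(distribution P V' \x m)%E]_z h z)%E.
  apply: eq_measure_integral => A mA _; apply/esym/product_measure_unique => // B C mB mC.
  change (P (V @^-1` B `&` U @^-1` C) = P (V @^-1` B) * m C)%E.
  apply: sigma_algebra_independent => //.
  by have := mV measurableT mB; rewrite setTI.
rewrite fubini_tonelli1// ge0_integral_distribution//.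
- exact: measurable_fun_fubini_tonelli_F.
- by move=> y; apply: integral_ge0 => z _; exact: h0.
Qed.

End IntegralOfIndependentPair.

Section DrawEvents.
Context {R : realType} {dW dU dX : measure_display} {W : measurableType dW}
  {U : measurableType dU} {X : measurableType dX}.
Variables (P : probability W R) (T : nat).
Variables (u : nat -> {RV P >-> U}) (xi : nat -> {RV P >-> X}).
Hypothesis indep : independent_draws T u xi.

Definition draw_event (A : 'I_T -> set U) (B : 'I_T -> set X) : set W :=
  [set w | forall t : 'I_T, A t (u t w) /\ B t (xi t w)].

(** Product events that only constrain the first m directions and the first n
    samples. Two indices are needed because the direction at time t is drawn
    after past_events t t and the sample after past_events t.+1 t. *)
Definition past_events (m n : nat) : set (set W) :=
  [set E | exists A B, [/\ forall t, measurable (A t), forall t, measurable (B t),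
    forall t : 'I_T, (m <= t)%N -> A t = setT,
    forall t : 'I_T, (n <= t)%N -> B t = setT & E = draw_event A B]].

Lemma past_events_setT m n : past_events m n setT.
Proof.
by exists (fun=> setT), (fun=> setT); split => //; apply/seteqP; split.
Qed.

Lemma past_events_setI m n : setI_closed (past_events m n).
Proof.
move=> _ _ [A [B [mA mB Am Bn ->]]] [A' [B' [mA' mB' A'm B'n ->]]].
exists (fun t => A t `&` A' t), (fun t => B t `&` B' t); split.
- by move=> t; exact: measurableI.
- by move=> t; exact: measurableI.
- by move=> t mt; rewrite Am// A'm// setTI.
- by move=> t nt; rewrite Bn// B'n// setTI.
apply/seteqP; split=> [w [h h'] t|w h].
  by have [? ?] := h t; have [? ?] := h' t.
by split=> t; have [[? ?] [? ?]] := h t.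
Qed.

Lemma past_events_measurable m n : past_events m n `<=` measurable.
Proof.
move=> _ [A [B [mA mB _ _ ->]]].
rewrite (_ : draw_event A B =
    \bigcap_(t in [set: 'I_T]) (u t @^-1` A t `&` xi t @^-1` B t)).
  apply: fin_bigcap_measurable => // t _; apply: measurableI.
  - rewrite -[X in measurable X]setTI.
    exact: (@measurable_funPT _ _ _ _ (u t) measurableT _ (mA t)).
  - rewrite -[X in measurable X]setTI.
    exact: (@measurable_funPT _ _ _ _ (xi t) measurableT _ (mB t)).
by apply/seteqP; split => [w h t _|w h t]; [exact: h|exact: h t I].
Qed.

Lemma past_events_sub m n m' n' : (m <= m')%N -> (n <= n')%N ->
  past_events m n `<=` past_events m' n'.
Proof.
move=> mm' nn' _ [A [B [mA mB Am Bn ->]]]; exists A, B; split => // t ht.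
- by apply: Am; exact: leq_trans ht.
- by apply: Bn; exact: leq_trans ht.
Qed.

Let P_preimageT dV (V : measurableType dV) (Y : {RV P >-> V}) :
  P (Y @^-1` setT) = 1%E.
Proof. by rewrite preimage_setT; exact: probability_setT. Qed.

Let draw_eventE A B : (forall t, measurable (A t)) -> (forall t, measurable (B t)) ->
  (P (draw_event A B) =
   \prod_(t < T) (P (u t @^-1` A t) * P (xi t @^-1` B t)))%E.
Proof. exact: indep. Qed.

Lemma direction_independent t (tT : (t < T)%N) E B : past_events t t E ->
  measurable B -> (P (E `&` u t @^-1` B) = P E * distribution P (u t) B)%E.
Proof.
move=> [A [B' [mA mB' Am Bn ->]]] mB; pose t' := Ordinal tT.
pose A' (s : 'I_T) := if s == t' then B else A s.
have mA' s : measurable (A' s) by rewrite /A'; case: ifP.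
have -> : draw_event A B' `&` u t @^-1` B = draw_event A' B'.
  apply/seteqP; split => [w [h Bw] s|w h].
    by rewrite /A'; have [? ?] := h s; case: eqP => [st|_]; split => //; rewrite st.
  split=> [s|]; last by have [+ _] := h t'; rewrite /A' eqxx.
  have [+ ?] := h s; rewrite /A'; case: eqP => // st _; split => //.
  by rewrite st Am.
rewrite !draw_eventE// (bigD1 t')//= [in RHS](bigD1 t')//= /A' eqxx Am//= Bn//.
rewrite !P_preimageT !mule1 mul1e muleC; congr (_ * _)%E.
by apply: eq_bigr => s /negbTE ->.
Qed.

Lemma sample_independent t (tT : (t < T)%N) E B : past_events t.+1 t E ->
  measurable B -> (P (E `&` xi t @^-1` B) = P E * distribution P (xi t) B)%E.
Proof.
move=> [A [B' [mA mB' Am Bn ->]]] mB; pose t' := Ordinal tT.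
pose B1 (s : 'I_T) := if s == t' then B else B' s.
have mB1 s : measurable (B1 s) by rewrite /B1; case: ifP.
have -> : draw_event A B' `&` xi t @^-1` B = draw_event A B1.
  apply/seteqP; split => [w [h Bw] s|w h].
    by rewrite /B1; have [? ?] := h s; case: eqP => [st|_]; split => //; rewrite st.
  split=> [s|]; last by have [_ +] := h t'; rewrite /B1 eqxx.
  have [? +] := h s; rewrite /B1; case: eqP => // st _; split => //.
  by rewrite st Bn.
rewrite !draw_eventE// (bigD1 t')//= [in RHS](bigD1 t')//= /B1 eqxx Bn//=.
rewrite !P_preimageT !mule1 muleAC; congr (_ * _)%E.
by congr (_ * _)%E; apply: eq_bigr => s /negbTE ->.
Qed.

Lemma measurable_past_sub {dY} {Y : measurableType dY} m n m' n' (V : W -> Y) :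
  (m <= m')%N -> (n <= n')%N ->
  measurable_fun [set: g_sigma_algebraType (past_events m n)] V ->
  measurable_fun [set: g_sigma_algebraType (past_events m' n')] V.
Proof.
move=> mm' nn' mV _ A mA; rewrite setTI.
have := mV measurableT A mA; rewrite setTI; apply: smallest_sub.
  exact: smallest_sigma_algebra.
move=> E GE; apply: sub_sigma_algebra; exact: past_events_sub GE.
Qed.

Lemma measurable_past_direction t m n : (t < T)%N -> (t < m)%N ->
  measurable_fun [set: g_sigma_algebraType (past_events m n)] (u t : W -> U).
Proof.
move=> tT tm _ A mA; rewrite setTI; apply: sub_sigma_algebra.
exists (fun s => if s == Ordinal tT then A else setT), (fun=> setT); split => //.
- by move=> s; case: ifP.
- by move=> s ms; case: eqP => // st; move: ms; rewrite st/= leqNgt tm.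
apply/seteqP; split => [w Aw s|w /(_ (Ordinal tT))[]]; last by rewrite eqxx.
by case: eqP => [->|].
Qed.

Lemma measurable_past_sample t m n : (t < T)%N -> (t < n)%N ->
  measurable_fun [set: g_sigma_algebraType (past_events m n)] (xi t : W -> X).
Proof.
move=> tT tn _ A mA; rewrite setTI; apply: sub_sigma_algebra.
exists (fun=> setT), (fun s => if s == Ordinal tT then A else setT); split => //.
- by move=> s; case: ifP.
- by move=> s ns; case: eqP => // st; move: ns; rewrite st/= leqNgt tn.
apply/seteqP; split => [w Aw s|w /(_ (Ordinal tT))[_]]; last by rewrite eqxx.
by case: eqP => [->|].
Qed.

End DrawEvents.

(** * High-probability bound for the potential *)

Lemma differentiable_measurable {R : realType} {d : nat} (h : 'rV[R]_d -> R) :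
  (forall x, differentiable h x) -> measurable_fun [set: borel_rV R d] h.
Proof.
by move=> dh; apply: continuous_measurable_rV => x; exact: differentiable_continuous.
Qed.

(** Since 1 / 0 = 0, the uniform formula also covers the zero direction. *)
Lemma step_sizeE {R : realType} {d : nat} (L mu : R) t (v : 'rV[R]_d) :
  step_size L mu t v = 4 * d%:R / (mu * (t%:R + offset (d := d) L mu)) / enorm v ^+ 2.
Proof.
rewrite /step_size; have [->|v0] := eqVneq v 0.
  by rewrite /enorm dotp0r sqrtr0 expr0n/= invr0 mulr0.
by rewrite [in LHS]invfM mulrA.
Qed.

Section Trajectory.
Context {R : realType} {d : nat} {dX dW : measure_display}
  {X : measurableType dX} {W : measurableType dW}.
Variables (D : probability X R) (P : probability W R).
Variables (L mu sigma : R) (f : 'rV[R]_d -> R) (xstar x0 : 'rV[R]_d) (T : nat).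
Variable (H : 'rV[R]_d -> X -> R).
Variables (u : nat -> {RV P >-> borel_rV R d}) (xi : nat -> {RV P >-> X}).
Hypothesis d_gt1 : (1 < d)%N.
Hypothesis fssc : smooth_strongly_convex L mu f.
Hypothesis fmin : unique_minimizer f xstar.
Hypothesis sigma_gt0 : 0 < sigma.
Hypothesis mu_gt0 : 0 < mu.
Hypothesis mu_le_L : mu <= L.
Hypothesis H_smooth : forall s, lipschitz_smooth L (H ^~ s).
Hypothesis mH : forall x, measurable_fun setT (H x).
Hypothesis n_int : forall x i,
  D.-integrable setT (fun s => ((grad (H ^~ s) x - grad f x) 0%R i)%:E).
Hypothesis n_mean : forall x i,
  (\int[D]_s ((grad (H ^~ s) x - grad f x) 0%R i)%:E = 0)%E.
Hypothesis n_exp : forall x la, 0 < la < sigma ^- 2 ->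
  (\int[D]_s (expR (la * dotp (grad (H ^~ s) x - grad f x)
                             (grad (H ^~ s) x - grad f x)))%:E
   <= (expR (la * sigma ^+ 2))%:E)%E.
Hypothesis u_gauss : forall t, (t < T)%N -> std_gaussian (distribution P (u t)).
Hypothesis xi_law : forall t, (t < T)%N -> forall B, measurable B ->
  distribution P (xi t) B = D B.
Hypothesis indep : independent_draws T u xi.
Variables (K p : R).
Hypothesis p_gt0 : 0 < p.
Hypothesis p_le_d : 4 * kurtosis_bound * p <= d%:R.
Hypothesis K_gt0 : 0 < K.
Hypothesis K_sigma : 256 * sigma ^+ 2 <= K * mu.
Hypothesis K_L : 384 * L ^+ 2 <= K * mu.
Hypothesis K_p : 2 * (512 * L * sigma ^+ 2 / mu ^+ 2 + 48 * L ^+ 2 / mu) <= K * p.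

Let V := borel_rV R d.
Let al : R := smoothing (d := d) L mu T.
Let ga (t : nat) : R := 4 * d%:R / (mu * (t%:R + offset (d := d) L mu)).
Let x_ (t : nat) (w : W) : V := zo_sgd H L mu T x0 (fun s => u s w) (fun s => xi s w) t.
Let move_ (t : nat) (y : V * V * X) : V := sgd_move H y.1.1 al (ga t) y.1.2 y.2.

Let x_S t w : x_ t.+1 w = move_ t ((x_ t w, u t w), xi t w).
Proof.
by rewrite /x_ /= /move_ /sgd_move /two_point_estimate step_sizeE scalerA.
Qed.

Let mH2 : measurable_fun [set: V * X] (fun z : V * X => H z.1 z.2).
Proof.
apply: caratheodory_measurable => // s x; have [dH _] := H_smooth s.
exact: differentiable_continuous.
Qed.

Let measurable_move t : measurable_fun [set: V * V * X] (move_ t).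
Proof.
have m11 : measurable_fun [set: V * V * X] (fun y : V * V * X => y.1.1).
  by apply: (measurableT_comp measurable_fst measurable_fst).
have m12 : measurable_fun [set: V * V * X] (fun y : V * V * X => y.1.2).
  by apply: (measurableT_comp measurable_snd measurable_fst).
have mx i : measurable_fun [set: V * V * X] (fun y : V * V * X => (y.1.1 : 'rV[R]_d) 0 i).
  exact: (measurableT_comp (measurable_coord i) m11).
have mv i : measurable_fun [set: V * V * X] (fun y : V * V * X => (y.1.2 : 'rV[R]_d) 0 i).
  exact: (measurableT_comp (measurable_coord i) m12).
have mHa (a : R) : measurable_fun [set: V * V * X]
    (fun y : V * V * X => H ((y.1.1 : 'rV[R]_d) + a *: (y.1.2 : 'rV[R]_d)) y.2).
  have mpair : measurable_fun [set: V * V * X] (fun y : V * V * X =>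
      ((y.1.1 : 'rV[R]_d) + a *: (y.1.2 : 'rV[R]_d) : V, y.2)).
    apply: measurable_fun_pair => //; apply: measurable_rV => i.
    under eq_fun do rewrite !mxE.
    by apply: measurable_funD => //; exact: measurable_funM.
  exact: (measurableT_comp mH2 mpair).
have minv : measurable_fun [set: V * V * X]
    (fun y : V * V * X => (enorm (y.1.2 : 'rV[R]_d) ^+ 2)^-1).
  under eq_fun do rewrite -exprVn.
  apply: measurable_funX; exact: (measurableT_comp measurable_inv_enorm m12).
apply: measurable_rV => i; rewrite /move_ /sgd_move.
under eq_fun do rewrite !mxE.
apply: measurable_funB => //; apply: measurable_funM => //.
apply: measurable_funM; first exact: measurable_funM.
apply: measurable_funM => //; apply: measurable_funB; first exact: mHa.
by under eq_fun do rewrite -scaleNr; exact: mHa.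
Qed.

Let measurable_past_x t : (t <= T)%N ->
  measurable_fun [set: g_sigma_algebraType (past_events T u xi t t)]
    (x_ t : g_sigma_algebraType _ -> V).
Proof.
elim: t => [_|t IH tT]; first exact: measurable_cst.
have -> : x_ t.+1 = (fun w => move_ t ((x_ t w, u t w), xi t w)).
  by apply/funext => w; exact: x_S.
have mx : measurable_fun [set: g_sigma_algebraType (past_events T u xi t.+1 t.+1)]
    (x_ t : g_sigma_algebraType _ -> V).
  by apply: (measurable_past_sub (leqnSn t) (leqnSn t)); exact: IH (ltnW tT).
apply: (measurableT_comp (measurable_move t)).
apply: measurable_fun_pair; last exact: measurable_past_sample.
by apply: measurable_fun_pair => //; exact: measurable_past_direction.
Qed.

Let measurable_x t : (t <= T)%N -> measurable_fun [set: W] (x_ t).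
Proof.
move=> tT _ A mA; rewrite setTI.
have := measurable_past_x tT measurableT mA; rewrite setTI.
apply: smallest_sub; last exact: past_events_measurable.
exact: sigma_algebra_measurable.
Qed.

Let S t x : R := potential (d := d) L mu f xstar T K p t x.

Let measurable_S t : measurable_fun [set: V] (fun x : V => S t x).
Proof.
rewrite /S /potential; apply: measurable_funD => //; apply: measurable_funM => //.
apply: measurable_funB => //; apply: differentiable_measurable.
by have [] := fssc.
Qed.

Let psi t x : R := expR (p * ln (S t x)).

Let measurable_psi t : measurable_fun [set: V] (fun x : V => psi t x).
Proof.
have mlnS : measurable_fun [set: V] (fun x : V => ln (S t x)).
  exact: (measurableT_comp (@measurable_ln R) (measurable_S t)).
have mplnS : measurable_fun [set: V] (fun x : V => p * ln (S t x)).
  exact: measurable_funM.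
exact: (measurableT_comp (@measurable_expR R) mplnS).
Qed.

(** The sample is integrated out given the iterate and the direction, then the
    direction given the iterate; what remains is the one-step bound at a
    deterministic point. *)
Let expected_step t : (t < T)%N ->
  (\int[P]_w (psi t.+1 (x_ t.+1 w))%:E <= \int[P]_w (psi t (x_ t w))%:E)%E.
Proof.
move=> tT; pose k (y : V * V * X) : \bar R := (psi t.+1 (move_ t y))%:E.
have mk : measurable_fun setT k.
  by apply/measurable_EFinP; exact: (measurableT_comp (measurable_psi _) (measurable_move t)).
have k0 y : (0 <= k y)%E by rewrite lee_fin expR_ge0.
under eq_integral do rewrite x_S -/(k _).
have -> : (\int[P]_w k (x_ t w, u t w, xi t w) =
    \int[P]_w \int[D]_s k ((x_ t w, u t w), s))%E.
  apply: (integral_independent_pair (G := past_events T u xi t.+1 t)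
    (V := fun w => (x_ t w, u t w))) => //.
  - exact: past_events_setI.
  - exact: past_events_setT.
  - exact: past_events_measurable.
  - apply: measurable_fun_pair; last exact: measurable_past_direction.
    by apply: (measurable_past_sub (leqnSn t) (leqnn t)); exact: measurable_past_x (ltnW tT).
  - by move=> E B GE mB; rewrite (sample_independent indep)// xi_law.
pose k2 (y : V * V) := (\int[D]_s k (y, s))%E.
have k20 y : (0 <= k2 y)%E by apply: integral_ge0.
have mk2 : measurable_fun setT k2 by exact: measurable_fun_fubini_tonelli_F.
have -> : (\int[P]_w k2 (x_ t w, u t w) =
    \int[P]_w \int[distribution P (u t)]_v k2 (x_ t w, v))%E.
  apply: (integral_independent_pair (G := past_events T u xi t t)) => //.
  - exact: past_events_setI.
  - exact: past_events_setT.
  - exact: past_events_measurable.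
  - exact: measurable_past_x (ltnW tT).
  - by move=> E B GE mB; exact: (direction_independent indep).
apply: ge0_le_integral => //.
- by move=> w _; apply: integral_ge0.
- have mk3 : measurable_fun setT
      (fun x : V => \int[distribution P (u t)]_v k2 (x, v))%E.
    exact: measurable_fun_fubini_tonelli_F.
  exact: (measurableT_comp mk3 (measurable_x (ltnW tT))).
- apply/measurable_EFinP.
  exact: (measurableT_comp (measurable_psi t) (measurable_x (ltnW tT))).
move=> w _; pose x : V := x_ t w; rewrite -/x.
have mpair : measurable_fun [set: V * X] (fun z : V * X => ((x, z.1), z.2)).
  by apply: measurable_fun_pair => //; exact: measurable_fun_pair.
have -> : (\int[distribution P (u t)]_v k2 (x, v) =
   \int[(distribution P (u t) \x D)%E]_z k ((x, z.1), z.2))%E.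
  rewrite fubini_tonelli1//.
  exact: (measurableT_comp mk mpair).
apply: (potential_step (u_gauss tT) d_gt1 fssc fmin sigma_gt0 mu_gt0 mu_le_L
  H_smooth n_int n_mean n_exp p_gt0 p_le_d K_gt0 K_sigma K_L K_p tT).
have mf : measurable_fun [set: V] f by apply: differentiable_measurable; have [] := fssc.
exact: (measurableT_comp mf (measurableT_comp (measurable_move t) mpair)).
Qed.

(** Markov's inequality for the p-th power of the potential; delta ^ (- 1 / p)
    is the resulting loss. *)
Lemma potential_high_probability (delta : R) : 0 < delta < 1 ->
  exists E : set W, [/\ measurable E, ((1 - delta)%:E <= P E)%E &
    forall w, E w -> potential (d := d) L mu f xstar T K p T
        (zo_sgd H L mu T x0 (fun s => u s w) (fun s => xi s w) T) <=
      expR (ln (1 / delta) / p) * potential (d := d) L mu f xstar T K p 0 x0].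
Proof.
move=> /andP[de0 de1].
have total t : (t <= T)%N -> (\int[P]_w (psi t (x_ t w))%:E <= (psi 0 x0)%:E)%E.
  elim: t => [_|t IH tT]; first by rewrite -[leRHS](rint_cst P).
  by apply: (le_trans (expected_step tT)); apply: IH; exact: ltnW.
pose thr := expR (ln (1 / delta) / p) * S 0 x0.
have S0 t x : 0 < S t x by exact: (potential_gt0 d_gt1 fmin mu_gt0 mu_le_L T p_gt0 K_gt0).
have thr0 : 0 < thr by rewrite /thr mulr_gt0 ?expR_gt0//; exact: S0.
have mST : measurable_fun [set: W] (fun w => S T (x_ T w)).
  exact: (measurableT_comp (measurable_S T) (measurable_x (leqnn T))).
pose E := [set w | S T (x_ T w) <= thr].
have mE : measurable E.
  rewrite -[E]setTI; apply: (@measurable_fun_ler _ _ _ setT _ (cst thr) mST _ measurableT [set true]) => //.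
exists E; split => //.
have mEC : measurable (~` E) by exact: measurableC.
suff PEC : (P (~` E) <= delta%:E)%E.
  rewrite -[E]setCK probability_setC// EFinB.
  by apply: leeB.
have M0 : 0 < psi 0 x0 / delta by rewrite divr_gt0 ?expR_gt0.
have : (\int[P]_w ((psi 0 x0 / delta) * \1_(~` E) w)%:E <= (psi 0 x0)%:E)%E.
  apply: le_trans (total T (leqnn T)); apply: rint_le.
  - by apply: measurable_funM => //; exact: measurable_indic.
  - exact: (measurableT_comp (measurable_psi T) (measurable_x (leqnn T))).
  - by move=> w; rewrite mulr_ge0// ltW.
  move=> w; rewrite indicE; have [|_] := boolP (w \in ~` E); last first.
    by rewrite mulr0 expR_ge0.
  rewrite inE /E /= => /negP; rewrite -ltNge => Sw; rewrite mulr1.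
  have -> : psi 0 x0 / delta = expR (p * ln thr).
    rewrite /thr lnM ?posrE ?expR_gt0// expRK mulrDr expRD mulrC; congr (_ * _).
    by rewrite mulrC divfK ?gt_eqF// lnK ?posrE ?divr_gt0// div1r.
  by rewrite ler_expR ler_pM2l// ler_ln ?posrE// ltW.
rewrite rintZ ?(ltW M0)//.
rewrite integral_indic// setIT -lee_pdivlMl// => /le_trans; apply.
by rewrite -EFinM lee_fin invf_div mulrAC -mulrA divff ?mulr1// gt_eqF// expR_gt0.
Qed.

End Trajectory.

(** * Logarithmic quantities *)

Section Rates.
Context {R : realType}.
Implicit Types x y q delta : R.

Lemma ln_le_subr1 x : 0 < x -> ln x <= x - 1.
Proof.
move=> x0; have := @le_ln1Dx R (x - 1).
by rewrite (_ : 1 + (x - 1) = x); [apply; lra|ring].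
Qed.

Lemma ln2_ge_half : 2^-1 <= ln 2 :> R.
Proof.
have := @ln_le_subr1 2^-1; rewrite lnV ?posrE// => h.
have : - ln 2 <= 2^-1 - 1 :> R by apply: h; rewrite invr_gt0.
lra.
Qed.

Lemma expR1_le4 : expR 1 <= 4 :> R.
Proof.
have := ln2_ge_half => h.
have : expR (2 * 2^-1) <= expR (2 * ln 2) :> R by rewrite ler_expR; lra.
rewrite mulfV// => /le_trans; apply.
by rewrite expRM_natl lnK ?posrE//; lra.
Qed.

Lemma ln_nondecreasing x y : 0 < x -> x <= y -> ln x <= ln y.
Proof. by move=> x0 xy; rewrite ler_ln ?posrE// (lt_le_trans x0). Qed.

(** 1 / r <= 2 / (r + 1) <= 2 (ln (r + 1) - ln r) for r >= 1. *)
Lemma sum_inv_le_ln (T : nat) (T0 : R) : 1 <= T0 ->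
  \sum_(0 <= s < T) (s%:R + T0)^-1 <= 2 * ln (T%:R + T0).
Proof.
move=> T01; elim: T => [|T IH].
  by rewrite big_geq// mulr_ge0// ln_ge0// add0r.
rewrite big_nat_recr//=; set r : R := T%:R + T0 in IH *.
have r1 : 1 <= r by rewrite /r -[leLHS]add0r lerD.
have -> : T.+1%:R + T0 = r + 1 by rewrite /r -natr1; ring.
have := @ln_le_subr1 (r / (r + 1)); rewrite divr_gt0; [|lra|lra] => /(_ isT).
rewrite lnM ?posrE ?invr_gt0 ?lnV ?posrE; try lra.
have -> : r / (r + 1) - 1 = - (r + 1)^-1 by field; lra.
have : r^-1 <= 2 * (r + 1)^-1.
  rewrite -[2 * _]invrK invfM invrK lef_pV2 ?posrE ?mulr_gt0 ?invr_gt0; lra.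
lra.
Qed.

Variables (T : nat) (T0 delta : R).
Hypothesis T_ge1 : (1 <= T)%N.
Hypothesis T0_ge : 64 <= T0.
Hypothesis delta01 : 0 < delta < 1.

Let T1 : 1 <= T%:R :> R. Proof. by rewrite (ler_nat R 1). Qed.
Let TT0 : 64 <= T%:R + T0. Proof. by have := T1; have := T0_ge; lra. Qed.

Let ratio_ge1 : 1 <= T%:R * (T%:R + T0) / T0.
Proof.
have h : T0 <= T%:R + T0 by have := T1; lra.
rewrite ler_pdivlMr ?mul1r; last by have := T0_ge; lra.
by apply: (le_trans h); rewrite ler_peMl//; have := TT0; lra.
Qed.

Let ln2 : 0 < ln 2 :> R.
Proof. by have := ln2_ge_half; lra. Qed.

Lemma num_phases_ge1 : 1 <= num_phases T T0.
Proof.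
rewrite /num_phases lerDl ler0z ceil_ge0.
apply: (@lt_le_trans _ _ 0); first by lra.
by rewrite divr_ge0 ?ln_ge0// ler1n.
Qed.

Lemma ln_inv_delta_ge0 : 0 <= ln (1 / delta).
Proof.
have /andP[d0 d1] := delta01; rewrite ln_ge0// ler_pdivlMr// mul1r; lra.
Qed.

Lemma ln_offset_ge1 : 1 <= ln (expR 1 + T0).
Proof.
rewrite -[leLHS]expRK; apply: ln_nondecreasing; first exact: expR_gt0.
by rewrite lerDl; have := T0_ge; lra.
Qed.

Lemma Gamma_ge1 : 1 <= Gamma T T0 delta.
Proof.
have := ln_ge0 num_phases_ge1; have := ln_offset_ge1; have := ln_inv_delta_ge0.
rewrite /Gamma; lra.
Qed.

Lemma Gamma_ge_ln : ln (1 / delta) <= Gamma T T0 delta.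
Proof.
have := ln_ge0 num_phases_ge1; have := ln_offset_ge1; have := ln_inv_delta_ge0.
rewrite /Gamma; lra.
Qed.

Lemma ln_horizon_ge1 : 1 <= ln (T%:R + T0).
Proof.
rewrite -[leLHS]expRK; apply: ln_nondecreasing; first exact: expR_gt0.
have := expR1_le4; have := TT0; lra.
Qed.

Variables (d : nat) (q : R).
Hypothesis q_ge1 : 1 <= q.
Hypothesis T0_q : T0 = q * d%:R.
Let l := ln (expR 1 + d%:R + T%:R + 1 / delta).

Let d_ge0 : 0 <= d%:R :> R. Proof. exact: ler0n. Qed.
Let inv_delta : 1 <= 1 / delta.
Proof. by have /andP[d0 d1] := delta01; rewrite ler_pdivlMr// mul1r ltW. Qed.
Let e_gt0 : 0 < expR 1 :> R. Proof. exact: expR_gt0. Qed.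

Lemma polylog_ge1 : 1 <= l.
Proof.
rewrite -[leLHS]expRK; apply: ln_nondecreasing => //.
have := d_ge0; have := T1; have := inv_delta; lra.
Qed.

Lemma ln_inv_delta_le : ln (1 / delta) <= l.
Proof.
apply: ln_nondecreasing; first by have := inv_delta; lra.
have := d_ge0; have := T1; have := e_gt0; lra.
Qed.

Let ln_scaled y : 0 < y -> y <= q * (expR 1 + d%:R + T%:R + 1 / delta) ->
  ln y <= ln q + l.
Proof.
move=> y0 yq; apply: (le_trans (ln_nondecreasing y0 yq)).
have h1 := d_ge0; have h2 := T1; have h3 := inv_delta; have h4 := e_gt0.
by rewrite lnM ?posrE//; move: q_ge1; lra.
Qed.

Lemma ln_horizon_le : ln (T%:R + T0) <= (1 + ln q) * l.
Proof.
have h := ln_ge0 q_ge1; have l1 := polylog_ge1.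
apply: (@le_trans _ _ (ln q + l)).
  apply: ln_scaled; first by have := TT0; lra.
  rewrite T0_q !mulrDr.
  have h1 : T%:R <= q * T%:R by rewrite ler_peMl//; have := T1; lra.
  have h2 : 0 <= q * expR 1 by rewrite mulr_ge0// ?(ltW e_gt0)//; move: q_ge1; lra.
  have h3 : 0 <= q * (1 / delta) by rewrite mulr_ge0//; move: q_ge1 inv_delta; lra.
  lra.
have : ln q <= ln q * l by rewrite ler_peMr.
lra.
Qed.

(** Each summand of Gamma is at most logarithmic in the parameters. For the
    iterated logarithm ln (num_phases T T0) the crude bound num_phases T T0 - 1
    is enough. *)
Lemma Gamma_le : Gamma T T0 delta <= (8 + 3 * ln q) * l.
Proof.
have lq := ln_ge0 q_ge1; have l1 := polylog_ge1.
have a1 := ln_inv_delta_le; have a2 := ln_horizon_le.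
have lql : ln q <= ln q * l by rewrite ler_peMr.
have a3 : ln (expR 1 + T0) <= ln q + l.
  apply: ln_scaled; first by have := e_gt0; have := T0_ge; lra.
  rewrite T0_q !mulrDr.
  have h1 : expR 1 <= q * expR 1 by rewrite ler_peMl// ltW.
  have h2 : 0 <= q * T%:R by rewrite mulr_ge0//; move: q_ge1 T1; lra.
  have h3 : 0 <= q * (1 / delta) by rewrite mulr_ge0//; move: q_ge1 inv_delta; lra.
  lra.
have TT0' : 0 < T%:R + T0 by have := TT0; lra.
have T0' : 0 < T0 by have := T0_ge; lra.
have Tl : ln T%:R <= l.
  apply: ln_nondecreasing; first by have := T1; lra.
  by have := d_ge0; have := inv_delta; have := e_gt0; lra.
have a4 : ln (num_phases T T0) <= 1 + 2 * (l + (1 + ln q) * l).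
  apply: (le_trans (ln_le_subr1 _)); first by have := num_phases_ge1; lra.
  rewrite /num_phases.
  set y := ln _ / ln 2.
  have y_le : y <= 2 * (l + (1 + ln q) * l).
    have hln : ln (T%:R * (T%:R + T0) / T0) <= l + (1 + ln q) * l.
      apply: (@le_trans _ _ (ln (T%:R * (T%:R + T0)))).
        apply: ln_nondecreasing; first by have := ratio_ge1; lra.
        rewrite ler_pdivrMr// ler_peMr//; last by have := T0_ge; lra.
        by rewrite mulr_ge0// ltW.
      rewrite lnM ?posrE//; first by apply: lerD.
      by have := T1; lra.
    rewrite /y ler_pdivrMr//.
    apply: (le_trans hln); rewrite mulrAC ler_peMl//.
      by rewrite addr_ge0 ?mulr_ge0//; lra.
    by have := ln2_ge_half; lra.
  have := ltW (ceilB1_lt y); lra.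
rewrite /Gamma; lra.
Qed.

End Rates.

(** * Exceptional samples *)

Section NullSamples.
Context {R : realType} {d : nat} {dX : measure_display} {X : measurableType dX}.
Variables (D : probability X R) (L sigma : R) (f : 'rV[R]_d -> R).
Variables (F : 'rV[R]_d -> X -> R) (G : 'rV[R]_d -> X -> 'rV[R]_d).
Variable N : set X.
Hypothesis L_ge0 : 0 <= L.
Hypothesis mN : measurable N.
Hypothesis N0 : (D N = 0)%E.
Hypothesis F_smooth : forall s, ~ N s -> lipschitz_smooth L (F ^~ s).
Hypothesis F_grad : forall s x, ~ N s -> G x s = grad (F ^~ s) x.
Hypothesis mF : forall x, measurable_fun setT (F x).
Hypothesis G_mean : forall x i,
  has_expectation D (fun s => G x s 0 i) (grad f x 0 i).
Hypothesis G_exp : forall x la, 0 < la < sigma ^- 2 ->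
  ('E_D[fun s => expR (la * enorm (grad f x - G x s) ^+ 2)]
     <= (expR (la * sigma ^+ 2))%:E)%E.

(** Setting the sample function to 0 on the null set N makes every sample smooth
    and preserves measurability, without changing any expectation. *)
Definition purge (x : 'rV[R]_d) (s : X) : R := \1_(~` N) s * F x s.

Let indicN s : ~ N s -> \1_(~` N) s = 1 :> R.
Proof. by move=> Ns; rewrite indicE mem_set. Qed.

Let indicN0 s : N s -> \1_(~` N) s = 0 :> R.
Proof. by move=> Ns; rewrite indicE memNset//; exact. Qed.

Lemma purgeE x s : ~ N s -> purge x s = F x s.
Proof. by move=> Ns; rewrite /purge indicN// mul1r. Qed.

Let purge_bad s : N s -> purge ^~ s = cst 0.
Proof. by move=> Ns; apply/funext => x; rewrite /purge indicN0// mul0r. Qed.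

Let purge_good s : ~ N s -> purge ^~ s = F ^~ s.
Proof. by move=> Ns; apply/funext => x; exact: purgeE. Qed.

Let grad_cst0 (x : 'rV[R]_d) : grad (cst 0) x = 0.
Proof. by apply/rowP => i; rewrite !mxE derive_cst. Qed.

Lemma purge_smooth s : lipschitz_smooth L (purge ^~ s).
Proof.
have [Ns|Ns] := pselect (N s); last by rewrite purge_good//; exact: F_smooth.
rewrite purge_bad//; split => // x y.
by rewrite !grad_cst0 subr0 /enorm dotp0r sqrtr0 mulr_ge0// sqrtr_ge0.
Qed.

Lemma measurable_purge x : measurable_fun setT (purge x).
Proof.
by apply: measurable_funM => //; apply: measurable_indic; exact: measurableC.
Qed.

Let grad_purge x s : grad (purge ^~ s) x = \1_(~` N) s *: G x s.
Proof.
have [Ns|Ns] := pselect (N s).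
  by rewrite purge_bad// grad_cst0 indicN0// scale0r.
by rewrite purge_good// indicN// scale1r F_grad.
Qed.

Let noise x s : 'rV[R]_d := grad (purge ^~ s) x - grad f x.

Let noiseE x s i : noise x s 0 i = \1_(~` N) s * G x s 0 i - grad f x 0 i.
Proof. by rewrite /noise grad_purge !mxE. Qed.

Let mG x i : measurable_fun setT (fun s => G x s 0 i).
Proof. by have [/measurable_int/measurable_EFinP] := G_mean x i. Qed.

Let m1G x i : measurable_fun setT (fun s => \1_(~` N) s * G x s 0 i : R).
Proof.
by apply: measurable_funM => //; apply: measurable_indic; exact: measurableC.
Qed.

Let ae_good (A : X -> \bar R) (B : X -> \bar R) :
  (forall s, ~ N s -> A s = B s) -> ae_eq D setT A B.
Proof.
move=> AB; exists N; split => // s /= h; apply: contrapT => Ns; apply: h => _.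
exact: AB.
Qed.

Let int_1G x i : D.-integrable setT (fun s => (\1_(~` N) s * G x s 0%R i)%:E).
Proof.
have [Gi _] := G_mean x i; apply: le_integrable Gi => //.
  exact/measurable_EFinP.
move=> s _ /=; rewrite lee_fin normrM ler_piMl// indicE.
by case: (_ \in _); rewrite ?normr1 ?normr0.
Qed.

Lemma purge_noise_integrable x i :
  D.-integrable setT (fun s => (noise x s 0%R i)%:E).
Proof.
under eq_fun do rewrite noiseE EFinB.
by apply: integrableB => //; exact: finite_measure_integrable_cst.
Qed.

Lemma purge_noise_mean x i : (\int[D]_s (noise x s 0%R i)%:E = 0)%E.
Proof.
under eq_integral do rewrite noiseE EFinB.
rewrite integralB//; last exact: finite_measure_integrable_cst.
rewrite rint_cst (ae_eq_integral (fun s => (G x s 0%R i)%:E)).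
- by have [_] := G_mean x i; rewrite unlock => ->; rewrite subee.
- by [].
- exact/measurable_EFinP.
- exact/measurable_EFinP.
- by apply: ae_good => s Ns; rewrite indicN// mul1r.
Qed.

Lemma purge_noise_exp x la : 0 < la < sigma ^- 2 ->
  (\int[D]_s (expR (la * dotp (noise x s) (noise x s)))%:E <=
   (expR (la * sigma ^+ 2))%:E)%E.
Proof.
move=> /(G_exp x); rewrite unlock; apply: le_trans.
rewrite le_eqVlt; apply/orP; left; apply/eqP; apply: ae_eq_integral => //.
- apply/measurable_EFinP; apply: measurableT_comp => //.
  apply: measurable_funM => //; apply: measurable_sum => i.
  by apply: measurable_funM; under eq_fun do rewrite noiseE; exact: measurable_funB.
- apply/measurable_EFinP; apply: measurableT_comp => //.
  apply: measurable_funM => //; under eq_fun do rewrite enorm_sqr.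
  apply: measurable_sum => i.
  by apply: measurable_funM; under eq_fun do rewrite !mxE; exact: measurable_funB.
apply: ae_good => s Ns; rewrite enorm_sqr /noise grad_purge indicN// scale1r.
by rewrite -opprB dotpNl dotpNr opprK.
Qed.

End NullSamples.

Lemma eq_zo_sgd {R : realType} {d : nat} {X : Type} (F H : 'rV[R]_d -> X -> R)
    (L mu : R) (T : nat) (x0 : 'rV[R]_d) (u : nat -> 'rV[R]_d) (xi : nat -> X) t :
  (forall s x, (s < t)%N -> F x (xi s) = H x (xi s)) ->
  zo_sgd F L mu T x0 u xi t = zo_sgd H L mu T x0 u xi t.
Proof.
elim: t => //= t IH FH; rewrite IH; last by move=> s x st; exact/FH/ltnW.
by rewrite /two_point_estimate !FH.
Qed.

(** Almost surely no draw falls into the null set, and then the trajectory is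
    the one of the purged sample functions. *)
Lemma avoid_null_draws {R : realType} {dW dX : measure_display}
    {W : measurableType dW} {X : measurableType dX} (P : probability W R)
    (xi : nat -> {RV P >-> X}) (N : set X) (E : set W) (n : nat) :
  measurable N -> (forall t, (t < n)%N -> P (xi t @^-1` N) = 0%E) -> measurable E ->
  measurable (E `&` [set w | forall t, (t < n)%N -> ~ N (xi t w)]) /\
  (P (E `&` [set w | forall t, (t < n)%N -> ~ N (xi t w)]) = P E)%E.
Proof.
move=> mN + mE; elim: n => [_|n IH nul].
  by rewrite (_ : [set w | _] = setT) ?setIT//; apply/seteqP; split.
have [mA PA] := IH (fun t tn => nul t (ltnW tn)).
set A := E `&` _ in mA PA.
have mB : measurable (xi n @^-1` N).
  rewrite -[X in measurable X]setTI.
  exact: (@measurable_funPT _ _ _ _ (xi n) measurableT _ mN).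
have -> : E `&` [set w | forall t, (t < n.+1)%N -> ~ N (xi t w)] =
    A `\` (xi n @^-1` N).
  apply/seteqP; split => [w [Ew h]|w [[Ew h] hn]].
    by split; [split => // t tn; apply: h; exact: ltnW|exact: h].
  split=> // t; rewrite ltnS leq_eqVlt => /orP[/eqP ->|]; [exact: hn|exact: h].
split; first exact: measurableD.
rewrite measureD//; last first.
  by apply: (@le_lt_trans _ _ 1%E); [exact: probability_le1|exact: ltry].
rewrite (@subset_measure0 _ _ _ P (A `&` xi n @^-1` N) (xi n @^-1` N))//.
- by rewrite sube0.
- exact: measurableI.
- exact: nul.
Qed.

(** * The convergence rate *)

Section Constants.
Context {R : realType}.
Variables (kappa L mu sigma : R).
Hypotheses (hkappa : 0 < kappa) (hmu : 0 < mu) (hL : mu <= L) (hsigma : 0 < sigma).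

(** The ratio p / Gamma. Its value makes the admissibility condition
    4 kurtosis_bound p <= d equivalent to kappa Gamma <= T0. *)
Definition moment_rate : R := mu * kappa / (128 * L * kurtosis_bound).

(** The sum of the lower bounds that the potential requires of K. The last of
    them concerns K p, and p is at least moment_rate since Gamma is at least
    1. *)
Definition noise_constant : R :=
  256 * sigma ^+ 2 / mu + 384 * L ^+ 2 / mu +
  2 * (512 * L * sigma ^+ 2 / mu ^+ 2 + 48 * L ^+ 2 / mu) / moment_rate.

Definition rate_constant : R :=
  expR (moment_rate^-1) * (1 + 3 * noise_constant * moment_rate).

Let L0 : 0 < L. Proof. exact: lt_le_trans hL. Qed.
Let num n : 0 < n.+1%:R :> R. Proof. exact: ltr0Sn. Qed.
Let C40 : 0 < kurtosis_bound :> R. Proof. by rewrite /kurtosis_bound; lra. Qed.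

Lemma moment_rate_gt0 : 0 < moment_rate.
Proof.
exact: divr_gt0 (mulr_gt0 hmu hkappa) (mulr_gt0 (mulr_gt0 (num _) L0) C40).
Qed.

Let C10 : 0 < 512 * L * sigma ^+ 2 / mu ^+ 2 + 48 * L ^+ 2 / mu.
Proof.
exact: addr_gt0
  (divr_gt0 (mulr_gt0 (mulr_gt0 (num _) L0) (exprn_gt0 2 hsigma)) (exprn_gt0 2 hmu))
  (divr_gt0 (mulr_gt0 (num _) (exprn_gt0 2 L0)) hmu).
Qed.

Let a0 : 0 < 256 * sigma ^+ 2 / mu.
Proof. exact: divr_gt0 (mulr_gt0 (num _) (exprn_gt0 2 hsigma)) hmu. Qed.
Let b0 : 0 < 384 * L ^+ 2 / mu.
Proof. exact: divr_gt0 (mulr_gt0 (num _) (exprn_gt0 2 L0)) hmu. Qed.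
Let c0 : 0 < 2 * (512 * L * sigma ^+ 2 / mu ^+ 2 + 48 * L ^+ 2 / mu) / moment_rate.
Proof. exact: divr_gt0 (mulr_gt0 (num _) C10) moment_rate_gt0. Qed.

Lemma noise_constant_gt0 : 0 < noise_constant.
Proof. by rewrite /noise_constant !addr_gt0. Qed.

Lemma noise_constant_sigma : 256 * sigma ^+ 2 <= noise_constant * mu.
Proof.
rewrite -ler_pdivrMr// /noise_constant.
by move: (ltW b0) (ltW c0); lra.
Qed.

Lemma noise_constant_L : 384 * L ^+ 2 <= noise_constant * mu.
Proof.
rewrite -ler_pdivrMr// /noise_constant.
by move: (ltW a0) (ltW c0); lra.
Qed.

Lemma noise_constant_rate :
  2 * (512 * L * sigma ^+ 2 / mu ^+ 2 + 48 * L ^+ 2 / mu) <=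
  noise_constant * moment_rate.
Proof.
rewrite -ler_pdivrMr ?moment_rate_gt0// /noise_constant.
by move: (ltW a0) (ltW b0); lra.
Qed.

Lemma moment_rate_kurtosis : 4 * kurtosis_bound * moment_rate = mu * kappa / (32 * L).
Proof.
rewrite /moment_rate; move: kurtosis_bound C40 => C4 C40'.
by field; rewrite !gt_eqF.
Qed.

(** Here q d is T0, and the factors 8 + 3 ln q and 1 + ln q bound Gamma and
    ln (T + T0) by multiples of the logarithm in the polylogarithmic rate. *)
Definition polylog_constant (Delta0 : R) : R :=
  let q := 32 * L / mu in
  expR (moment_rate^-1) * (q * Delta0 + 3 * noise_constant * moment_rate *
    ((8 + 3 * ln q) * (1 + ln q))).

End Constants.

Theorem corollary2 (R : realType) (kappa L mu sigma : R)
    (hkappa : 0 < kappa) (hmu : 0 < mu) (hL : mu <= L) (hsigma : 0 < sigma) :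
  exists (C : R) (k : nat) (C' : R -> R),
  forall (d T : nat) (delta : R)
    (dX : measure_display) (X : measurableType dX) (D : probability X R)
    (f : 'rV[R]_d -> R) (F : 'rV[R]_d -> X -> R)
    (G : borel_rV R d -> X -> borel_rV R d)
    (x0 xstar : 'rV[R]_d)
    (dW : measure_display) (W : measurableType dW) (P : probability W R)
    (u : nat -> {RV P >-> borel_rV R d}) (xi : nat -> {RV P >-> X}),
  (2 <= d)%N -> (1 <= T)%N -> 0 < delta < 1 ->
  (* f is the expectation of F(., s), s distributed according to D *)
  (forall x, has_expectation D (F x) (f x)) ->
  smooth_strongly_convex L mu f ->
  unique_minimizer f xstar ->
  x0 != xstar ->
  (* G is the jointly measurable version of the sample gradient *)
  (\forall s \ae D, lipschitz_smooth L (F ^~ s) /\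
     forall x, G x s = grad (F ^~ s) x) ->
  measurable_fun setT (fun p : borel_rV R d * X => G p.1 p.2) ->
  (forall (x : 'rV[R]_d) (i : 'I_d),
     has_expectation D (fun s => (G x s : 'rV[R]_d) 0 i) (grad f x 0 i)) ->
  (forall (x : 'rV[R]_d) (lambda : R), 0 < lambda < sigma ^- 2 ->
     ('E_D[fun s => expR (lambda * enorm (grad f x - G x s) ^+ 2)]
        <= (expR (lambda * sigma ^+ 2))%:E)%E) ->
  (* the random draws of the algorithm *)
  (forall t, (t < T)%N -> std_gaussian (distribution P (u t))) ->
  (forall t, (t < T)%N -> forall B, measurable B ->
     distribution P (xi t) B = D B) ->
  independent_draws T u xi ->
  let T0 := offset (d := d) L mu in
  let Delta0 := f x0 - f xstar in
  let xT w := zo_sgd F L mu T x0 (fun t => u t w) (fun t => xi t w) T in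
  kappa * Gamma T T0 delta <= T0 ->
  exists E : set W,
    [/\ measurable E,
        ((1 - delta)%:E <= P E)%E,
        forall w, E w -> f (xT w) - f xstar <= C * error_bound d T T0 delta Delta0
      & forall w, E w ->
          f (xT w) - f xstar <= C' Delta0 * polylog_rate k d T delta].
Proof.
have L0 : 0 < L by exact: lt_le_trans hL.
pose c := moment_rate kappa L mu; pose K := noise_constant kappa L mu sigma.
have c0 : 0 < c by exact: moment_rate_gt0.
have K0 : 0 < K by exact: noise_constant_gt0.
exists (rate_constant kappa L mu sigma), 2%N, (polylog_constant kappa L mu sigma).
move=> d T delta dX X D f F G x0 xstar dW W P u xi d2 T1 delta01 F_mean fssc fmin _
  [N [mN N0 subN]] _ G_mean G_exp u_gauss xi_law indep T0 Delta0 xT Gamma_T0.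
have good s : ~ N s -> lipschitz_smooth L (F ^~ s) /\ forall x, G x s = grad (F ^~ s) x.
  by move=> Ns; apply: contrapT => h; apply: Ns; exact: subN.
have F_smooth s (Ns : ~ N s) := (good s Ns).1.
have F_grad s x (Ns : ~ N s) := (good s Ns).2 x.
have mF x : measurable_fun setT (F x).
  by have [/measurable_int/measurable_EFinP] := F_mean x.
have d0 : 0 < d%:R :> R by rewrite ltr0n (leq_trans _ d2).
have T0E : T0 = 32 * L / mu * d%:R.
  by rewrite /T0 /offset; field; rewrite gt_eqF.
have q32 : 32 <= 32 * L / mu by rewrite ler_pdivlMr// ler_pM2l.
have d2R : 2 <= d%:R :> R by rewrite (ler_nat R 2).
have T0_64 : 64 <= T0.
  rewrite T0E (_ : 64 = 32 * 2); last by rewrite -natrM.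
  by apply: ler_pM.
have T1R : 1 <= T%:R :> R by rewrite (ler_nat R 1).
set Gm := Gamma T T0 delta in Gamma_T0.
have Gm1 : 1 <= Gm by exact: Gamma_ge1.
pose p := c * Gm.
have p0 : 0 < p by rewrite mulr_gt0//; lra.
have p_le_d : 4 * kurtosis_bound * p <= d%:R.
  rewrite /p mulrA /c moment_rate_kurtosis//.
  have -> : mu * kappa / (32 * L) * Gm = mu / (32 * L) * (kappa * Gm) by ring.
  apply: (@le_trans _ _ (mu / (32 * L) * T0)).
    by rewrite ler_wpM2l// divr_ge0 ?mulr_ge0 ?(ltW L0) ?(ltW hmu).
  rewrite T0E le_eqVlt; apply/orP; left; apply/eqP.
  by field; rewrite !gt_eqF.
have K_p : 2 * (512 * L * sigma ^+ 2 / mu ^+ 2 + 48 * L ^+ 2 / mu) <= K * p.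
  rewrite /p (mulrA K); apply: (le_trans (noise_constant_rate hkappa hmu hL hsigma)).
  rewrite ler_peMr//; apply: mulr_ge0; exact: ltW.
have [E [mE PE ES]] := potential_high_probability x0 d2 fssc fmin hsigma hmu hL
  (purge_smooth (ltW L0) F_smooth) (measurable_purge mN mF)
  (purge_noise_integrable mN F_grad G_mean)
  (purge_noise_mean mN N0 F_grad G_mean)
  (purge_noise_exp mN N0 F_grad G_mean G_exp)
  u_gauss xi_law indep p0 p_le_d K0 (noise_constant_sigma hkappa hmu hL hsigma)
  (noise_constant_L hkappa hmu hL hsigma) K_p delta01.
have [mE' PE'] := @avoid_null_draws _ _ _ _ _ P xi N E T mN
  (fun t tT => etrans (xi_law t tT N mN) N0) mE.
set TT := T%:R + T0; have TT0 : 0 < TT by rewrite /TT; lra.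
have D0 : 0 <= Delta0 by rewrite subr_ge0; exact: minimizer_le.
have Lam1 : 1 <= ln TT by exact: ln_horizon_ge1.
pose bound := expR (c^-1) * (T0 * Delta0 + 3 * K * c * (d%:R * ln TT * Gm)).
have gap_bound w : (E `&` [set w | forall t, (t < T)%N -> ~ N (xi t w)]) w ->
    f (xT w) - f xstar <= bound / TT.
  move=> [Ew Nw].
  have -> : xT w = zo_sgd (purge F N) L mu T x0 (fun t => u t w) (fun t => xi t w) T.
    by apply: eq_zo_sgd => s x sT; rewrite purgeE//; exact: Nw.
  rewrite ler_pdivlMr// mulrC.
  apply: (le_trans (gap_le_potential d2 f xstar hmu hL T p0 K0 T _)).
  apply: (le_trans (ES w Ew)); rewrite /bound; apply: ler_pM.
  - exact: expR_ge0.
  - exact: ltW (potential_gt0 d2 fmin hmu hL T p0 K0 0 x0).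
  - rewrite ler_expR ler_pdivrMr// /p mulrA mulVf ?gt_eqF// [leRHS]mul1r.
    exact: Gamma_ge_ln.
  rewrite /potential -/T0 add0r lerD2l /p.
  have hb : noise_budget (d := d) L mu T 0 <= 3 * ln TT.
    have T01 : 1 <= T0 by lra.
    have := sum_inv_le_ln T T01; rewrite /noise_budget -/T0 -/TT; lra.
  have -> : 3 * K * c * (d%:R * ln TT * Gm) = K * d%:R * (c * Gm) * (3 * ln TT) by ring.
  by apply: (ler_wpM2l _ hb); exact: mulr_ge0 (mulr_ge0 (ltW K0) (ltW d0)) (ltW p0).
have e0 : 0 < expR (c^-1) by exact: expR_gt0.
have Kc0 : 0 <= 3 * K * c by exact: mulr_ge0 (mulr_ge0 (ler0n _ 3) (ltW K0)) (ltW c0).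
have Gm0 : 0 <= Gm by exact: le_trans ler01 Gm1.
have Lam0 : 0 <= ln TT by exact: le_trans ler01 Lam1.
have dLG0 : 0 <= d%:R * ln TT * Gm by exact: mulr_ge0 (mulr_ge0 (ltW d0) Lam0) Gm0.
have T0_gt0 : 0 < T0 by exact: lt_le_trans T0_64.
have TD0 : 0 <= T0 * Delta0 by exact: mulr_ge0 (ltW T0_gt0) D0.
exists (E `&` [set w | forall t, (t < T)%N -> ~ N (xi t w)]); split => //.
- by rewrite PE'.
- move=> w Ew; apply: (le_trans (gap_bound w Ew)).
  rewrite /error_bound -/Gm -/TT /rate_constant -/c -/K.
  have -> : T0 * Delta0 / TT + d%:R * ln TT * Gm / TT * (1 + Gm / T0) =
    (T0 * Delta0 + d%:R * ln TT * Gm * (1 + Gm / T0)) / TT by ring.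
  rewrite [leRHS]mulrA ler_pM2r ?invr_gt0// /bound -[leRHS]mulrA ler_pM2l//.
  have h1 : d%:R * ln TT * Gm <= d%:R * ln TT * Gm * (1 + Gm / T0).
    by rewrite ler_peMr// lerDl; exact: divr_ge0 Gm0 (ltW T0_gt0).
  have h2 := ler_wpM2l Kc0 h1; have h3 : 0 <= 3 * K * c * (T0 * Delta0) by exact: mulr_ge0.
  lra.
move=> w Ew; apply: (le_trans (gap_bound w Ew)).
rewrite /polylog_rate /polylog_constant -/c -/K.
set q := 32 * L / mu in T0E q32 *; set l := ln (expR 1 + _ + _ + _).
have q1 : 1 <= q by lra.
have l1 : 1 <= l by exact: polylog_ge1.
have lq0 : 0 <= ln q by exact: ln_ge0.
have hG : Gm <= (8 + 3 * ln q) * l by exact: Gamma_le.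
have hLam : ln TT <= (1 + ln q) * l by exact: ln_horizon_le.
apply: (@le_trans _ _ (bound / T%:R)).
  rewrite ler_wpM2l//; first by rewrite mulr_ge0 ?(ltW e0)// addr_ge0// mulr_ge0.
  by rewrite lef_pV2 ?posrE//; rewrite /TT; lra.
rewrite /bound.
have -> : expR c^-1 * (T0 * Delta0 + 3 * K * c * (d%:R * ln TT * Gm)) / T%:R =
  expR c^-1 * (q * Delta0 + 3 * K * c * (Gm * ln TT)) * (d%:R / T%:R).
  by rewrite T0E; ring.
have -> : expR c^-1 * (q * Delta0 + 3 * K * c * ((8 + 3 * ln q) * (1 + ln q))) *
    (d%:R / T%:R * l ^+ 2) =
  expR c^-1 * (q * Delta0 * l ^+ 2 + 3 * K * c * (((8 + 3 * ln q) * l) * ((1 + ln q) * l))) *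
  (d%:R / T%:R) by ring.
apply: ler_wpM2r; first by rewrite divr_ge0 ?ler0n.
rewrite ler_pM2l//; apply: lerD.
  by rewrite ler_peMr ?exprn_ege1// mulr_ge0//; lra.
by apply: ler_wpM2l => //; apply: ler_pM => //; lra.
Qed.
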